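(* For each integer $n\ge 0$ let $$P_{n,\mathrm{tun}}=\frac{2}{\pi^{1/2}\,2^n\,n!}\int_{\sqrt{2n+1}}^{\infty}\left(H_n(x)\,e^{-x^2/2}\right)^2\,dx .$$ Then, as $n\to\infty$, $$P_{n,\mathrm{tun}}=\frac{1}{n^{1/3}}\left(2\int_0^\infty \mathrm{Ai}^2(t)\,dt-\frac{2}{5\,n^{2/3}}\int_0^\infty t\,\mathrm{Ai}^2(t)\,dt\right)+O(n^{-4/3}).$$
   Context: $H_n$ denotes the (physicists') Hermite polynomial $H_n(x)=(-1)^n e^{x^2}\frac{d^n}{dx^n}e^{-x^2}$, and $\mathrm{Ai}$ is the Airy function of the first kind (the solution of $y''=ty$ decaying as $t\to+\infty$, with $\mathrm{Ai}(0)=\frac{1}{3^{2/3}\Gamma(2/3)}$). The number $P_{n,\mathrm{tun}}$ is the probability that a quantum harmonic oscillator with Hamiltonian $\hat H=\frac12(\hat p^2+\hat x^2)$, $[\hat x,\hat p]=i$, in its $n$-th normalized energy eigenstate $\psi_n(x)=\pi^{-1/4}(2^n n!)^{-1/2}H_n(x)e^{-x^2/2}$, is found in the classically forbidden region $|x|>\sqrt{2n+1}$. *)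

(* Defs.v *)
From Stdlib Require Import Reals Factorial.
From Coquelicot Require Import Coquelicot.
Open Scope R_scope.

Definition hermite (n : nat) (x : R) : R :=
  (-1) ^ n * exp (x ^ 2) * Derive_n (fun y => exp (- y ^ 2)) n x.

(* [at_right 0] makes the integral improper at 0 as well, as needed for
   [s < 1]. *)
Definition Gamma (s : R) : R :=
  RInt_gen (fun t => Rpower t (s - 1) * exp (- t))
    (at_right 0) (Rbar_locally p_infty).

(* [is_derive_n y 2] alone would not ensure that [y] is differentiable, since
   [Derive] is total. *)
Definition airy_equation (y : R -> R) : Prop :=
  forall t : R, ex_derive y t /\ is_derive_n y 2 t (t * y t).

(* These conditions have exactly one solution: the solutions of the equation
   that tend to 0 at +oo form a line, on which the value at 0 is a coordinate. *)
Definition is_airy (Ai : R -> R) : Prop :=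
  airy_equation Ai /\
  is_lim Ai p_infty 0 /\
  Ai 0 = 1 / (Rpower 3 (2 / 3) * Gamma (2 / 3)).

Definition P_tun (n : nat) : R :=
  2 / (sqrt PI * 2 ^ n * INR (fact n)) *
  RInt_gen (fun x => (hermite n x * exp (- x ^ 2 / 2)) ^ 2)
    (at_point (sqrt (2 * INR n + 1))) (Rbar_locally p_infty).

Definition big_O (u v : nat -> R) : Prop :=
  exists C : R, eventually (fun n => Rabs (u n) <= C * Rabs (v n)).

(* Main.v *)
Require Import Defs.
From Stdlib Require Import Reals Factorial Lra Lia Psatz.
From Coquelicot Require Import Coquelicot.
Open Scope R_scope.

(** With [u = 2 n + 1], the function [g(x) = H_n(x) exp(-x^2/2)] solves
    [g'' = (x^2 - u) g] and is recessive at infinity, where its leading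
    coefficient [2^n] is known; no connection through the oscillatory region is
    needed. Put [x = sqrt u * cosh th] and let [S(th)] be the Liouville-Green
    phase. The Langer variable [zeta = (3/2 u S)^(2/3)] turns the equation into
    the Airy equation up to an error term that is bounded and integrable in
    [th], so the ratio of [g] to [zeta^(1/4) sinh^(-1/2) Ai(zeta)] equals its
    limit at infinity up to a relative error [O(1/n)], uniformly on the forbidden
    region. There
    [g^2 dx = const * (1 - zeta / (5 b) + O(zeta^2/b^2)) Ai(zeta)^2 dzeta] with
    [b = (n + 1/2)^(2/3)], and integrating gives both terms. The constant
    requires Stirling's formula and [Ai t ~ t^(-1/4) exp(-2/3 t^(3/2)) / (2 sqrt PI)].
    The latter is derived from the value [Ai 0] by computing the integrals of
    [t^(3k+2) Ai t] in two ways: exactly, by the recursion coming from the Airy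
    equation, and asymptotically as [k] grows. *)

(** Near infinity no integral equation is solved. Each estimate shows that some explicit quantity is
    monotone, and the wrong sign is excluded because a bounded function would then grow at least
    linearly. The gain of 1/n has the same source. The ratio h of the Hermite function to its Airy
    approximation satisfies (p h')' = - E sinh^2 p h, where E is bounded by a multiple of exp(-th)
    and p' <= - 2 u sinh^2 p. The decay rate of the weight p carries the large parameter u, so h' is
    O(1/u) times a bound of h; a maximum argument supplies that bound. The exponents 3k+2 are
    forced: the recursion takes them down to Ai 0, while the other classes modulo 3 start from the
    integral of Ai and from Ai' 0. The Gamma-type values that occur lie between factorials, and
    log-convexity brackets them up to a relative error O(1/k), which is enough for a constant
    independent of k. The coefficient 1/5 comes from (3 S)^(2/3) = v^2 (1 - v^2/5 + ...), where S is
    the phase and v = sinh th. The overall factor is of order n^(-1/3), so relative errors O(1/n)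
    become O(n^(-4/3)). *)

Ltac unfold_ball := unfold ball; simpl; unfold AbsRing_ball, abs, minus, plus, opp; simpl.

Ltac unfold_ball_in H :=
  unfold ball in H; simpl in H; unfold AbsRing_ball, abs, minus, plus, opp in H; simpl in H.

(** * Monotonicity and growth from bounds on derivatives *)

Lemma incr_seg (f df : R -> R) (x y : R) :
  x <= y ->
  (forall z, x <= z <= y -> is_derive f z (df z)) ->
  (forall z, x <= z <= y -> 0 <= df z) -> f x <= f y.
Proof.
intros Hxy Hd Hp.
destruct (MVT_gen f x y df) as [c [Hc He]].
- intros z Hz. rewrite Rmin_left, Rmax_right in Hz by lra. apply Hd; lra.
- intros z Hz. rewrite Rmin_left, Rmax_right in Hz by lra.
  apply continuity_pt_filterlim. apply (ex_derive_continuous f).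
  exists (df z). apply Hd; lra.
- rewrite Rmin_left, Rmax_right in Hc by lra.
  specialize (Hp c Hc). nra.
Qed.

Lemma decr_seg (f df : R -> R) (x y : R) :
  x <= y ->
  (forall z, x <= z <= y -> is_derive f z (df z)) ->
  (forall z, x <= z <= y -> df z <= 0) -> f y <= f x.
Proof.
intros Hxy Hd Hp.
cut (- f x <= - f y); [lra|].
apply (incr_seg (fun z => - f z) (fun z => - df z)); trivial.
- intros z Hz. apply (is_derive_opp f), Hd, Hz.
- intros z Hz. specialize (Hp z Hz). lra.
Qed.

Lemma linear_growth (f df : R -> R) (x y m : R) :
  x <= y ->
  (forall z, x <= z <= y -> is_derive f z (df z)) ->
  (forall z, x <= z <= y -> m <= df z) -> f x + m * (y - x) <= f y.
Proof.
intros Hxy Hd Hp.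
cut (f x - m * x <= f y - m * y); [lra|].
apply (incr_seg (fun z => f z - m * z) (fun z => df z - m)); trivial.
- intros z Hz. apply (is_derive_minus f (fun z => m * z) z (df z) m (Hd z Hz)).
  auto_derive; trivial; ring.
- intros z Hz. specialize (Hp z Hz). lra.
Qed.

Lemma is_lim_p_infty_eventually (f : R -> R) (l eps : R) :
  is_lim f p_infty l -> 0 < eps ->
  exists T, forall t, T < t -> Rabs (f t - l) < eps.
Proof.
intros H He. apply is_lim_spec in H. destruct (H (mkposreal eps He)) as [T HT].
exists T. exact HT.
Qed.

(** The device behind the arguments at infinity: a quantity of the wrong sign is shown to force such
    a function [f]. *)
Lemma unbounded_of_derive_ge (f df : R -> R) (a m b : R) :
  0 < m ->
  (forall z, a <= z -> is_derive f z (df z)) ->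
  (forall z, a <= z -> m <= df z) ->
  (forall z, a <= z -> f z <= b) -> False.
Proof.
intros Hm Hd Hp Hb.
set (y := a + Rabs (b - f a) / m + 1).
assert (0 <= Rabs (b - f a) / m).
{ apply Rmult_le_pos; [apply Rabs_pos|left; now apply Rinv_0_lt_compat]. }
assert (Hy : a <= y) by (unfold y; lra).
assert (H1 := linear_growth f df a y m Hy (fun z Hz => Hd z (proj1 Hz)) (fun z Hz => Hp z (proj1 Hz))).
specialize (Hb y Hy).
assert (m * (y - a) = Rabs (b - f a) + m) by (unfold y; field; lra).
assert (H2 := Rle_abs (b - f a)). lra.
Qed.

Ltac subst_derive f H z :=
  change (Derive (fun x => f x) z) with (Derive f z);
  rewrite (is_derive_unique f z _ (H z)).

Lemma exp_mono x y : x <= y -> exp x <= exp y.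
Proof. intros [H| ->]; [left; now apply exp_increasing|right; reflexivity]. Qed.

Lemma ln_1p_le_id x : 0 <= x -> ln (1 + x) <= x.
Proof.
intros Hx. rewrite <- (ln_exp x) at 2. apply ln_le; [lra|apply exp_ineq1_le].
Qed.

Ltac pos := repeat match goal with
  | |- 0 < _ * _ => apply Rmult_lt_0_compat
  | |- 0 < _ / _ => apply Rdiv_lt_0_compat
  | |- 0 < / _ => apply Rinv_0_lt_compat
  | |- 0 < _ ^ _ => apply pow_lt
  | |- 0 < Rpower _ _ => apply exp_pos
  | |- 0 < exp _ => apply exp_pos
  | |- 0 < sqrt _ => apply sqrt_lt_R0
  end; trivial; try lra.

(** * The Airy function at infinity *)

(** Only positivity at 0 is kept of the normalization, so what follows holds for every positive
    multiple of Ai. The value at 0 enters again when the connection coefficient is computed. *)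
Record decaying_airy (A D : R -> R) : Prop := {
  airy_D1 : forall t, is_derive A t (D t);
  airy_D2 : forall t, is_derive D t (t * A t);
  airy_lim : is_lim A p_infty 0;
  airy_pos0 : 0 < A 0 }.

(** The derivative of A D is D^2 + t A^2 >= 0. A positive value of A D would persist and make A^2
    grow at least linearly, against the decay of A. *)
Lemma airy_prod_le0 A D : decaying_airy A D -> forall t, 0 <= t -> A t * D t <= 0.
Proof.
intros [H1 H2 H3 _] t0 Ht0.
destruct (Rle_lt_dec (A t0 * D t0) 0) as [|Hpos]; trivial. exfalso.
assert (HF : forall z, is_derive (fun z => A z * D z) z (D z ^ 2 + z * A z ^ 2)).
{ intros z. evar_last.
  - apply (is_derive_mult A D z _ _ (H1 z) (H2 z)). intros; apply Rmult_comm.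
  - unfold plus, mult; simpl. ring. }
assert (Hge : forall z, t0 <= z -> A t0 * D t0 <= A z * D z).
{ intros z Hz. apply (incr_seg (fun z => A z * D z) (fun z => D z ^ 2 + z * A z ^ 2)).
  - exact Hz.
  - intros; apply HF.
  - intros y Hy. nra. }
destruct (is_lim_p_infty_eventually A 0 1 H3) as [T HT]; [lra|].
set (a := Rmax t0 (T + 1)).
assert (t0 <= a /\ T + 1 <= a) as [Ha1 Ha2] by (split; [apply Rmax_l|apply Rmax_r]).
apply (unbounded_of_derive_ge (fun z => A z ^ 2) (fun z => 2 * (A z * D z)) a (2 * (A t0 * D t0)) 1).
- lra.
- intros z _. evar_last.
  + apply (is_derive_pow A 2 z _ (H1 z)).
  + simpl. ring.
- intros z Hz. specialize (Hge z ltac:(lra)). lra.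
- intros z Hz. specialize (HT z ltac:(lra)). apply Rabs_def2 in HT. nra.
Qed.

(** By [airy_prod_le0] the square A^2 does not increase, so A vanishes beyond any zero. Then A and D
    both vanish at a point, and backward uniqueness contradicts A 0 > 0. *)
Lemma airy_neq0 A D : decaying_airy A D -> forall t, 0 <= t -> A t <> 0.
Proof.
intros H t0 Ht0 HA0. assert (Hle := airy_prod_le0 A D H).
destruct H as [H1 H2 H3 H4].
assert (Hz : forall z, t0 <= z -> A z = 0).
{ intros z Hz.
  assert (A z ^ 2 <= A t0 ^ 2).
  { apply (decr_seg (fun z => A z ^ 2) (fun z => 2 * (A z * D z))); trivial.
    - intros y _. evar_last.
      + apply (is_derive_pow A 2 y _ (H1 y)).
      + simpl. ring.
    - intros y Hy. specialize (Hle y ltac:(lra)). lra. }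
  rewrite HA0 in H. nra. }
set (t1 := t0 + 1).
assert (HD : D t1 = 0).
{ rewrite <- (is_derive_unique _ _ _ (H1 t1)). apply is_derive_unique.
  apply (is_derive_ext_loc (fun _ => 0)); [|apply (@is_derive_const R_AbsRing R_NormedModule)].
  exists (mkposreal 1 Rlt_0_1). intros y Hy. symmetry. apply Hz.
  unfold_ball_in Hy.
  apply Rabs_def2 in Hy. unfold t1 in *; lra. }
(* Gronwall: the derivative of A^2 + D^2 is 2 (1 + z) A D >= - (1 + z)(A^2 + D^2), and exp(z +
   z^2/2) is the integrating factor. *)
assert (HF : (A 0 ^ 2 + D 0 ^ 2) * exp (0 + 0 ^ 2 / 2) <= (A t1 ^ 2 + D t1 ^ 2) * exp (t1 + t1 ^ 2 / 2)).
{ apply (incr_seg (fun z => (A z ^ 2 + D z ^ 2) * exp (z + z ^ 2 / 2))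
     (fun z => (2 * (A z * D z) * (1 + z) + (A z ^ 2 + D z ^ 2) * (1 + z)) * exp (z + z ^ 2 / 2))).
  - unfold t1; lra.
  - intros z Hz'. auto_derive.
    + repeat split; [exists (D z); apply H1|exists (z * A z); apply H2].
    + subst_derive A H1 z; subst_derive D H2 z. unfold Rdiv; simpl; field.
  - intros z Hz'. apply Rmult_le_pos; [|left; apply exp_pos].
    replace (2 * (A z * D z) * (1 + z) + (A z ^ 2 + D z ^ 2) * (1 + z))
      with ((A z + D z) ^ 2 * (1 + z)) by ring.
    apply Rmult_le_pos; [apply pow2_ge_0|lra]. }
rewrite HD, (Hz t1) in HF by (unfold t1; lra).
replace (0 + 0 ^ 2 / 2) with 0 in HF by field. rewrite exp_0 in HF. nra.
Qed.

Lemma airy_pos A D : decaying_airy A D -> forall t, 0 <= t -> 0 < A t.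
Proof.
intros H t Ht. destruct (Rlt_le_dec 0 (A t)) as [|Hle]; trivial. exfalso.
assert (H0 := airy_pos0 A D H).
destruct (IVT_gen A 0 t 0) as [x [Hx HAx]].
- intros x. apply continuity_pt_filterlim. apply (ex_derive_continuous A).
  exists (D x). apply H.
- rewrite Rmin_right, Rmax_left by lra. lra.
- rewrite Rmin_left in Hx by lra. apply (airy_neq0 A D H x); lra.
Qed.

Lemma airy_deriv_le0 A D : decaying_airy A D -> forall t, 0 <= t -> D t <= 0.
Proof.
intros H t Ht. assert (H1 := airy_pos A D H t Ht). assert (H2 := airy_prod_le0 A D H t Ht). nra.
Qed.

(** The derivative of t A^2 - D^2 is A^2 >= 0. A positive value m would persist and bound (A D)' =
    D^2 + t A^2 below by m, although A D <= 0. *)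
Lemma airy_deriv_sq_ge A D : decaying_airy A D -> forall t, 0 <= t -> t * A t ^ 2 <= D t ^ 2.
Proof.
intros H t0 Ht0. assert (Hle := airy_prod_le0 A D H). destruct H as [H1 H2 _ _].
destruct (Rle_lt_dec (t0 * A t0 ^ 2) (D t0 ^ 2)) as [|Hlt]; trivial. exfalso.
set (m := t0 * A t0 ^ 2 - D t0 ^ 2).
assert (Hm : forall z, t0 <= z -> m <= z * A z ^ 2 - D z ^ 2).
{ intros z Hz. apply (incr_seg (fun z => z * A z ^ 2 - D z ^ 2) (fun z => A z ^ 2)); trivial.
  - intros y _. auto_derive.
    + repeat split; [exists (D y); apply H1|exists (y * A y); apply H2].
    + subst_derive A H1 y; subst_derive D H2 y. ring.
  - intros; apply pow2_ge_0. }
apply (unbounded_of_derive_ge (fun z => A z * D z) (fun z => D z ^ 2 + z * A z ^ 2) t0 m 0).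
- unfold m; lra.
- intros z _. evar_last.
  + apply (is_derive_mult A D z _ _ (H1 z) (H2 z)). intros; apply Rmult_comm.
  + unfold plus, mult; simpl. ring.
- intros z Hz. specialize (Hm z Hz). assert (Hp := pow2_ge_0 (D z)). lra.
- intros z Hz. apply Hle. lra.
Qed.

Lemma airy_deriv_le A D : decaying_airy A D -> forall t, 0 <= t -> D t <= - sqrt t * A t.
Proof.
intros H t Ht. assert (H1 := airy_deriv_sq_ge A D H t Ht).
assert (H2 := airy_deriv_le0 A D H t Ht). assert (H3 := airy_pos A D H t Ht).
assert (H4 := sqrt_pos t). assert (H5 := sqrt_sqrt t Ht).
apply Ropp_le_cancel. replace (- (- sqrt t * A t)) with (sqrt t * A t) by ring.
apply Rsqr_incr_0_var; [|lra].
unfold Rsqr. nra.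
Qed.

(* [/ wkb t] is the Liouville-Green approximation t^(-1/4) exp(-2/3 t^(3/2)). *)
Definition wkb (t : R) : R := sqrt (sqrt t) * exp (2 / 3 * (t * sqrt t)).

Definition wkb_rate (t : R) : R := / (4 * t) + sqrt t.

Lemma wkb_pos t : 0 < t -> 0 < wkb t.
Proof.
intros Ht. apply Rmult_lt_0_compat; [|apply exp_pos]. now repeat apply sqrt_lt_R0.
Qed.

Lemma is_derive_wkb t : 0 < t -> is_derive wkb t (wkb_rate t * wkb t).
Proof.
intros Ht. assert (Hs := sqrt_lt_R0 t Ht). assert (Hss := sqrt_lt_R0 _ Hs).
unfold wkb, wkb_rate. auto_derive; [repeat split; auto|].
assert (E1 : sqrt t * sqrt t = t) by (apply sqrt_sqrt; lra).
assert (E2 : sqrt (sqrt t) * sqrt (sqrt t) = sqrt t) by (apply sqrt_sqrt; lra).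
set (q := sqrt (sqrt t)) in *. set (s := sqrt t) in *. set (X := exp _).
rewrite <- E1, <- E2. field. lra.
Qed.

Lemma wkb_ge1 t : 1 <= t -> 1 <= wkb t.
Proof.
intros Ht. assert (1 <= sqrt t) by (rewrite <- sqrt_1; apply sqrt_le_1; lra).
assert (1 <= sqrt (sqrt t)) by (rewrite <- sqrt_1; apply sqrt_le_1; lra).
assert (H1 := exp_ineq1_le (2 / 3 * (t * sqrt t))).
assert (0 <= t * sqrt t) by nra. unfold wkb. nra.
Qed.

Lemma is_derive_wkb_rate t : 0 < t -> is_derive wkb_rate t (- / (4 * t ^ 2) + / (2 * sqrt t)).
Proof.
intros Ht. assert (Hs := sqrt_lt_R0 t Ht). unfold wkb_rate.
auto_derive; [split; lra|]. field. lra.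
Qed.

Lemma wkb_rate_sq t : 0 < t -> wkb_rate t ^ 2 = / (16 * t ^ 2) + / (2 * sqrt t) + t.
Proof.
intros Ht. assert (Hs := sqrt_lt_R0 t Ht).
assert (E1 : sqrt t * sqrt t = t) by (apply sqrt_sqrt; lra).
unfold wkb_rate. set (s := sqrt t) in *. rewrite <- E1. field. lra.
Qed.

Definition airy_defect (A D : R -> R) (t : R) : R := D t + A t * wkb_rate t.

Lemma is_derive_airy_ratio A D t : decaying_airy A D -> 0 < t ->
  is_derive (fun t => A t * wkb t) t (airy_defect A D t * wkb t).
Proof.
intros H Ht. assert (H1 := airy_D1 A D H). assert (H2 := is_derive_wkb t Ht).
evar_last.
- apply (is_derive_mult A wkb t _ _ (H1 t) H2). intros; apply Rmult_comm.
- unfold airy_defect, plus, mult; simpl. ring.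
Qed.

(** The left side is the Wronskian of A with y = 1 / [wkb], which solves y'' = (t + 5/(16 t^2)) y
    exactly. Only the excess 5/(16 t^2) survives in its derivative. *)
Lemma is_derive_airy_flux A D t : decaying_airy A D -> 0 < t ->
  is_derive (fun t => airy_defect A D t / wkb t) t (- (5 / 16) / t ^ 2 * A t / wkb t).
Proof.
intros H Ht. assert (H1 := airy_D1 A D H). assert (H2 := airy_D2 A D H).
assert (Hw := is_derive_wkb t Ht). assert (Hp := wkb_pos t Ht).
assert (Hr := is_derive_wkb_rate t Ht). assert (Hq := wkb_rate_sq t Ht).
unfold airy_defect. evar_last.
- apply (is_derive_div (fun t => D t + A t * wkb_rate t) wkb t); [|exact Hw|lra].
  apply (is_derive_plus D (fun t => A t * wkb_rate t) t); [apply H2|].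
  apply (is_derive_mult A wkb_rate t _ _ (H1 t) Hr). intros; apply Rmult_comm.
- unfold plus, mult; simpl.
  replace (- (5 / 16) / (t * (t * 1)) * A t / wkb t)
    with ((t * A t + A t * (- / (4 * t ^ 2) + / (2 * sqrt t)) - A t * wkb_rate t ^ 2) / wkb t).
  + field. assert (Hs := sqrt_lt_R0 t Ht). repeat split; lra.
  + rewrite Hq. field. assert (Hs := sqrt_lt_R0 t Ht). repeat split; lra.
Qed.

Lemma airy_flux_decr A D x y : decaying_airy A D -> 0 < x <= y ->
  airy_defect A D y / wkb y <= airy_defect A D x / wkb x.
Proof.
intros H Hxy.
apply (decr_seg (fun t => airy_defect A D t / wkb t) (fun t => - (5 / 16) / t ^ 2 * A t / wkb t)); [lra| |].
- intros z Hz. apply is_derive_airy_flux; trivial; lra.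
- intros z Hz. assert (Hw := wkb_pos z ltac:(lra)). assert (Ha := airy_pos A D H z ltac:(lra)).
  assert (0 < 5 / 16 / z ^ 2 * A z / wkb z).
  { apply Rdiv_lt_0_compat; trivial. apply Rmult_lt_0_compat; trivial.
    apply Rdiv_lt_0_compat; [lra|]. apply pow_lt; lra. }
  replace (- (5 / 16) / z ^ 2 * A z / wkb z) with (- (5 / 16 / z ^ 2 * A z / wkb z)) by (field; split; lra).
  lra.
Qed.

(** The Wronskian decreases, so a value -m < 0 persists as an upper bound. Then A * [wkb] would
    decrease at a rate of at least m * [wkb]^2 >= m, although it is positive. *)
Lemma airy_defect_ge0 A D t : decaying_airy A D -> 0 < t -> 0 <= airy_defect A D t.
Proof.
intros H Ht. destruct (Rle_lt_dec 0 (airy_defect A D t)) as [|Hneg]; trivial. exfalso.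
assert (Hw := wkb_pos t Ht). set (m := - (airy_defect A D t / wkb t)).
assert (Hm : 0 < m).
{ unfold m. replace (- (airy_defect A D t / wkb t)) with (- airy_defect A D t / wkb t) by (field; lra).
  apply Rdiv_lt_0_compat; lra. }
apply (unbounded_of_derive_ge (fun z => - (A z * wkb z)) (fun z => - (airy_defect A D z * wkb z)) (Rmax t 1) m 0 Hm).
- intros z Hz. apply (is_derive_opp (fun z => A z * wkb z)).
  apply is_derive_airy_ratio; trivial. generalize (Rmax_r t 1); lra.
- intros z Hz. assert (1 <= z) by (generalize (Rmax_r t 1); lra).
  assert (t <= z) by (generalize (Rmax_l t 1); lra).
  assert (Hz1 := wkb_ge1 z H0). assert (Hf := airy_flux_decr A D t z H ltac:(lra)).
  assert (airy_defect A D z <= - m * wkb z).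
  { replace (airy_defect A D z) with (airy_defect A D z / wkb z * wkb z) by (field; lra).
    apply Rmult_le_compat_r; [lra|]. unfold m; lra. }
  clearbody m. assert (m * 1 <= m * (wkb z * wkb z)) by (apply Rmult_le_compat_l; nra). nra.
- intros z Hz. assert (1 <= z) by (generalize (Rmax_r t 1); lra).
  assert (Hz1 := wkb_ge1 z H0). assert (Ha := airy_pos A D H z ltac:(lra)). nra.
Qed.

(** Minus the derivative of 5/48 t^(-3/2), the exponent in [airy_connection]. It balances the source
    5/(16 t^2) of the Wronskian against the rate 2 sqrt t at which A / [wkb] decays to leading
    order. *)
Definition wkb_corr (t : R) : R := 5 / 32 * / (t ^ 2 * sqrt t).

(** The difference divided by [wkb] does not decrease, so a positive value m persists. For z >= 1
    the defect is at most A, hence m <= A z, against the decay of A. *)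
Lemma airy_defect_le A D t : decaying_airy A D -> 0 < t ->
  airy_defect A D t <= wkb_corr t * A t.
Proof.
intros H Ht. destruct (Rle_lt_dec (airy_defect A D t) (wkb_corr t * A t)) as [|Hneg]; trivial. exfalso.
assert (Hw := wkb_pos t Ht). set (m := (airy_defect A D t - wkb_corr t * A t) / wkb t).
assert (Hm : 0 < m) by (apply Rdiv_lt_0_compat; lra).
assert (Hcp : forall z, 0 < z -> 0 < wkb_corr z).
{ intros z Hz. unfold wkb_corr. apply Rmult_lt_0_compat; [lra|]. apply Rinv_0_lt_compat.
  apply Rmult_lt_0_compat; [nra|]. now apply sqrt_lt_R0. }
assert (Hinc : forall z, t <= z -> m <= (airy_defect A D z - wkb_corr z * A z) / wkb z).
{ intros z Hz.
  apply (incr_seg (fun z => (airy_defect A D z - wkb_corr z * A z) / wkb z)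
    (fun z => - (5 / 16) / z ^ 2 * A z / wkb z -
       (- (5 / 2) / z * A z + D z - A z * wkb_rate z) * wkb_corr z / wkb z)); trivial.
  - intros y Hy. assert (Hy0 : 0 < y) by lra. assert (Hyw := wkb_pos y Hy0).
    apply (is_derive_ext (fun z => airy_defect A D z / wkb z - wkb_corr z * A z / wkb z)).
    { intros x. change (airy_defect A D x / wkb x - wkb_corr x * A x / wkb x
        = (airy_defect A D x - wkb_corr x * A x) / wkb x). unfold Rdiv; ring. }
    apply (is_derive_minus (fun z => airy_defect A D z / wkb z) (fun z => wkb_corr z * A z / wkb z)).
    + apply is_derive_airy_flux; trivial.
    + assert (H1 := airy_D1 A D H). assert (Hd := is_derive_wkb y Hy0).
      assert (Hs := sqrt_lt_R0 y Hy0).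
      assert (E1 : sqrt y * sqrt y = y) by (apply sqrt_sqrt; lra).
      evar_last.
      * apply (is_derive_div (fun z => wkb_corr z * A z) wkb y); [|exact Hd|lra].
        apply (is_derive_mult wkb_corr A y); [|apply H1|intros; apply Rmult_comm].
        unfold wkb_corr. auto_derive.
        { split; trivial. split; trivial. apply Rgt_not_eq. apply Rmult_lt_0_compat; nra. }
        reflexivity.
      * unfold plus, mult; simpl. unfold wkb_rate, wkb_corr. set (s := sqrt y) in *. rewrite <- E1. field. rewrite E1. split; lra.
  - intros y Hy. assert (Hy0 : 0 < y) by lra. assert (Hyw := wkb_pos y Hy0).
    assert (Ha := airy_pos A D H y ltac:(lra)). assert (Hdl := airy_deriv_le A D H y ltac:(lra)).
    assert (Hs := sqrt_lt_R0 y Hy0). assert (E1 : sqrt y * sqrt y = y) by (apply sqrt_sqrt; lra).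
    assert (Hc := Hcp y Hy0).
    assert (- (5 / 2) / y * A y + D y - A y * wkb_rate y <= - 2 * sqrt y * A y).
    { unfold wkb_rate. assert (Hi := Rinv_0_lt_compat y Hy0).
      replace (/ (4 * y)) with (/ 4 * / y) by (field; lra). unfold Rdiv. nra. }
    assert ((- (5 / 2) / y * A y + D y - A y * wkb_rate y) * wkb_corr y <= - (5 / 16) / y ^ 2 * A y).
    { replace (- (5 / 16) / y ^ 2 * A y) with (- 2 * sqrt y * A y * wkb_corr y).
      - apply Rmult_le_compat_r; lra.
      - unfold wkb_corr. field. lra. }
    replace (- (5 / 16) / y ^ 2 * A y / wkb y -
       (- (5 / 2) / y * A y + D y - A y * wkb_rate y) * wkb_corr y / wkb y)
     with ((- (5 / 16) / y ^ 2 * A y - (- (5 / 2) / y * A y + D y - A y * wkb_rate y) * wkb_corr y) * / wkb y)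
     by (field; lra).
    apply Rmult_le_pos; [lra|]. left; now apply Rinv_0_lt_compat. }
destruct (is_lim_p_infty_eventually A 0 m (airy_lim A D H) Hm) as [T HT].
set (z := Rmax t (Rmax 1 (T + 1))).
assert (Hz1 : t <= z) by apply Rmax_l.
assert (Hz2 : 1 <= z) by (apply Rle_trans with (2 := Rmax_r _ _), Rmax_l).
assert (Hz3 : T + 1 <= z) by (apply Rle_trans with (2 := Rmax_r _ _), Rmax_r).
specialize (HT z ltac:(lra)). specialize (Hinc z Hz1).
assert (Hw1 := wkb_ge1 z Hz2). assert (Ha := airy_pos A D H z ltac:(lra)).
assert (Hdl := airy_deriv_le A D H z ltac:(lra)). assert (Hc := Hcp z ltac:(lra)).
assert (airy_defect A D z <= A z).
{ unfold airy_defect, wkb_rate. assert (/ (4 * z) <= 1).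
  { rewrite <- Rinv_1. apply Rinv_le_contravar; lra. } nra. }
assert (m * wkb z <= airy_defect A D z - wkb_corr z * A z).
{ replace (airy_defect A D z - wkb_corr z * A z) with ((airy_defect A D z - wkb_corr z * A z) / wkb z * wkb z) by (field; lra).
  apply Rmult_le_compat_r; lra. }
apply Rabs_def2 in HT. nra.
Qed.

(** The bounds on the defect say that A * [wkb] increases while its product with exp(5/48 t^(-3/2))
    decreases. The constant c is the supremum of the first function, which stays below every value
    of the second. *)
Lemma airy_connection A D : decaying_airy A D ->
  exists c, 0 < c /\ forall t, 0 < t ->
    A t * wkb t <= c <= A t * wkb t * exp (5 / 48 * / (t * sqrt t)).
Proof.
intros H.
assert (Hincr : forall x y, 0 < x <= y -> A x * wkb x <= A y * wkb y).
{ intros x y Hxy.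
  apply (incr_seg (fun t => A t * wkb t) (fun t => airy_defect A D t * wkb t)); [lra| |].
  - intros z Hz. apply is_derive_airy_ratio; trivial; lra.
  - intros z Hz. apply Rmult_le_pos; [apply airy_defect_ge0; trivial; lra|left; apply wkb_pos; lra]. }
set (ex := fun t => exp (5 / 48 * / (t * sqrt t))).
assert (Hdecr : forall x y, 0 < x <= y -> A y * wkb y * ex y <= A x * wkb x * ex x).
{ intros x y Hxy.
  apply (decr_seg (fun t => A t * wkb t * ex t) (fun t => (airy_defect A D t - wkb_corr t * A t) * wkb t * ex t)); [lra| |].
  - intros z Hz. assert (Hz0 : 0 < z) by lra. assert (Hs := sqrt_lt_R0 z Hz0).
    assert (E1 : sqrt z * sqrt z = z) by (apply sqrt_sqrt; lra).
    evar_last.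
    + apply (is_derive_mult (fun t => A t * wkb t) ex z); [apply (is_derive_airy_ratio A D z H Hz0)| |intros; apply Rmult_comm].
      unfold ex. auto_derive; [|reflexivity]. split; trivial. split; trivial.
      apply Rgt_not_eq. apply Rmult_lt_0_compat; nra.
    + unfold plus, mult; simpl. fold (ex z). unfold wkb_corr.
      set (s := sqrt z) in *. rewrite <- E1. field. lra.
  - intros z Hz. assert (Hd := airy_defect_le A D z H ltac:(lra)).
    assert (Hw := wkb_pos z ltac:(lra)). assert (He := exp_pos (5 / 48 * / (z * sqrt z))). fold (ex z) in He.
    assert (0 < wkb z * ex z) by nra. rewrite Rmult_assoc. nra. }
assert (Hex : forall t, 0 < t -> 1 <= ex t).
{ intros t Ht. unfold ex. assert (0 < 5 / 48 * / (t * sqrt t)).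
  { apply Rmult_lt_0_compat; [lra|]. apply Rinv_0_lt_compat. apply Rmult_lt_0_compat; trivial. now apply sqrt_lt_R0. }
  assert (H1 := exp_ineq1_le (5 / 48 * / (t * sqrt t))). lra. }
assert (Hk : forall t, 0 < t -> 0 < A t * wkb t).
{ intros t Ht. apply Rmult_lt_0_compat; [apply (airy_pos A D H); lra|now apply wkb_pos]. }
assert (Hub : forall x y, 0 < x -> 0 < y -> A x * wkb x <= A y * wkb y * ex y).
{ intros x y Hx Hy. destruct (Rle_lt_dec x y).
  - assert (H1 := Hincr x y ltac:(lra)). assert (H2 := Hex y Hy). assert (H3 := Hk y Hy). nra.
  - assert (H1 := Hdecr y x ltac:(lra)). assert (H2 := Hex x Hx). assert (H3 := Hk x Hx). nra. }
destruct (completeness (fun v => exists t, 0 < t /\ v = A t * wkb t)) as [c [Hc1 Hc2]].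
- exists (A 1 * wkb 1 * ex 1). intros v [t [Ht ->]]. apply Hub; lra.
- exists (A 1 * wkb 1). exists 1. split; lra.
- exists c. split.
  + apply Rlt_le_trans with (A 1 * wkb 1); [apply Hk; lra|]. apply Hc1. exists 1. split; lra.
  + intros t Ht. split.
    * apply Hc1. now exists t.
    * apply Hc2. intros v [x [Hx ->]]. now apply Hub.
Qed.

(** * Improper integrals and the Mellin transform of exp(-t^q/q) *)

(** The lower end is abstract ([Fa], with admissible points [dom]) so that one proof serves
    integrals improper at 0 and integrals from a fixed point. The value is the supremum of the
    partial integrals, which grow with the interval. *)
Lemma ex_RInt_gen_bounded (Fa : (R -> Prop) -> Prop) {FFa : Filter Fa} (dom : R -> Prop)
  (f : R -> R) (B : R) :
  (exists x0, dom x0) ->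
  (forall x0, dom x0 -> Fa (fun x => dom x /\ x <= x0)) ->
  (forall x t, dom x -> x <= t -> continuous f t) ->
  (forall x t, dom x -> x <= t -> 0 <= f t) ->
  (forall x y, dom x -> x <= y -> RInt f x y <= B) ->
  exists l, is_RInt_gen f Fa (Rbar_locally p_infty) l /\ l <= B /\
    forall x y, dom x -> x <= y -> RInt f x y <= l.
Proof.
intros [x0 Hx0] HF Hc Hp HB.
assert (Hex : forall x y z, dom x -> x <= y -> x <= z -> ex_RInt f y z).
{ intros x y z Hx Hy Hz. apply (ex_RInt_continuous (V := R_CompleteNormedModule)).
  intros t Ht. apply (Hc x); trivial. apply Rle_trans with (2 := proj1 Ht). now apply Rmin_glb. }
destruct (completeness (fun v => exists x y, dom x /\ x <= y /\ v = RInt f x y)) as [l [Hl1 Hl2]].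
- exists B. intros v [x [y [Hx [Hy ->]]]]. now apply HB.
- exists (RInt f x0 x0). exists x0, x0. repeat split; trivial; lra.
- exists l. split; [|split].
  + intros P [eps HP].
    assert (exists x y, dom x /\ x <= y /\ l - eps < RInt f x y) as [x1 [y1 [Hx1 [Hy1 Hl]]]].
    { destruct (Classical_Prop.classic (exists x y, dom x /\ x <= y /\ l - eps < RInt f x y)) as [|Hn]; trivial.
      exfalso. assert (l <= l - eps).
      { apply Hl2. intros v [x [y [Hx [Hy ->]]]]. apply Rnot_lt_le. intros Hlt. apply Hn. now exists x, y. }
      assert (He := cond_pos eps). lra. }
    apply (Filter_prod _ _ _ (fun x => dom x /\ x <= x1) (fun y => y1 < y)).
    * now apply HF.
    * now exists y1.
    * intros x y [Hx Hxx1] Hy. simpl. exists (RInt f x y).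
      assert (Hxy : x <= y) by lra.
      split; [apply (RInt_correct f), (Hex x); trivial; lra|].
      apply HP. unfold_ball.
      assert (RInt f x y <= l) by (apply Hl1; now exists x, y).
      assert (RInt f x1 y1 <= RInt f x y).
      { rewrite <- (RInt_Chasles f x x1 y); [|apply (Hex x)|apply (Hex x)]; trivial; try lra.
        rewrite <- (RInt_Chasles f x1 y1 y); [|apply (Hex x)|apply (Hex x)]; trivial; try lra.
        unfold plus; simpl.
        assert (0 <= RInt f x x1).
        { apply RInt_ge_0; trivial; [apply (Hex x); trivial; lra|]. intros t Ht. apply (Hp x); trivial; lra. }
        assert (0 <= RInt f y1 y).
        { apply RInt_ge_0; [lra|apply (Hex x); trivial; lra|]. intros t Ht. apply (Hp x); trivial; lra. }
        lra. }
      apply Rabs_def1; lra.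
  + apply Hl2. intros v [x [y [Hx [Hy ->]]]]. now apply HB.
  + intros x y Hx Hy. apply Hl1. now exists x, y.
Qed.

Notation is_int0 f l := (is_RInt_gen f (at_right 0) (Rbar_locally p_infty) l).

Lemma at_right_pos x0 : 0 < x0 -> at_right 0 (fun x => 0 < x /\ x <= x0).
Proof.
intros H. exists (mkposreal x0 H). intros y Hy Hy0. split; trivial.
unfold_ball_in Hy.
apply Rabs_def2 in Hy. lra.
Qed.

Lemma ex_int0_bounded (f : R -> R) (B : R) :
  (forall t, 0 < t -> continuous f t) ->
  (forall t, 0 < t -> 0 <= f t) ->
  (forall x y, 0 < x -> x <= y -> RInt f x y <= B) ->
  exists l, is_int0 f l /\ l <= B /\ forall x y, 0 < x -> x <= y -> RInt f x y <= l.
Proof.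
intros Hc Hp HB. apply (ex_RInt_gen_bounded (at_right 0) (fun x => 0 < x)); trivial.
- exists 1. lra.
- apply at_right_pos.
- intros; apply Hc; lra.
- intros; apply Hp; lra.
Qed.

Lemma filter_prod_int0 : filter_prod (at_right 0) (Rbar_locally p_infty)
  (fun ab : R * R => 0 < fst ab /\ fst ab <= 1 /\ 1 < snd ab).
Proof.
apply (Filter_prod _ _ _ (fun x => 0 < x /\ x <= 1) (fun y => 1 < y)).
- apply at_right_pos; lra.
- now exists 1.
- intros x y; simpl; tauto.
Qed.

Lemma int0_ext (f g : R -> R) l :
  (forall t, 0 < t -> f t = g t) -> is_int0 f l -> is_int0 g l.
Proof.
intros H. apply is_RInt_gen_ext. apply filter_imp with (2 := filter_prod_int0).
intros [a b] [H1 [H2 H3]] x Hx; simpl in *. rewrite Rmin_left in Hx by lra. apply H; lra.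
Qed.

Lemma int0_le (f g : R -> R) lf lg :
  (forall t, 0 < t -> f t <= g t) -> is_int0 f lf -> is_int0 g lg -> lf <= lg.
Proof.
intros H Hf Hg.
assert (Hm := is_RInt_gen_minus g f lg lf Hg Hf).
assert (H0 := is_RInt_gen_scal g 0 lg Hg).
(* Nonnegativity of the integral of g - f comes from the norm inequality, with 0 * g as the
   dominated function because its integral is at hand. *)
assert (Hn : norm (scal 0 lg) <= minus lg lf).
{ refine (RInt_gen_norm (Fa := at_right 0) (Fb := Rbar_locally p_infty) _ _ _ _ _ _ H0 Hm).
  - apply filter_imp with (2 := filter_prod_int0). intros [a b]; simpl; lra.
  - apply filter_imp with (2 := filter_prod_int0). intros [a b]; simpl; intros H1 x Hx.
    unfold norm, scal, minus, plus, opp, mult, abs; simpl. unfold abs, mult; simpl.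
    rewrite Rmult_0_l, Rabs_R0. specialize (H x ltac:(lra)). lra. }
unfold norm, scal, minus, plus, opp, mult, abs in Hn; simpl in Hn. unfold abs, mult in Hn; simpl in Hn.
rewrite Rmult_0_l, Rabs_R0 in Hn. lra.
Qed.

Lemma int0_lin (f g : R -> R) (a b lf lg : R) :
  is_int0 f lf -> is_int0 g lg -> is_int0 (fun t => a * f t + b * g t) (a * lf + b * lg).
Proof.
intros Hf Hg.
exact (is_RInt_gen_plus _ _ _ _ (is_RInt_gen_scal f a lf Hf) (is_RInt_gen_scal g b lg Hg)).
Qed.

Lemma int0_derive (F f : R -> R) (la lb : R) :
  (forall t, 0 < t -> is_derive F t (f t)) ->
  (forall t, 0 < t -> continuous f t) ->
  filterlim F (at_right 0) (locally la) ->
  filterlim F (Rbar_locally p_infty) (locally lb) ->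
  is_int0 f (lb - la).
Proof.
intros Hd Hc Ha Hb P HP.
assert (Hlim : filterlim (fun ab : R * R => F (snd ab) - F (fst ab))
   (filter_prod (at_right 0) (Rbar_locally p_infty)) (locally (lb - la))).
{ apply (filterlim_comp_2 (fun ab : R * R => F (snd ab)) (fun ab : R * R => - F (fst ab)) Rplus (G := locally lb) (H := locally (- la))).
  - apply filterlim_comp with (2 := Hb). apply filterlim_snd.
  - apply (filterlim_comp _ _ _ (fun ab : R * R => F (fst ab)) Ropp (filter_prod (at_right 0) (Rbar_locally p_infty)) (locally la) (locally (- la))).
    + apply filterlim_comp with (2 := Ha). apply filterlim_fst.
    + apply (filterlim_opp la).
  - apply (filterlim_plus lb (- la)). }
specialize (Hlim P HP). unfold filtermapi.
unfold filtermap in Hlim.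
generalize (filter_and _ _ Hlim filter_prod_int0). apply filter_imp.
intros [a b] [H1 [H2 [H3 H4]]]; simpl in *. exists (F b - F a). split; trivial.
apply (is_RInt_derive F f); intros x Hx; rewrite Rmin_left in Hx by lra.
- apply Hd; lra.
- apply Hc; lra.
Qed.

Lemma is_derive_RInt_above (f : R -> R) (a x t : R) :
  (forall t, a < t -> continuous f t) -> a < x -> a < t ->
  is_derive (fun y => RInt f x y) t (f t).
Proof.
intros Hc Hx Ht. apply (is_derive_RInt f _ x t); [|now apply Hc].
assert (He : 0 < t - a) by lra.
exists (mkposreal _ He). intros z Hz.
unfold_ball_in Hz.
apply Rabs_def2 in Hz. apply (RInt_correct f). apply (ex_RInt_continuous (V := R_CompleteNormedModule)).
intros y Hy. apply Hc. apply Rlt_le_trans with (2 := proj1 Hy). apply Rmin_glb_lt; lra.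
Qed.

Lemma RInt_le_primitive (f F dF : R -> R) (a x y : R) :
  (forall t, a < t -> continuous f t) ->
  (forall t, a < t -> is_derive F t (dF t)) ->
  (forall t, a < t -> f t <= dF t) ->
  a < x -> x <= y -> RInt f x y <= F y - F x.
Proof.
intros Hc Hd Hle Hx Hxy.
assert (F x - RInt f x x <= F y - RInt f x y).
{ apply (incr_seg (fun t => F t - RInt f x t) (fun t => dF t - f t)); trivial.
  - intros z Hz. apply (is_derive_minus F (fun t => RInt f x t)); [apply Hd; lra|].
    apply (is_derive_RInt_above f a); trivial; lra.
  - intros z Hz. specialize (Hle z ltac:(lra)). lra. }
rewrite RInt_point in H. unfold zero in H; simpl in H. lra.
Qed.

Lemma ex_int0_primitive (f F dF : R -> R) (B : R) :
  (forall t, 0 < t -> continuous f t) ->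
  (forall t, 0 < t -> 0 <= f t) ->
  (forall t, 0 < t -> is_derive F t (dF t)) ->
  (forall t, 0 < t -> f t <= dF t) ->
  (forall t, 0 < t -> 0 <= F t <= B) ->
  exists l, is_int0 f l /\ l <= B /\ forall x y, 0 < x -> x <= y -> RInt f x y <= l.
Proof.
intros Hc Hp Hd Hle HB. apply ex_int0_bounded; trivial. intros x y Hx Hy.
assert (H := RInt_le_primitive f F dF 0 x y Hc Hd Hle Hx Hy).
assert (H1 := HB x Hx). assert (H2 := HB y ltac:(lra)). lra.
Qed.

Lemma ex_int0_dom (f g : R -> R) (lg : R) :
  (forall t, 0 < t -> continuous f t) ->
  (forall t, 0 < t -> 0 <= f t <= g t) ->
  (forall t, 0 < t -> continuous g t) ->
  is_int0 g lg -> exists l, is_int0 f l.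
Proof.
intros Hc Hfg Hcg Hg.
assert (Hex : forall h : R -> R, (forall t, 0 < t -> continuous h t) -> forall x y, 0 < x -> x <= y -> ex_RInt h x y).
{ intros h Hh x y Hx Hy. apply (ex_RInt_continuous (V := R_CompleteNormedModule)).
  intros z Hz. rewrite Rmin_left in Hz by lra. apply Hh; lra. }
destruct (ex_int0_bounded f lg) as [l [Hl _]]; trivial.
- intros; now apply Hfg.
- intros x y Hx Hy. apply Rnot_lt_le. intros Hlt.
  assert (Hfg' : RInt f x y <= RInt g x y).
  { apply RInt_le; auto. intros t Ht. apply Hfg; lra. }
  destruct (Hg (fun v => v < RInt f x y)) as [P Q HP HQ HPQ].
  { assert (He : 0 < RInt f x y - lg) by lra. exists (mkposreal _ He). intros v Hv.
    unfold_ball_in Hv.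
    apply Rabs_def2 in Hv. lra. }
  destruct (filter_ex (F := at_right 0) _ (filter_and _ _ HP (at_right_pos x Hx))) as [x' [Px [Hx' Hxx']]].
  assert (HQ' : Rbar_locally p_infty (fun z => y < z)) by now exists y.
  destruct (filter_ex (F := Rbar_locally p_infty) _ (filter_and _ _ HQ HQ')) as [y' [Qy Hy']].
  destruct (HPQ x' y' Px Qy) as [v [Hv1 Hv2]]. simpl in *.
  assert (RInt g x y <= v).
  { rewrite <- (is_RInt_unique _ _ _ _ Hv1).
    assert (forall a b, 0 < a -> a <= b -> 0 <= RInt g a b).
    { intros a b Ha Hb. apply RInt_ge_0; auto. intros t Ht. specialize (Hfg t ltac:(lra)). lra. }
    rewrite <- (RInt_Chasles g x' x y'); [|apply Hex|apply Hex]; trivial; try lra.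
    rewrite <- (RInt_Chasles g x y y'); [|apply Hex|apply Hex]; trivial; try lra.
    unfold plus; simpl. assert (H1 := H x' x Hx' Hxx'). assert (H2 := H y y' ltac:(lra) ltac:(lra)). lra. }
  lra.
- now exists l.
Qed.

Lemma is_derive_Rpower a t : 0 < t -> is_derive (fun x => Rpower x a) t (a * Rpower t (a - 1)).
Proof. intros Ht. apply is_derive_Reals. now apply derivable_pt_lim_power. Qed.

Lemma Rpower_pos x a : 0 < Rpower x a.
Proof. apply exp_pos. Qed.

Lemma Rpower_base1 a : Rpower 1 a = 1.
Proof. unfold Rpower. now rewrite ln_1, Rmult_0_r, exp_0. Qed.

(* Integrand of the Mellin transform of exp(-t^q/q); for q = 1 it is the
   Gamma integrand. *)
Definition mellin_exp (q s t : R) : R := Rpower t (s - 1) * exp (- (Rpower t q / q)).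

Lemma mellin_exp_pos q s t : 0 < mellin_exp q s t.
Proof. apply Rmult_lt_0_compat; [apply Rpower_pos|apply exp_pos]. Qed.

Lemma is_derive_exp_Rpower q t : 0 < q -> 0 < t ->
  is_derive (fun t => exp (- (Rpower t q / q))) t (- Rpower t (q - 1) * exp (- (Rpower t q / q))).
Proof.
intros Hq Ht. evar_last.
- apply (is_derive_comp exp (fun t => - (Rpower t q / q))); [apply is_derive_exp|].
  apply (is_derive_opp (fun t => Rpower t q / q)).
  apply (is_derive_ext (fun t => / q * Rpower t q)).
  { intros x. unfold Rdiv. apply Rmult_comm. }
  apply is_derive_scal. now apply is_derive_Rpower.
- unfold scal, opp; simpl. unfold mult; simpl. field. lra.
Qed.

Lemma continuous_mellin_exp q s t : 0 < q -> 0 < t -> continuous (mellin_exp q s) t.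
Proof.
intros Hq Ht. apply (continuous_mult (fun t => Rpower t (s - 1)) (fun t => exp (- (Rpower t q / q)))).
- apply (ex_derive_continuous (fun t => Rpower t (s - 1))). eexists. now apply is_derive_Rpower.
- apply (ex_derive_continuous (fun t => exp (- (Rpower t q / q)))). eexists. now apply is_derive_exp_Rpower.
Qed.

(** With z = t^q / q and m = s / q, this is z / m <= exp(z / m) raised to the power m. *)
Lemma Rpower_exp_bound q s t : 0 < q -> 0 < s -> 0 < t ->
  Rpower t s * exp (- (Rpower t q / q)) <= Rpower s (s / q).
Proof.
intros Hq Hs Ht. set (m := s / q). assert (Hm : 0 < m) by now apply Rdiv_lt_0_compat.
set (z := Rpower t q / q). assert (Hz : 0 < z) by (apply Rdiv_lt_0_compat; trivial; apply Rpower_pos).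
assert (H1 : z / m <= exp (z / m)) by (generalize (exp_ineq1_le (z / m)); lra).
assert (H2 : Rpower (z / m) m <= Rpower (exp (z / m)) m).
{ apply Rle_Rpower_l; [lra|]. split; trivial. now apply Rdiv_lt_0_compat. }
assert (H3 : Rpower (exp (z / m)) m = exp z).
{ unfold Rpower. rewrite ln_exp. f_equal. field. lra. }
assert (H4 : Rpower t s = Rpower (z / m) m * Rpower s m).
{ rewrite Rpower_mult_distr; trivial; [|now apply Rdiv_lt_0_compat].
  replace (z / m * s) with (Rpower t q) by (unfold z, m; field; lra).
  rewrite Rpower_mult. f_equal. unfold m; field; lra. }
rewrite H4, exp_Ropp. rewrite H3 in H2.
assert (H5 := exp_pos z). assert (H6 := Rpower_pos s m). fold m.
apply Rmult_le_reg_r with (exp z); trivial.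
replace (Rpower (z / m) m * Rpower s m * / exp z * exp z) with (Rpower s m * Rpower (z / m) m) by (field; lra).
apply Rmult_le_compat_l; lra.
Qed.

Lemma Rpower_double t s : Rpower t (2 * s) = Rpower t s ^ 2.
Proof. replace (2 * s) with (s + s) by ring. rewrite Rpower_plus. ring. Qed.

(** The bounded comparison primitive is C t^s / (1 + t^s). Its derivative behaves like t^(s-1) at 0
    and like t^(-s-1) at infinity, so a single function handles both ends. *)
Lemma ex_int0_mellin_exp q s : 0 < q -> 0 < s ->
  exists l, is_int0 (mellin_exp q s) l /\ 0 < l.
Proof.
intros Hq Hs. set (C := 2 * (1 + Rpower (2 * s) (2 * s / q)) / s).
destruct (ex_int0_primitive (mellin_exp q s) (fun t => C * (Rpower t s / (1 + Rpower t s)))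
  (fun t => C * (s * Rpower t (s - 1) / (1 + Rpower t s) ^ 2)) C) as [l [Hl [_ Hle]]].
- intros; now apply continuous_mellin_exp.
- intros; left; apply mellin_exp_pos.
- intros t Ht. apply (is_derive_scal (fun t => Rpower t s / (1 + Rpower t s))).
  assert (H := is_derive_Rpower s t Ht). assert (Hp := Rpower_pos t s).
  evar_last.
  + apply (is_derive_comp (fun v => v / (1 + v)) (fun t => Rpower t s) t); [|exact H].
    auto_derive; [lra|reflexivity].
  + unfold scal; simpl. unfold mult; simpl. field. lra.
- intros t Ht. assert (Hp := Rpower_pos t s). assert (Hp1 := Rpower_pos t (s - 1)).
  unfold mellin_exp. set (E := exp (- (Rpower t q / q))).
  assert (HE : 0 < E) by apply exp_pos.
  assert (HE1 : E <= 1).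
  { unfold E. rewrite <- exp_0. apply exp_mono. assert (0 < Rpower t q / q) by (apply Rdiv_lt_0_compat; trivial; apply Rpower_pos). lra. }
  assert (HB := Rpower_exp_bound q (2 * s) t Hq ltac:(lra) Ht). fold E in HB. rewrite Rpower_double in HB.
  replace (C * (s * Rpower t (s - 1) / (1 + Rpower t s) ^ 2))
    with (Rpower t (s - 1) * (2 * (1 + Rpower (2 * s) (2 * s / q)) / (1 + Rpower t s) ^ 2)) by (unfold C; field; lra).
  apply Rmult_le_compat_l; [lra|].
  set (v := Rpower t s) in *. set (w := Rpower (2 * s) _) in *.
  apply Rmult_le_reg_r with ((1 + v) ^ 2); [nra|].
  replace (2 * (1 + w) / (1 + v) ^ 2 * (1 + v) ^ 2) with (2 * (1 + w)) by (field; lra).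
  (* Amounts to (1 + v)^2 <= 2 (1 + v^2). The term v^2 E is bounded by [Rpower_exp_bound] at 2 s. *)
  assert (0 <= E * (1 - v) ^ 2) by (apply Rmult_le_pos; [lra|apply pow2_ge_0]). nra.
- intros t Ht. assert (Hp := Rpower_pos t s). assert (Hw := Rpower_pos (2 * s) (2 * s / q)).
  assert (HC : 0 < C) by (unfold C; apply Rdiv_lt_0_compat; lra).
  assert (0 < Rpower t s / (1 + Rpower t s) <= 1).
  { split; [apply Rdiv_lt_0_compat; lra|]. apply Rmult_le_reg_r with (1 + Rpower t s); [lra|].
    unfold Rdiv; rewrite Rmult_assoc, Rinv_l; lra. }
  nra.
- exists l. split; trivial. apply Rlt_le_trans with (2 := Hle 1 2 Rlt_0_1 ltac:(lra)).
  apply RInt_gt_0; [lra| |].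
  + intros; apply mellin_exp_pos.
  + intros; apply continuous_mellin_exp; lra.
Qed.

Definition Mellin (q s : R) : R := RInt_gen (mellin_exp q s) (at_right 0) (Rbar_locally p_infty).

Lemma is_int0_unique (f : R -> R) l : is_int0 f l -> RInt_gen f (at_right 0) (Rbar_locally p_infty) = l.
Proof. apply (is_RInt_gen_unique (V := R_CompleteNormedModule)). Qed.

Lemma Mellin_correct q s : 0 < q -> 0 < s -> is_int0 (mellin_exp q s) (Mellin q s).
Proof.
intros Hq Hs. destruct (ex_int0_mellin_exp q s Hq Hs) as [l [Hl _]].
unfold Mellin. now rewrite (is_int0_unique _ _ Hl).
Qed.

Lemma Mellin_pos q s : 0 < q -> 0 < s -> 0 < Mellin q s.
Proof.
intros Hq Hs. destruct (ex_int0_mellin_exp q s Hq Hs) as [l [Hl Hp]].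
unfold Mellin. now rewrite (is_int0_unique _ _ Hl).
Qed.

Lemma filterlim_Rpower_0 s : 0 < s -> filterlim (fun t => Rpower t s) (at_right 0) (locally 0).
Proof.
intros Hs P [eps HP]. assert (He := cond_pos eps).
exists (mkposreal _ (Rpower_pos eps (/ s))). intros t Ht Ht0.
unfold_ball_in Ht.
apply Rabs_def2 in Ht. apply HP.
unfold_ball.
rewrite Ropp_0, Rplus_0_r, Rabs_pos_eq by (left; apply Rpower_pos).
replace (pos eps) with (Rpower (Rpower eps (/ s)) s).
- apply Rlt_Rpower_l; lra.
- rewrite Rpower_mult, Rinv_l, Rpower_1; lra.
Qed.

Lemma filterlim_Rpower_neg s : 0 < s -> filterlim (fun t => Rpower t (- s)) (Rbar_locally p_infty) (locally 0).
Proof.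
intros Hs P [eps HP]. assert (He := cond_pos eps).
exists (Rpower eps (- / s)). intros t Ht.
assert (H0 := Rpower_pos eps (- / s)).
apply HP. unfold_ball.
rewrite Ropp_0, Rplus_0_r, Rabs_pos_eq by (left; apply Rpower_pos).
replace (pos eps) with (Rpower (Rpower eps (- / s)) (- s)).
- set (T := Rpower eps (- / s)) in *. rewrite !Rpower_Ropp. apply Rinv_lt_contravar.
  + apply Rmult_lt_0_compat; apply Rpower_pos.
  + apply Rlt_Rpower_l; lra.
- rewrite Rpower_mult. replace (- / s * - s) with 1 by (field; lra). now apply Rpower_1.
Qed.

Lemma filterlim_squeeze0 {F : (R -> Prop) -> Prop} {FF : Filter F} (f g : R -> R) :
  F (fun t => 0 <= f t <= g t) -> filterlim g F (locally 0) -> filterlim f F (locally 0).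
Proof.
intros H Hg. apply (filterlim_le_le (fun _ => 0) f g (Finite 0)).
- exact H.
- apply filterlim_const.
- exact Hg.
Qed.

(** Integration by parts: t^s exp(-t^q/q) vanishes at both ends, and its derivative is s times the
    integrand at s minus the integrand at s + q. *)
Lemma Mellin_add q s : 0 < q -> 0 < s -> Mellin q (s + q) = s * Mellin q s.
Proof.
intros Hq Hs.
assert (H1 := Mellin_correct q s Hq Hs). assert (H2 := Mellin_correct q (s + q) Hq ltac:(lra)).
assert (H3 := int0_lin _ _ s (-1) _ _ H1 H2).
assert (H4 : is_int0 (fun t => s * mellin_exp q s t + -1 * mellin_exp q (s + q) t) (0 - 0)).
{ apply (int0_derive (fun t => Rpower t s * exp (- (Rpower t q / q)))).
  - intros t Ht. evar_last.
    + apply (is_derive_mult (fun t => Rpower t s) (fun t => exp (- (Rpower t q / q))) t).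
      * now apply is_derive_Rpower.
      * now apply is_derive_exp_Rpower.
      * intros; apply Rmult_comm.
    + unfold plus, mult; simpl. unfold mellin_exp.
      replace (s + q - 1) with (s + (q - 1)) by ring. rewrite (Rpower_plus s). ring.
  - intros t Ht. apply (continuous_plus (fun t => s * mellin_exp q s t) (fun t => -1 * mellin_exp q (s + q) t)).
    + apply (continuous_scal_r s (mellin_exp q s)). now apply continuous_mellin_exp.
    + apply (continuous_scal_r (-1) (mellin_exp q (s + q))). now apply continuous_mellin_exp.
  - apply (filterlim_squeeze0 _ (fun t => Rpower t s)); [|now apply filterlim_Rpower_0].
    exists (mkposreal 1 Rlt_0_1). intros t _ Ht. split; [left; apply Rmult_lt_0_compat; [apply Rpower_pos|apply exp_pos]|].
    rewrite <- (Rmult_1_r (Rpower t s)) at 2. apply Rmult_le_compat_l; [left; apply Rpower_pos|].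
    rewrite <- exp_0. apply exp_mono. assert (0 < Rpower t q / q) by (apply Rdiv_lt_0_compat; trivial; apply Rpower_pos). lra.
  - apply (filterlim_squeeze0 _ (fun t => Rpower (2 * s) (2 * s / q) * Rpower t (- s))).
    + exists 0. intros t Ht. split; [left; apply Rmult_lt_0_compat; [apply Rpower_pos|apply exp_pos]|].
      assert (HB := Rpower_exp_bound q (2 * s) t Hq ltac:(lra) Ht). rewrite Rpower_double in HB.
      rewrite Rpower_Ropp. assert (Hp := Rpower_pos t s).
      apply Rmult_le_reg_r with (Rpower t s); trivial.
      replace (Rpower (2 * s) (2 * s / q) * / Rpower t s * Rpower t s) with (Rpower (2 * s) (2 * s / q)) by (field; lra).
      nra.
    + assert (HL := filterlim_scal_r (Rpower (2 * s) (2 * s / q)) (0 : R_NormedModule)).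
      unfold scal in HL; simpl in HL. unfold mult in HL; simpl in HL. rewrite Rmult_0_r in HL.
      apply (filterlim_comp _ _ _ (fun t => Rpower t (- s)) (fun x => Rpower (2 * s) (2 * s / q) * x) _ (locally 0)); [|exact HL].
      now apply filterlim_Rpower_neg. }
assert (H5 := is_int0_unique _ _ H3). rewrite (is_int0_unique _ _ H4) in H5. lra.
Qed.

Lemma Mellin_base q : 0 < q -> Mellin q q = 1.
Proof.
intros Hq. apply (is_int0_unique (mellin_exp q q)). replace 1 with (0 - (-1)) by ring.
apply (int0_derive (fun t => - exp (- (Rpower t q / q)))).
- intros t Ht. evar_last.
  + apply (is_derive_opp (fun t => exp (- (Rpower t q / q)))). now apply is_derive_exp_Rpower.
  + unfold opp; simpl. unfold mellin_exp. ring.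
- intros; now apply continuous_mellin_exp.
- apply (filterlim_comp _ _ _ (fun t => Rpower t q) (fun x => - exp (- (x / q))) _ (locally 0)).
  + now apply filterlim_Rpower_0.
  + replace (-1) with (- exp (- (0 / q))).
    * apply (ex_derive_continuous (fun x => - exp (- (x / q)))). auto_derive; lra.
    * unfold Rdiv. rewrite Rmult_0_l, Ropp_0, exp_0. ring.
- rewrite <- Ropp_0.
  apply (filterlim_comp _ _ _ (fun t => exp (- (Rpower t q / q))) Ropp _ (locally 0)); [|apply (filterlim_opp (0 : R_NormedModule))].
  apply (filterlim_squeeze0 _ (fun t => Rpower 1 (1 / q) * Rpower t (Ropp 1))).
  + exists 0. intros t Ht. split; [left; apply exp_pos|].
    assert (HB := Rpower_exp_bound q 1 t Hq ltac:(lra) Ht). rewrite Rpower_1 in HB by trivial.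
    rewrite Rpower_Ropp, Rpower_1 by trivial.
    apply Rmult_le_reg_r with t; trivial.
    replace (Rpower 1 (1 / q) * / t * t) with (Rpower 1 (1 / q)) by (field; lra). lra.
  + rewrite Rpower_base1.
    apply (filterlim_ext (fun t => Rpower t (Ropp 1))); [intros; ring|]. apply filterlim_Rpower_neg; lra.
Qed.

(** Convexity of exp: the tangent at l ln x is taken at 0 and at ln x, and with weights 1 - l and l
    the linear terms cancel. *)
Lemma Rpower_le_weighted_AM x l : 0 < x -> 0 <= l <= 1 -> Rpower x l <= 1 - l + l * x.
Proof.
intros Hx Hl. unfold Rpower. set (a := ln x). replace x with (exp a) by (unfold a; now apply exp_ln).
assert (H1 := exp_ineq1_le (a - l * a)). assert (H2 := exp_ineq1_le (- (l * a))).
assert (H3 := exp_pos (l * a)).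
replace (exp a) with (exp (l * a) * exp (a - l * a)) by (rewrite <- exp_plus; f_equal; ring).
assert (H4 : exp (l * a) * exp (- (l * a)) = 1) by (rewrite <- exp_plus, Rplus_opp_r; apply exp_0).
assert (exp (l * a) * (1 + (a - l * a)) <= exp (l * a) * exp (a - l * a)) by (apply Rmult_le_compat_l; lra).
assert (exp (l * a) * (1 + - (l * a)) <= 1) by (rewrite <- H4; apply Rmult_le_compat_l; lra).
nra.
Qed.

(** The weighted mean inequality is applied pointwise to t^q / s. The scale s is the one for which
    [Mellin_add] makes the two integrals on the right add up to [Mellin q s]. *)
Lemma Mellin_log_convex q s l : 0 < q -> 0 < s -> 0 <= l <= 1 ->
  Mellin q (s + q * l) <= Rpower s l * Mellin q s.
Proof.
intros Hq Hs Hl.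
assert (Hsl : 0 < s + q * l) by nra.
assert (H1 := Mellin_correct q s Hq Hs). assert (H2 := Mellin_correct q (s + q) Hq ltac:(lra)).
assert (H3 := int0_lin _ _ (Rpower s l * (1 - l)) (Rpower s l * (l / s)) _ _ H1 H2).
assert (Ea := Mellin_add q s Hq Hs).
replace (Rpower s l * Mellin q s)
  with (Rpower s l * (1 - l) * Mellin q s + Rpower s l * (l / s) * Mellin q (s + q)) by (rewrite Ea; field; lra).
apply int0_le with (2 := Mellin_correct q (s + q * l) Hq Hsl) (3 := H3).
intros t Ht. unfold mellin_exp.
replace (s + q * l - 1) with (s - 1 + q * l) by ring.
replace (s + q - 1) with (s - 1 + q) by ring. rewrite !(Rpower_plus (s - 1)).
rewrite <- (Rpower_mult t q l). set (X := Rpower t q). assert (HX : 0 < X) by apply Rpower_pos.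
assert (HA := Rpower_le_weighted_AM (X / s) l ltac:(apply Rdiv_lt_0_compat; lra) Hl).
replace (Rpower X l) with (Rpower (X / s) l * Rpower s l).
2:{ rewrite Rpower_mult_distr; trivial; [|apply Rdiv_lt_0_compat; lra]. f_equal. field. lra. }
set (E := exp _). set (Y := Rpower t (s - 1)).
assert (HE : 0 < E) by apply exp_pos. assert (HY : 0 < Y) by apply Rpower_pos.
assert (HZ := Rpower_pos s l). assert (0 < Y * Rpower s l * E) by (repeat apply Rmult_lt_0_compat; trivial).
replace (Rpower s l * (1 - l) * (Y * E) + Rpower s l * (l / s) * (Y * X * E))
  with (Y * Rpower s l * E * (1 - l + l * (X / s))) by (field; lra).
replace (Y * (Rpower (X / s) l * Rpower s l) * E) with (Y * Rpower s l * E * Rpower (X / s) l) by ring.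
apply Rmult_le_compat_l; lra.
Qed.

Lemma Mellin_nat q m : 0 < q -> Mellin q (q * INR (S m)) = q ^ m * INR (fact m).
Proof.
intros Hq. induction m as [|m IH].
- simpl. rewrite Rmult_1_r, Mellin_base by trivial. ring.
- replace (q * INR (S (S m))) with (q * INR (S m) + q) by (rewrite (S_INR (S m)); ring).
  assert (0 < INR (S m)) by (apply lt_0_INR; lia).
  rewrite Mellin_add, IH by (trivial; nra). rewrite fact_simpl, mult_INR. simpl pow. ring.
Qed.

Lemma Gamma_Mellin s : 0 < s -> Gamma s = Mellin 1 s.
Proof.
intros Hs. unfold Gamma. apply is_int0_unique.
apply int0_ext with (2 := Mellin_correct 1 s Rlt_0_1 Hs).
intros t Ht. unfold mellin_exp. rewrite Rpower_1 by trivial. f_equal. f_equal. field.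
Qed.

(** * Stirling's formula *)

(** At x = 1/n this is (n + 1/2) ln(1 + 1/n) >= 1, which makes [stirling_seq] decrease. *)
Lemma ln_1p_ge x : 0 <= x -> 2 * x / (2 + x) <= ln (1 + x).
Proof.
intros Hx. cut (ln (1 + 0) - 2 * 0 / (2 + 0) <= ln (1 + x) - 2 * x / (2 + x)).
{ rewrite !Rplus_0_r, ln_1. lra. }
apply (incr_seg (fun x => ln (1 + x) - 2 * x / (2 + x)) (fun x => / (1 + x) - 4 / (2 + x) ^ 2)); trivial.
- intros z Hz. auto_derive; [lra|]. field. lra.
- intros z Hz. replace (/ (1 + z) - 4 / (2 + z) ^ 2) with (z ^ 2 / ((1 + z) * (2 + z) ^ 2)) by (field; lra).
  apply Rmult_le_pos; [apply pow2_ge_0|]. left. apply Rinv_0_lt_compat. nra.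
Qed.

(** At x = 1/n this makes the decrease of [stirling_seq] at most the telescoping term (1/n -
    1/(n+1)) / 4. *)
Lemma ln_1p_le x : 0 <= x -> ln (1 + x) <= x * (2 + x) / (2 * (1 + x)).
Proof.
intros Hx. cut (0 * (2 + 0) / (2 * (1 + 0)) - ln (1 + 0) <= x * (2 + x) / (2 * (1 + x)) - ln (1 + x)).
{ rewrite !Rplus_0_r, ln_1. lra. }
apply (incr_seg (fun x => x * (2 + x) / (2 * (1 + x)) - ln (1 + x)) (fun x => x ^ 2 / (2 * (1 + x) ^ 2))); trivial.
- intros z Hz. auto_derive; [lra|]. field. lra.
- intros z Hz. apply Rmult_le_pos; [apply pow2_ge_0|]. left. apply Rinv_0_lt_compat. nra.
Qed.

Definition stirling_seq (n : nat) : R := ln (INR (fact n)) - (INR n + / 2) * ln (INR n) + INR n.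

Lemma stirling_step n : (1 <= n)%nat ->
  0 <= stirling_seq n - stirling_seq (S n) <= / 4 * (/ INR n - / INR (S n)).
Proof.
intros Hn. assert (Hp : 0 < INR n) by (apply lt_0_INR; lia).
assert (E : stirling_seq n - stirling_seq (S n) = (INR n + / 2) * ln (1 + / INR n) - 1).
{ unfold stirling_seq. rewrite fact_simpl, mult_INR, !S_INR.
  rewrite ln_mult; [|lra|apply lt_0_INR, lt_O_fact].
  replace (INR n + 1) with (INR n * (1 + / INR n)) by (field; lra).
  rewrite ln_mult; [|lra|assert (H := Rinv_0_lt_compat _ Hp); lra]. 
  replace (INR n * (1 + / INR n)) with (INR n + 1) by (field; lra). field. }
rewrite E. set (x := INR n) in *. rewrite S_INR. fold x. assert (Hi := Rinv_0_lt_compat _ Hp).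
assert (H1 := ln_1p_ge (/ x) ltac:(lra)). assert (H2 := ln_1p_le (/ x) ltac:(lra)). split.
- assert ((x + / 2) * (2 * / x / (2 + / x)) <= (x + / 2) * ln (1 + / x)) by (apply Rmult_le_compat_l; lra).
  replace ((x + / 2) * (2 * / x / (2 + / x))) with 1 in H by (field; lra). lra.
- assert ((x + / 2) * ln (1 + / x) <= (x + / 2) * (/ x * (2 + / x) / (2 * (1 + / x)))) by (apply Rmult_le_compat_l; lra).
  replace ((x + / 2) * (/ x * (2 + / x) / (2 * (1 + / x)))) with (1 + / 4 * (/ x - / (x + 1))) in H by (field; lra). lra.
Qed.

(** The sequence decreases while the sequence minus 1/(4 n) increases; a is the supremum of the
    latter. *)
Lemma stirling_limit_exists :
  exists a, forall n, (1 <= n)%nat -> a <= stirling_seq n <= a + / 4 * / INR n.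
Proof.
assert (Hd : forall n k, (1 <= n)%nat ->
   0 <= stirling_seq n - stirling_seq (n + k) <= / 4 * (/ INR n - / INR (n + k))).
{ intros n k Hn. induction k as [|k IH].
  - rewrite Nat.add_0_r. lra.
  - rewrite Nat.add_succ_r. assert (H := stirling_step (n + k) ltac:(lia)). lra. }
destruct (completeness (fun v => exists n, (1 <= n)%nat /\ v = stirling_seq n - / 4 * / INR n)) as [a [Ha1 Ha2]].
- exists (stirling_seq 1). intros v [n [Hn ->]].
  assert (H := Hd 1%nat (n - 1)%nat ltac:(lia)). replace (1 + (n - 1))%nat with n in H by lia.
  assert (0 < / INR n) by (apply Rinv_0_lt_compat, lt_0_INR; lia). lra.
- exists (stirling_seq 1 - / 4 * / INR 1). exists 1%nat. split; trivial.
- exists a. intros n Hn. split.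
  + apply Ha2. intros v [m [Hm ->]].
    assert (0 < / INR n) by (apply Rinv_0_lt_compat, lt_0_INR; lia).
    assert (0 < / INR m) by (apply Rinv_0_lt_compat, lt_0_INR; lia).
    destruct (Nat.le_ge_cases n m) as [Hnm|Hnm].
    * assert (H1 := Hd n (m - n)%nat Hn). replace (n + (m - n))%nat with m in H1 by lia. lra.
    * assert (H1 := Hd m (n - m)%nat Hm). replace (m + (n - m))%nat with n in H1 by lia. lra.
  + assert (stirling_seq n - / 4 * / INR n <= a) by (apply Ha1; now exists n). lra.
Qed.

Definition wallis (n : nat) : R := RInt (fun x => sin x ^ n) 0 (PI / 2).

Lemma ex_RInt_sin_pow n a b : ex_RInt (fun x => sin x ^ n) a b.
Proof.
apply (ex_RInt_continuous (V := R_CompleteNormedModule)). intros z _.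
apply (ex_derive_continuous (fun x => sin x ^ n)). auto_derive; trivial.
Qed.

Lemma wallis_rec n : (INR n + 2) * wallis (S (S n)) = (INR n + 1) * wallis n.
Proof.
assert (H : is_RInt (fun x => (INR n + 1) * sin x ^ n + - (INR n + 2) * sin x ^ S (S n)) 0 (PI / 2)
   (sin (PI / 2) ^ S n * cos (PI / 2) - sin 0 ^ S n * cos 0)).
{ apply (is_RInt_derive (fun x => sin x ^ S n * cos x)).
  - intros x _. auto_derive; trivial. change (match n with O => 1 | S _ => INR n + 1 end) with (INR (S n)). rewrite S_INR.
    assert (E := sin2_cos2 x). unfold Rsqr in E. simpl.
    assert (E1 : cos x * cos x = 1 - sin x * sin x) by lra.
    transitivity ((cos x * cos x) * (INR n + 1) * sin x ^ n - sin x * sin x * sin x ^ n); [ring|].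
    rewrite E1. ring.
  - intros x _. apply (ex_derive_continuous (fun x => (INR n + 1) * sin x ^ n + - (INR n + 2) * sin x ^ S (S n))).
    auto_derive; trivial. }
assert (H2 : is_RInt (fun x => (INR n + 1) * sin x ^ n + - (INR n + 2) * sin x ^ S (S n)) 0 (PI / 2)
   ((INR n + 1) * wallis n + - (INR n + 2) * wallis (S (S n)))).
{ apply (is_RInt_plus (fun x => (INR n + 1) * sin x ^ n) (fun x => - (INR n + 2) * sin x ^ S (S n))).
  - apply (is_RInt_scal (fun x => sin x ^ n)). apply (RInt_correct (fun x => sin x ^ n)), ex_RInt_sin_pow.
  - apply (is_RInt_scal (fun x => sin x ^ S (S n))). apply (RInt_correct (fun x => sin x ^ S (S n))), ex_RInt_sin_pow. }
apply (is_RInt_unique (V := R_CompleteNormedModule)) in H. apply (is_RInt_unique (V := R_CompleteNormedModule)) in H2. rewrite H in H2.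
rewrite cos_PI2, sin_0, pow_i in H2 by lia. lra.
Qed.

Lemma wallis_decr n : wallis (S n) <= wallis n.
Proof.
assert (Hpi := PI_RGT_0).
apply RInt_le; try apply ex_RInt_sin_pow; [lra|].
intros x Hx. simpl. assert (0 <= sin x) by (apply sin_ge_0; lra).
assert (Hs := SIN_bound x). assert (0 <= sin x ^ n) by now apply pow_le. nra.
Qed.

Lemma wallis_0 : wallis 0 = PI / 2.
Proof.
unfold wallis. simpl. rewrite RInt_const. unfold scal; simpl. unfold mult; simpl. ring.
Qed.

Lemma wallis_1 : wallis 1 = 1.
Proof.
unfold wallis. rewrite (RInt_ext _ sin) by (intros; simpl; ring).
assert (H : is_RInt sin 0 (PI / 2) (- cos (PI / 2) - - cos 0)).
{ apply (is_RInt_derive (fun x => - cos x)).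
  - intros x _. auto_derive; trivial. ring.
  - intros x _. apply (ex_derive_continuous sin). auto_derive; trivial. }
apply (is_RInt_unique (V := R_CompleteNormedModule)) in H. rewrite H, cos_PI2, cos_0. ring.
Qed.

Lemma wallis_even_odd n :
  wallis (2 * n) * (4 ^ n * INR (fact n) ^ 2) = PI / 2 * INR (fact (2 * n)) /\
  wallis (S (2 * n)) * INR (fact (S (2 * n))) = 4 ^ n * INR (fact n) ^ 2.
Proof.
induction n as [|n [IH1 IH2]].
- simpl. rewrite wallis_0, wallis_1. split; ring.
- replace (2 * S n)%nat with (S (S (2 * n))) by lia.
  assert (R1 := wallis_rec (2 * n)). assert (R2 := wallis_rec (S (2 * n))).
  rewrite !fact_simpl, !mult_INR, !S_INR, ?mult_INR.
  rewrite fact_simpl, mult_INR, S_INR, mult_INR in IH2.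
  rewrite S_INR, mult_INR in R2. rewrite mult_INR in R1.
  change (INR 2) with (1 + 1) in *. change (4 ^ S n) with (4 * 4 ^ n). set (x := INR n) in *.
  set (f := INR (fact n)) in *. set (g := INR (fact (2 * n))) in *.
  set (w0 := wallis (2 * n)) in *. set (w1 := wallis (S (2 * n))) in *.
  set (w2 := wallis (S (S (2 * n)))) in *. set (w3 := wallis (S (S (S (2 * n))))) in *.
  set (P := 4 ^ n) in *. split.
  + replace (w2 * (4 * P * ((x + 1) * f) ^ 2)) with ((((1 + 1) * x + 2) * w2) * (P * f ^ 2) * (2 * (x + 1))) by ring.
    rewrite R1. replace (((1 + 1) * x + 1) * w0 * (P * f ^ 2) * (2 * (x + 1)))
      with ((w0 * (P * f ^ 2)) * (((1 + 1) * x + 1) * (2 * (x + 1)))) by ring.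
    rewrite IH1. field.
  + replace (w3 * (((1 + 1) * x + 1 + 1 + 1) * (((1 + 1) * x + 1 + 1) * (((1 + 1) * x + 1) * g))))
      with ((((1 + 1) * x + 1 + 2) * w3) * (((1 + 1) * x + 1 + 1) * (((1 + 1) * x + 1) * g))) by ring.
    rewrite R2. replace (((1 + 1) * x + 1 + 1) * w1 * (((1 + 1) * x + 1 + 1) * (((1 + 1) * x + 1) * g)))
      with ((w1 * (((1 + 1) * x + 1) * g)) * ((1 + 1) * x + 1 + 1) ^ 2) by ring.
    rewrite IH2. ring.
Qed.

(** For even indices the closed form gives positivity. The general case follows because the sequence
    decreases and 2 n >= n. *)
Lemma wallis_pos n : 0 < wallis n.
Proof.
assert (H2 : 0 < wallis (2 * n)).
{ destruct (wallis_even_odd n) as [H _]. 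
  assert (0 < 4 ^ n * INR (fact n) ^ 2).
  { apply Rmult_lt_0_compat; apply pow_lt; [lra|apply lt_0_INR, lt_O_fact]. }
  assert (0 < PI / 2 * INR (fact (2 * n))).
  { apply Rmult_lt_0_compat; [generalize PI_RGT_0; lra|apply lt_0_INR, lt_O_fact]. }
  nra. }
assert (forall k, wallis (n + k) <= wallis n).
{ intros k. induction k; [rewrite Nat.add_0_r; lra|]. rewrite Nat.add_succ_r. generalize (wallis_decr (n + k)). lra. }
specialize (H n). replace (n + n)%nat with (2 * n)%nat in H by lia. lra.
Qed.

(** The middle term is the quotient of the Wallis integrals of indices 2n and 2n+1. Monotonicity
    puts it between 1 and the quotient for 2n and 2n+2, which the recursion evaluates. *)
Lemma wallis_ratio n : 1 <= PI / 2 * INR (fact (2 * n)) ^ 2 * (2 * INR n + 1) / (16 ^ n * INR (fact n) ^ 4) <= (2 * INR n + 2) / (2 * INR n + 1).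
Proof.
destruct (wallis_even_odd n) as [H1 H2]. assert (R1 := wallis_rec (2 * n)).
assert (D1 := wallis_decr (2 * n)). assert (D2 := wallis_decr (S (2 * n))).
assert (P0 := wallis_pos (2 * n)). assert (P1 := wallis_pos (S (2 * n))).
rewrite fact_simpl, mult_INR, S_INR in H2. rewrite mult_INR in *. simpl (INR 2) in *.
assert (Hf : 0 < INR (fact n)) by apply lt_0_INR, lt_O_fact.
assert (Hg : 0 < INR (fact (2 * n))) by apply lt_0_INR, lt_O_fact.
assert (Hx := pos_INR n).
replace 16 with (4 * 4) by ring. rewrite Rpow_mult_distr.
assert (HP : 0 < 4 ^ n) by (apply pow_lt; lra).
set (x := INR n) in *. set (f := INR (fact n)) in *. set (g := INR (fact (2 * n))) in *.
set (w0 := wallis (2 * n)) in *. set (w1 := wallis (S (2 * n))) in *.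
set (w2 := wallis (S (S (2 * n)))) in *. set (P := 4 ^ n) in *.
assert (E : PI / 2 * g ^ 2 * (2 * x + 1) / (P * P * f ^ 4) = w0 / w1).
{ replace (PI / 2 * g ^ 2 * (2 * x + 1)) with ((PI / 2 * g) * (g * (2 * x + 1))) by ring.
  rewrite <- H1. replace (g * (2 * x + 1)) with (P * f ^ 2 / w1) by (rewrite <- H2; field; lra).
  field. repeat split; lra. }
rewrite E. split.
- apply Rmult_le_reg_r with w1; trivial. replace (w0 / w1 * w1) with w0 by (field; lra). lra.
- apply Rmult_le_reg_r with w1; trivial. replace (w0 / w1 * w1) with w0 by (field; lra).
  apply Rmult_le_reg_r with (2 * x + 1); [lra|].
  replace ((2 * x + 2) / (2 * x + 1) * w1 * (2 * x + 1)) with ((2 * x + 2) * w1) by (field; lra). nra.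
Qed.

Lemma Rle_0_of_le_inv_INR (y C : R) : 0 <= C -> (forall n, (1 <= n)%nat -> y <= C / INR n) -> y <= 0.
Proof.
intros HC H. apply Rnot_lt_le. intros Hy.
destruct (nfloor_ex (C / y)) as [n Hn]; [apply Rmult_le_pos; [lra|left; now apply Rinv_0_lt_compat]|].
specialize (H (S n) ltac:(lia)). rewrite S_INR in H. assert (Hp := pos_INR n).
apply Rmult_le_compat_r with (r := INR n + 1) in H; [|lra].
replace (C / (INR n + 1) * (INR n + 1)) with C in H by (field; lra).
assert (C / y * y < (INR n + 1) * y) by (apply Rmult_lt_compat_r; lra).
replace (C / y * y) with C in H0 by (field; lra). lra.
Qed.

Theorem stirling n : (1 <= n)%nat -> 0 <= stirling_seq n - ln (2 * PI) / 2 <= / 4 * / INR n.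
Proof.
destruct stirling_limit_exists as [a Ha].
assert (Hpi := PI_RGT_0).
(* In the logarithm of the Wallis quotient the factorials enter as 2 ln (2k)! - 4 ln k!. After
   Stirling with unknown constant a, all growing terms cancel and ln(2 PI) - 2 a remains. *)
assert (Hk : forall n, (1 <= n)%nat -> Rabs (ln (2 * PI) - 2 * a) <= 2 / INR n).
{ intros k Hk. assert (Hx : 0 < INR k) by (apply lt_0_INR; lia).
  assert (Hf : 0 < INR (fact k)) by apply lt_0_INR, lt_O_fact.
  assert (Hg : 0 < INR (fact (2 * k))) by apply lt_0_INR, lt_O_fact.
  assert (H1 := Ha k Hk). assert (H2 := Ha (2 * k)%nat ltac:(lia)).
  destruct (wallis_ratio k) as [W1 W2].
  assert (HP : 0 < 16 ^ k) by (apply pow_lt; lra).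
  unfold stirling_seq in H1, H2. rewrite mult_INR in H2. simpl (INR 2) in H2.
  assert (E : ln (PI / 2 * INR (fact (2 * k)) ^ 2 * (2 * INR k + 1) / (16 ^ k * INR (fact k) ^ 4))
     = ln PI - ln 2 + 2 * ln (INR (fact (2 * k))) + ln (2 * INR k + 1) - INR k * (4 * ln 2) - 4 * ln (INR (fact k))).
  { rewrite ln_div; [|pos|pos].
    rewrite !ln_mult; pos.
    rewrite ln_div, !ln_pow by lra.
    replace 16 with (2 ^ 4) by ring. rewrite ln_pow by lra. simpl INR. ring. }
  assert (L1 : 0 <= ln PI - ln 2 + 2 * ln (INR (fact (2 * k))) + ln (2 * INR k + 1) - INR k * (4 * ln 2) - 4 * ln (INR (fact k))).
  { rewrite <- E, <- ln_1. apply ln_le; lra. }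
  assert (L2 : ln PI - ln 2 + 2 * ln (INR (fact (2 * k))) + ln (2 * INR k + 1) - INR k * (4 * ln 2) - 4 * ln (INR (fact k)) <= / (2 * INR k + 1)).
  { rewrite <- E. apply Rle_trans with (ln ((2 * INR k + 2) / (2 * INR k + 1))); [apply ln_le; lra|].
    replace ((2 * INR k + 2) / (2 * INR k + 1)) with (1 + / (2 * INR k + 1)) by (field; lra).
    apply ln_1p_le_id. left; apply Rinv_0_lt_compat; lra. }
  assert (L3 : 0 <= ln (2 * INR k + 1) - ln (2 * INR k) <= / (2 * INR k)).
  { rewrite <- ln_div by lra. replace ((2 * INR k + 1) / (2 * INR k)) with (1 + / (2 * INR k)) by (field; lra).
    assert (0 < / (2 * INR k)) by (apply Rinv_0_lt_compat; lra). split.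
    - rewrite <- ln_1. apply ln_le; lra.
    - apply ln_1p_le_id; lra. }
  assert (E2 : ln (2 * INR k) = ln 2 + ln (INR k)) by (apply ln_mult; lra).
  assert (E3 : ln (2 * PI) = ln 2 + ln PI) by (apply ln_mult; lra).
  replace (1 + 1) with 2 in H2 by ring. rewrite E2 in *. rewrite E3.
  assert (I1 : / (2 * INR k) = / 2 * / INR k) by (field; lra).
  assert (I2 : / (2 * INR k + 1) <= / 2 * / INR k) by (rewrite <- I1; apply Rinv_le_contravar; lra).
  assert (I0 := Rinv_0_lt_compat _ Hx). rewrite I1 in *. unfold Rdiv.
  set (y := INR k) in *. set (l2 := ln 2) in *. set (ly := ln y) in *.
  assert (M1 : 4 * a <= 4 * (ln (INR (fact k)) - (y + / 2) * ly + y) <= 4 * a + / y) by lra.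
  assert (M2 : 2 * a <= 2 * (ln (INR (fact (2 * k))) - (2 * y + / 2) * (l2 + ly) + 2 * y) <= 2 * a + / 4 * / y) by lra.
  apply Rabs_le.
  split; nra. }
assert (E : ln (2 * PI) = 2 * a).
{ assert (Rabs (ln (2 * PI) - 2 * a) <= 0) by (apply (Rle_0_of_le_inv_INR _ 2); [lra|exact Hk]).
  assert (H1 := Rabs_pos (ln (2 * PI) - 2 * a)).
  assert (H2 := Rle_abs (ln (2 * PI) - 2 * a)). assert (H3 := Rle_abs (- (ln (2 * PI) - 2 * a))).
  rewrite Rabs_Ropp in H3. lra. }
intros Hn. specialize (Ha n Hn). lra.
Qed.

(** * The connection coefficient of the Airy function *)

Lemma wkb_Rpower t : 0 < t -> wkb t = Rpower t (1 / 4) * exp (Rpower t (3 / 2) / (3 / 2)).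
Proof.
intros Ht. unfold wkb. f_equal.
- rewrite <- !Rpower_sqrt; [|now trivial|apply sqrt_lt_R0; trivial]. rewrite Rpower_mult. f_equal. field.
- f_equal. replace (3 / 2) with (1 + / 2) at 1 by field. rewrite Rpower_plus, Rpower_1, Rpower_sqrt by trivial. field.
Qed.

Lemma pow_div_wkb m t : 0 < t -> t ^ m / wkb t = mellin_exp (3 / 2) (INR m + 3 / 4) t.
Proof.
intros Ht. rewrite wkb_Rpower by trivial. unfold mellin_exp.
replace (INR m + 3 / 4 - 1) with (INR m + - (1 / 4)) by field.
rewrite Rpower_plus, Rpower_pow, Rpower_Ropp, exp_Ropp by trivial.
assert (H := Rpower_pos t (1 / 4)). assert (H1 := exp_pos (Rpower t (3 / 2) / (3 / 2))). field. lra.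
Qed.

Lemma mellin_exp_shift m t : 0 < t ->
  mellin_exp (3 / 2) (INR m + 3 / 4) t * / (t * sqrt t) = mellin_exp (3 / 2) (INR m - 3 / 4) t.
Proof.
intros Ht. unfold mellin_exp.
replace (INR m + 3 / 4 - 1) with (INR m - 3 / 4 - 1 + (1 + / 2)) by field.
rewrite Rpower_plus with (y := 1 + / 2), Rpower_plus, Rpower_1, Rpower_sqrt by trivial.
assert (H := sqrt_lt_R0 t Ht). field. lra.
Qed.

Lemma continuous_airy A D t : decaying_airy A D -> continuous A t.
Proof. intros H. apply (ex_derive_continuous A). exists (D t). apply H. Qed.

Lemma continuous_pow_airy A D m t : decaying_airy A D -> continuous (fun t => t ^ m * A t) t.
Proof.
intros H. apply (continuous_mult (fun t => t ^ m) A).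
- apply (ex_derive_continuous (fun t => t ^ m)). auto_derive; trivial.
- now apply (continuous_airy A D).
Qed.

Definition airy_connected (A : R -> R) (c : R) : Prop :=
  0 < c /\ forall t, 0 < t -> A t * wkb t <= c <= A t * wkb t * exp (5 / 48 * / (t * sqrt t)).

Lemma airy_le_wkb A c t : airy_connected A c -> 0 < t -> A t <= c / wkb t.
Proof.
intros [Hc H] Ht. assert (Hw := wkb_pos t Ht). destruct (H t Ht) as [H1 _].
apply Rmult_le_reg_r with (wkb t); trivial. replace (c / wkb t * wkb t) with c by (field; lra). trivial.
Qed.

Lemma airy_ge_wkb A c t : airy_connected A c -> 0 < t -> c / wkb t * (1 - 5 / 48 * / (t * sqrt t)) <= A t.
Proof.
intros [Hc H] Ht. assert (Hw := wkb_pos t Ht). destruct (H t Ht) as [_ H1].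
set (y := 5 / 48 * / (t * sqrt t)) in *.
assert (H2 := exp_ineq1_le (- y)). rewrite exp_Ropp in H2. assert (H3 := exp_pos y).
assert (Hcw : 0 < c / wkb t) by pos.
apply Rle_trans with (c / wkb t * / exp y); [apply Rmult_le_compat_l; lra|].
apply Rmult_le_reg_r with (wkb t * exp y); [pos|].
replace (c / wkb t * / exp y * (wkb t * exp y)) with c by (field; lra). lra.
Qed.

Definition airy_moment (A : R -> R) (m : nat) : R :=
  RInt_gen (fun t => t ^ m * A t) (at_right 0) (Rbar_locally p_infty).

Lemma pow_airy_le A D c m t : decaying_airy A D -> airy_connected A c -> 0 < t ->
  0 <= t ^ m * A t <= c * mellin_exp (3 / 2) (INR m + 3 / 4) t.
Proof.
intros H Hc Ht. assert (Ha := airy_pos A D H t ltac:(lra)). assert (Hle := airy_le_wkb A c t Hc Ht).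
rewrite <- pow_div_wkb by trivial. assert (Hw := wkb_pos t Ht).
replace (c * (t ^ m / wkb t)) with (t ^ m * (c / wkb t)) by (field; lra).
assert (Hm : 0 < t ^ m) by pos. split; [left; pos|]. apply Rmult_le_compat_l; lra.
Qed.

Lemma airy_moment_correct A D c m : decaying_airy A D -> airy_connected A c ->
  is_int0 (fun t => t ^ m * A t) (airy_moment A m).
Proof.
intros H Hc. assert (Hm := pos_INR m).
assert (Hg := Mellin_correct (3 / 2) (INR m + 3 / 4) ltac:(lra) ltac:(lra)).
destruct (ex_int0_dom (fun t => t ^ m * A t) (fun t => c * mellin_exp (3 / 2) (INR m + 3 / 4) t)
  (c * Mellin (3 / 2) (INR m + 3 / 4))) as [l Hl].
- intros; now apply (continuous_pow_airy A D).
- intros; now apply (pow_airy_le A D).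
- intros. apply (continuous_scal_r c (mellin_exp (3 / 2) (INR m + 3 / 4))). apply continuous_mellin_exp; lra.
- apply (is_RInt_gen_scal _ c _ Hg).
- unfold airy_moment. now rewrite (is_int0_unique _ _ Hl).
Qed.

(** For large m the moment weighs large t, where A is close to c / [wkb]. The correction t^(-3/2)
    lowers the Mellin argument by 3/2, and [Mellin_add] turns that into the factor 1 / (m - 3/4). *)
Lemma airy_moment_bounds A D c m : decaying_airy A D -> airy_connected A c -> (1 <= m)%nat ->
  c * Mellin (3 / 2) (INR m + 3 / 4) * (1 - 5 / 48 / (INR m - 3 / 4)) <= airy_moment A m
  <= c * Mellin (3 / 2) (INR m + 3 / 4).
Proof.
intros H Hc Hm. assert (Hm1 : 1 <= INR m) by (apply (le_INR 1 m); trivial).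
assert (H1 := airy_moment_correct A D c m H Hc).
assert (H2 := Mellin_correct (3 / 2) (INR m + 3 / 4) ltac:(lra) ltac:(lra)).
assert (H3 := Mellin_correct (3 / 2) (INR m - 3 / 4) ltac:(lra) ltac:(lra)).
split.
- assert (E := Mellin_add (3 / 2) (INR m - 3 / 4) ltac:(lra) ltac:(lra)).
  replace (INR m - 3 / 4 + 3 / 2) with (INR m + 3 / 4) in E by field.
  replace (c * Mellin (3 / 2) (INR m + 3 / 4) * (1 - 5 / 48 / (INR m - 3 / 4)))
    with (c * Mellin (3 / 2) (INR m + 3 / 4) + - (c * (5 / 48)) * Mellin (3 / 2) (INR m - 3 / 4))
    by (rewrite E; field; lra).
  apply int0_le with (2 := int0_lin _ _ c (- (c * (5 / 48))) _ _ H2 H3) (3 := H1).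
  intros t Ht. rewrite <- (mellin_exp_shift m) by trivial. rewrite <- pow_div_wkb by trivial.
  assert (Hge := airy_ge_wkb A c t Hc Ht). assert (Hw := wkb_pos t Ht). assert (Hs := sqrt_lt_R0 t Ht).
  replace (c * (t ^ m / wkb t) + - (c * (5 / 48)) * (t ^ m / wkb t * / (t * sqrt t)))
    with (t ^ m * (c / wkb t * (1 - 5 / 48 * / (t * sqrt t)))) by (field; lra).
  apply Rmult_le_compat_l; trivial. left; pos.
- apply int0_le with (2 := H1) (3 := is_RInt_gen_scal _ c _ H2).
  intros t Ht. now apply (pow_airy_le A D).
Qed.

Lemma airy_deriv_abs_le A D t : decaying_airy A D -> 1 <= t -> Rabs (D t) <= 2 * t * A t.
Proof.
intros H Ht. assert (H1 := airy_deriv_le0 A D H t ltac:(lra)).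
assert (H2 := airy_defect_ge0 A D t H ltac:(lra)). assert (H3 := airy_pos A D H t ltac:(lra)).
rewrite Rabs_left1 by trivial. unfold airy_defect, wkb_rate in H2.
assert (sqrt t <= t).
{ rewrite <- (sqrt_sqrt t) at 2 by lra. assert (1 <= sqrt t) by (rewrite <- sqrt_1; apply sqrt_le_1; lra). nra. }
assert (/ (4 * t) <= 1) by (rewrite <- Rinv_1; apply Rinv_le_contravar; lra).
nra.
Qed.

Lemma pow_airy_decay A D c m t : decaying_airy A D -> airy_connected A c -> 1 <= t ->
  t ^ m * A t <= c * Rpower (INR (S m)) (INR (S m) / (3 / 2)) * / t.
Proof.
intros H Hc Ht. assert (Hle := airy_le_wkb A c t Hc ltac:(lra)).
assert (HS : 0 < INR (S m)) by (apply lt_0_INR; lia).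
assert (HB := Rpower_exp_bound (3 / 2) (INR (S m)) t ltac:(lra) HS ltac:(lra)).
rewrite Rpower_pow in HB by lra. set (B := Rpower (INR (S m)) _) in *.
assert (Hp : 0 < t ^ m) by pos. assert (Hc0 := proj1 Hc).
assert (Hw : exp (Rpower t (3 / 2) / (3 / 2)) <= wkb t).
{ rewrite wkb_Rpower by lra. rewrite <- (Rmult_1_l (exp _)) at 1. apply Rmult_le_compat_r; [left; apply exp_pos|].
  apply Rle_trans with (Rpower t 0); [rewrite Rpower_O; lra|apply Rle_Rpower; lra]. }
assert (He := exp_pos (Rpower t (3 / 2) / (3 / 2))).
apply Rle_trans with (t ^ m * (c * exp (- (Rpower t (3 / 2) / (3 / 2))))).
- apply Rmult_le_compat_l; [lra|]. apply Rle_trans with (1 := Hle). rewrite exp_Ropp.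
  apply Rmult_le_compat_l; [lra|]. apply Rinv_le_contravar; lra.
- apply Rmult_le_reg_r with t; [lra|]. simpl pow in HB.
  replace (c * B * / t * t) with (c * B) by (field; lra).
  set (E := exp _) in *. replace (t ^ m * (c * E) * t) with (c * (t * t ^ m * E)) by ring.
  apply Rmult_le_compat_l; lra.
Qed.

Lemma filterlim_inv_0 (K : R) : filterlim (fun t => K * / t) (Rbar_locally p_infty) (locally 0).
Proof.
assert (H : is_lim (fun t => K * / t) p_infty (Rbar_mult K 0)).
{ apply is_lim_scal_l. apply (is_lim_inv (fun t => t) p_infty p_infty); [apply is_lim_id|discriminate]. }
replace (Rbar_mult K 0) with (Finite 0) in H by (simpl; f_equal; ring). exact H.
Qed.

(** The integrand is the derivative of t^(m+1) D - (m+1) t^m A. At 0 only m = 0 contributes, since 0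
    ^ 0 = 1; the truncated exponent m - 1 is harmless there because of the factor [INR m]. *)
Lemma airy_moment_boundary A D c m : decaying_airy A D -> airy_connected A c ->
  is_int0 (fun t => t ^ (m + 2) * A t - (INR m + 1) * INR m * t ^ (m - 1) * A t) (0 - - ((INR m + 1) * 0 ^ m * A 0)).
Proof.
intros H Hc. assert (H1 := airy_D1 A D H). assert (H2 := airy_D2 A D H).
assert (HF : forall t, is_derive (fun t => t ^ S m * D t - (INR m + 1) * t ^ m * A t) t
  (t ^ (m + 2) * A t - (INR m + 1) * INR m * t ^ (m - 1) * A t)).
{ intros t. auto_derive.
  - repeat split; [exists (t * A t); apply H2|exists (D t); apply H1].
  - subst_derive A H1 t. subst_derive D H2 t.
    change (match m with O => 1 | S _ => INR m + 1 end) with (INR (S m)). rewrite S_INR.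
    replace (m + 2)%nat with (S (S m)) by lia. replace (Init.Nat.pred m) with (m - 1)%nat by lia. simpl. ring. }
apply (int0_derive (fun t => t ^ S m * D t - (INR m + 1) * t ^ m * A t)).
- intros; apply HF.
- intros t _. apply (continuous_minus (fun t => t ^ (m + 2) * A t) (fun t => (INR m + 1) * INR m * t ^ (m - 1) * A t)).
  + now apply (continuous_pow_airy A D).
  + apply (continuous_ext (fun t => ((INR m + 1) * INR m) * (t ^ (m - 1) * A t))); [intros; symmetry; apply Rmult_assoc|].
    apply (continuous_scal_r ((INR m + 1) * INR m) (fun t => t ^ (m - 1) * A t)). now apply (continuous_pow_airy A D).
- replace (- ((INR m + 1) * 0 ^ m * A 0)) with (0 ^ S m * D 0 - (INR m + 1) * 0 ^ m * A 0) by (simpl; ring).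
  apply (filterlim_filter_le_1 (F := locally 0)); [apply filter_le_within|].
  apply (ex_derive_continuous (fun t => t ^ S m * D t - (INR m + 1) * t ^ m * A t)). eexists. apply HF.
(* For t >= 1 the primitive is at most (m + 3) t^(m+2) A in absolute value, by |D| <= 2 t A, and
   [pow_airy_decay] bounds this by K / t. *)
- set (K := (INR m + 3) * (c * Rpower (INR (S (m + 2))) (INR (S (m + 2)) / (3 / 2)))).
  apply (filterlim_le_le (fun t => - K * / t) _ (fun t => K * / t) (Finite 0)).
  + exists 1. intros t Ht. replace (- K * / t) with (- (K * / t)) by ring. apply Rabs_le_between.
    assert (Hd := pow_airy_decay A D c (m + 2) t H Hc ltac:(lra)).
    assert (Ha := airy_pos A D H t ltac:(lra)). assert (HD := airy_deriv_abs_le A D t H ltac:(lra)).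
    assert (Hp : 0 < t ^ m) by pos. assert (Hm := pos_INR m).
    apply Rle_trans with (t ^ S m * (2 * t * A t) + (INR m + 1) * t ^ m * A t).
    * apply Rle_trans with (1 := Rabs_triang _ _). rewrite Rabs_Ropp, !Rabs_mult.
      rewrite (Rabs_pos_eq (t ^ S m)) by (left; pos). rewrite (Rabs_pos_eq (INR m + 1)), (Rabs_pos_eq (t ^ m)), (Rabs_pos_eq (A t)) by lra.
      apply Rplus_le_compat_r. apply Rmult_le_compat_l; [left; pos|trivial].
    * unfold K. set (B := c * Rpower _ _) in *.
      replace ((INR m + 3) * B * / t) with ((INR m + 3) * (B * / t)) by ring.
      apply Rle_trans with ((INR m + 3) * (t ^ (m + 2) * A t)); [|apply Rmult_le_compat_l; lra].
      replace (m + 2)%nat with (S (S m)) by lia. simpl pow.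
      assert (0 < t ^ m * A t) by pos. assert (1 <= t * t) by nra.
      assert ((INR m + 1) * (t ^ m * A t) * 1 <= (INR m + 1) * (t ^ m * A t) * (t * t)) by (apply Rmult_le_compat_l; nra).
      nra.
  + apply filterlim_inv_0.
  + apply filterlim_inv_0.
Qed.

Lemma airy_moment_2 A D c : decaying_airy A D -> airy_connected A c -> airy_moment A 2 = A 0.
Proof.
intros H Hc. apply (is_int0_unique (fun t => t ^ 2 * A t)).
assert (H0 := airy_moment_boundary A D c 0 H Hc).
replace (0 - - ((INR 0 + 1) * 0 ^ 0 * A 0)) with (A 0) in H0 by (simpl; ring).
apply int0_ext with (2 := H0). intros t Ht. simpl. ring.
Qed.

Lemma airy_moment_rec A D c m : decaying_airy A D -> airy_connected A c ->
  airy_moment A (m + 3) = (INR m + 2) * (INR m + 1) * airy_moment A m.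
Proof.
intros H Hc. assert (H0 := airy_moment_boundary A D c (m + 1) H Hc).
assert (H1 := airy_moment_correct A D c (m + 3) H Hc). assert (H2 := airy_moment_correct A D c m H Hc).
assert (H3 := int0_lin _ _ 1 (- ((INR m + 2) * (INR m + 1))) _ _ H1 H2).
apply is_int0_unique in H0. 
assert (H4 : is_int0 (fun t => t ^ (m + 1 + 2) * A t - (INR (m + 1) + 1) * INR (m + 1) * t ^ (m + 1 - 1) * A t)
   (1 * airy_moment A (m + 3) + - ((INR m + 2) * (INR m + 1)) * airy_moment A m)).
{ apply int0_ext with (2 := H3). intros t Ht. rewrite plus_INR. simpl (INR 1).
  replace (m + 1 + 2)%nat with (m + 3)%nat by lia. replace (m + 1 - 1)%nat with m by lia. ring. }
apply is_int0_unique in H4. rewrite H0 in H4. rewrite pow_i in H4 by lia. lra.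
Qed.

(** Each step multiplies the moment by (3k+4)(3k+3). The missing factor 3k+2 of the factorial is 3
    (k + 2/3), supplied by the power of 3 and the Gamma recursion. *)
Lemma airy_moment_closed_form A D c k : decaying_airy A D -> airy_connected A c ->
  airy_moment A (3 * k + 2) * (3 ^ k * Mellin 1 (INR k + 2 / 3)) =
  A 0 * Mellin 1 (2 / 3) * INR (fact (3 * k + 1)).
Proof.
intros H Hc. induction k as [|k IH].
- simpl. rewrite (airy_moment_2 A D c H Hc), Rplus_0_l. ring.
- replace (3 * S k + 2)%nat with (3 * k + 2 + 3)%nat by lia.
  replace (3 * S k + 1)%nat with (S (S (S (3 * k + 1)))) by lia.
  rewrite (airy_moment_rec A D c _ H Hc), !fact_simpl, !mult_INR, !S_INR, !plus_INR, !mult_INR.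
  change (INR 3) with (1 + 1 + 1). change (INR 2) with (1 + 1). change (INR 1) with 1.
  replace (INR k + 1 + 2 / 3) with (INR k + 2 / 3 + 1) by ring.
  assert (Hk := pos_INR k). rewrite Mellin_add by lra. simpl (3 ^ S k).
  transitivity ((airy_moment A (3 * k + 2) * (3 ^ k * Mellin 1 (INR k + 2 / 3))) *
    ((3 * INR k + 4) * (3 * INR k + 3) * (3 * INR k + 2))); [field|].
  rewrite IH. ring.
Qed.

Lemma ln_add_bounds x a : 0 < x -> 0 <= a -> 0 <= ln (x + a) - ln x <= a / x.
Proof.
intros Hx Ha. rewrite <- ln_div by lra. replace ((x + a) / x) with (1 + a / x) by (field; lra).
assert (0 <= a / x) by (apply Rmult_le_pos; [lra|left; pos]). split.
- rewrite <- ln_1. apply ln_le; lra.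
- now apply ln_1p_le_id.
Qed.

Lemma ln_1m_ge y : 0 <= y <= 1 / 2 -> - (2 * y) <= ln (1 - y).
Proof.
intros Hy. assert (H := ln_1p_le_id (y / (1 - y)) ltac:(apply Rmult_le_pos; [lra|left; pos])).
replace (1 + y / (1 - y)) with (/ (1 - y)) in H by (field; lra). rewrite ln_Rinv in H by lra.
assert (y / (1 - y) <= 2 * y).
{ apply Rmult_le_reg_r with (1 - y); [lra|]. replace (y / (1 - y) * (1 - y)) with y by (field; lra). nra. }
lra.
Qed.

Lemma ln_fact_bounds n : (1 <= n)%nat ->
  0 <= ln (INR (fact n)) - ((INR n + / 2) * ln (INR n) - INR n + ln (2 * PI) / 2) <= / 4 * / INR n.
Proof. intros Hn. assert (H := stirling n Hn). unfold stirling_seq in H. lra. Qed.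

Lemma INR_fact_pos n : 0 < INR (fact n).
Proof. apply lt_0_INR, lt_O_fact. Qed.

(** Two uses of log-convexity: from k + 2/3 up to k + 1, and from k up to k + 2/3. Factorials give
    the values at k and at k + 1. *)
Lemma ln_Mellin1_bounds k : (1 <= k)%nat ->
  ln (INR (fact k)) - / 3 * ln (INR k + 2 / 3) <= ln (Mellin 1 (INR k + 2 / 3))
  <= ln (INR (fact k)) - / 3 * ln (INR k).
Proof.
intros Hk. assert (Hx : 0 < INR k) by (apply lt_0_INR; lia).
assert (HX := Mellin_pos 1 (INR k + 2 / 3) ltac:(lra) ltac:(lra)).
assert (E1 : Mellin 1 (INR k + 1) = INR (fact k)).
{ replace (INR k + 1) with (1 * INR (S k)) by (rewrite S_INR; ring). rewrite Mellin_nat, pow1 by lra. ring. }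
assert (E2 : INR k * Mellin 1 (INR k) = INR (fact k)) by (rewrite <- E1, Mellin_add; lra).
assert (H0 := Mellin_pos 1 (INR k) ltac:(lra) Hx). assert (Hf := INR_fact_pos k).
split.
- assert (L := Mellin_log_convex 1 (INR k + 2 / 3) (/ 3) ltac:(lra) ltac:(lra) ltac:(lra)).
  replace (INR k + 2 / 3 + 1 * / 3) with (INR k + 1) in L by field. rewrite E1 in L.
  apply ln_le in L; trivial. rewrite ln_mult in L; trivial; [|apply Rpower_pos].
  unfold Rpower in L. rewrite ln_exp in L. lra.
- assert (L := Mellin_log_convex 1 (INR k) (2 / 3) ltac:(lra) ltac:(lra) ltac:(lra)).
  rewrite Rmult_1_l in L.
  apply ln_le in L; trivial. rewrite ln_mult in L; trivial; [|apply Rpower_pos].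
  unfold Rpower in L. rewrite ln_exp in L. rewrite <- E2, ln_mult by trivial. lra.
Qed.

(** The argument 3k + 11/4 is m + 3/4 for m = 3k + 2. It lies between the multiples 3k + 3/2 and 3k
    + 3 of 3/2, where [Mellin_nat] applies. *)
Lemma ln_Mellin32_bounds k : (1 <= k)%nat ->
  (2 * INR k + 1) * ln (3 / 2) + ln (2 * INR k + 1) + ln (INR (fact (2 * k))) - / 6 * ln (3 * INR k + 11 / 4)
   <= ln (Mellin (3 / 2) (3 * INR k + 11 / 4))
  <= 5 / 6 * ln (3 * INR k + 3 / 2) + 2 * INR k * ln (3 / 2) + ln (INR (fact (2 * k))).
Proof.
intros Hk. assert (Hx : 0 < INR k) by (apply lt_0_INR; lia).
assert (HX := Mellin_pos (3 / 2) (3 * INR k + 11 / 4) ltac:(lra) ltac:(lra)).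
assert (Hf := INR_fact_pos (2 * k)).
assert (E1 : Mellin (3 / 2) (3 * INR k + 3) = (3 / 2) ^ S (2 * k) * ((2 * INR k + 1) * INR (fact (2 * k)))).
{ replace (3 * INR k + 3) with (3 / 2 * INR (S (S (2 * k)))).
  - rewrite Mellin_nat, fact_simpl, mult_INR, S_INR, mult_INR by lra. change (INR 2) with 2. ring.
  - rewrite !S_INR, mult_INR. change (INR 2) with 2. field. }
assert (E2 : Mellin (3 / 2) (3 * INR k + 3 / 2) = (3 / 2) ^ (2 * k) * INR (fact (2 * k))).
{ replace (3 * INR k + 3 / 2) with (3 / 2 * INR (S (2 * k))).
  - apply Mellin_nat; lra.
  - rewrite !S_INR, mult_INR. change (INR 2) with 2. field. }
split.
- assert (L := Mellin_log_convex (3 / 2) (3 * INR k + 11 / 4) (/ 6) ltac:(lra) ltac:(lra) ltac:(lra)).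
  replace (3 * INR k + 11 / 4 + 3 / 2 * / 6) with (3 * INR k + 3) in L by field. rewrite E1 in L.
  apply ln_le in L; [|pos]. rewrite !ln_mult in L; pos.
  rewrite ln_pow, S_INR, mult_INR in L by lra. change (INR 2) with 2 in L.
  unfold Rpower in L. rewrite ln_exp in L. lra.
- assert (L := Mellin_log_convex (3 / 2) (3 * INR k + 3 / 2) (5 / 6) ltac:(lra) ltac:(lra) ltac:(lra)).
  replace (3 * INR k + 3 / 2 + 3 / 2 * (5 / 6)) with (3 * INR k + 11 / 4) in L by field. rewrite E2 in L.
  apply ln_le in L; [|pos]. rewrite !ln_mult in L; pos.
  rewrite ln_pow, mult_INR in L by lra. change (INR 2) with 2 in L.
  unfold Rpower in L. rewrite ln_exp in L. lra.
Qed.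

Lemma airy_connection_value A D c : decaying_airy A D -> airy_connected A c ->
  A 0 = 1 / (Rpower 3 (2 / 3) * Gamma (2 / 3)) -> c = / (2 * sqrt PI).
Proof.
intros H Hc HA0. assert (Hpi := PI_RGT_0). assert (Hc0 := proj1 Hc).
assert (HG := Mellin_pos 1 (2 / 3) ltac:(lra) ltac:(lra)).
rewrite Gamma_Mellin in HA0 by lra. assert (H3 := Rpower_pos 3 (2 / 3)).
assert (HM : A 0 * Mellin 1 (2 / 3) = / Rpower 3 (2 / 3)) by (rewrite HA0; field; lra).
(* In logarithms, the closed form of the moment 3k+2 is compared with its asymptotic bounds. After
   Stirling for k!, (2k)! and (3k)! all terms growing with k cancel, which leaves ln(2 c sqrt PI) up
   to O(1/k). *)
assert (Hk : forall k, (1 <= k)%nat -> Rabs (ln c + ln 2 + ln PI / 2) <= 10 / INR k).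
{ intros k Hk. assert (Hx : 1 <= INR k) by (apply (le_INR 1 k); trivial).
  assert (Hm := airy_moment_closed_form A D c k H Hc). rewrite HM in Hm.
  destruct (airy_moment_bounds A D c (3 * k + 2) H Hc ltac:(lia)) as [B1 B2].
  assert (EI : INR (3 * k + 2) = 3 * INR k + 2).
  { rewrite plus_INR, mult_INR. change (INR 3) with (1 + 1 + 1). change (INR 2) with 2. ring. }
  rewrite EI in B1, B2. replace (3 * INR k + 2 + 3 / 4) with (3 * INR k + 11 / 4) in B1, B2 by field.
  replace (3 * INR k + 2 - 3 / 4) with (3 * INR k + 5 / 4) in B1 by field.
  assert (HX := Mellin_pos 1 (INR k + 2 / 3) ltac:(lra) ltac:(lra)).
  assert (HY := Mellin_pos (3 / 2) (3 * INR k + 11 / 4) ltac:(lra) ltac:(lra)).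
  assert (Hf1 := INR_fact_pos (3 * k + 1)). assert (Hf3 := INR_fact_pos (3 * k)).
  set (x := INR k) in *.
  set (y := 5 / 48 / (3 * x + 5 / 4)) in *.
  assert (Hix : 0 < / x <= 1) by (split; [pos|rewrite <- Rinv_1; apply Rinv_le_contravar; lra]).
  assert (Hy : 0 <= y <= / 2 * / x).
  { unfold y. split; [left; pos|]. apply Rle_trans with (5 / 48 * / x).
    - apply Rmult_le_compat_l; [lra|]. apply Rinv_le_contravar; lra.
    - lra. }
  assert (Ly := ln_1m_ge y ltac:(lra)).
  assert (HMp : 0 < airy_moment A (3 * k + 2)).
  { apply Rlt_le_trans with (2 := B1). pos. }
  assert (L1 : ln (airy_moment A (3 * k + 2)) = - (2 / 3 * ln 3) + ln (INR (fact (3 * k + 1))) - x * ln 3 - ln (Mellin 1 (x + 2 / 3))).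
  { apply (f_equal ln) in Hm. rewrite !ln_mult, ln_Rinv, ln_pow in Hm; pos.
    unfold Rpower in Hm. rewrite ln_exp in Hm. fold x in Hm. lra. }
  assert (B1' : ln c + ln (Mellin (3 / 2) (3 * x + 11 / 4)) + ln (1 - y) <= ln (airy_moment A (3 * k + 2))).
  { rewrite <- !ln_mult; pos. apply ln_le; pos. }
  assert (B2' : ln (airy_moment A (3 * k + 2)) <= ln c + ln (Mellin (3 / 2) (3 * x + 11 / 4))).
  { rewrite <- !ln_mult; pos. apply ln_le; pos. }
  assert (F1 := ln_Mellin1_bounds k Hk). assert (F2 := ln_Mellin32_bounds k Hk). fold x in F1, F2.
  assert (S1 := ln_fact_bounds k Hk). assert (S2 := ln_fact_bounds (2 * k) ltac:(lia)).
  assert (S3 := ln_fact_bounds (3 * k) ltac:(lia)). rewrite mult_INR in S2, S3. fold x in S1, S2, S3.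
  change (INR 2) with 2 in S2. replace (INR 3) with 3 in S3 by (simpl; ring).
  assert (E1 : ln (INR (fact (3 * k + 1))) = ln (3 * x + 1) + ln (INR (fact (3 * k)))).
  { replace (3 * k + 1)%nat with (S (3 * k)) by lia. rewrite fact_simpl, mult_INR, S_INR, mult_INR.
    replace (INR 3) with 3 by (simpl; ring). apply ln_mult; trivial. lra. }
  assert (P2 : ln (2 * x) = ln 2 + ln x) by (apply ln_mult; lra).
  assert (P3 : ln (3 * x) = ln 3 + ln x) by (apply ln_mult; lra).
  assert (P4 : ln (3 / 2) = ln 3 - ln 2) by (apply ln_div; lra).
  assert (P5 : ln (2 * PI) = ln 2 + ln PI) by (apply ln_mult; lra).
  assert (A1 := ln_add_bounds x (2 / 3) ltac:(lra) ltac:(lra)).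
  assert (A2 := ln_add_bounds (2 * x) 1 ltac:(lra) ltac:(lra)).
  assert (A3 := ln_add_bounds (3 * x) (11 / 4) ltac:(lra) ltac:(lra)).
  assert (A4 := ln_add_bounds (3 * x) (3 / 2) ltac:(lra) ltac:(lra)).
  assert (A5 := ln_add_bounds (3 * x) 1 ltac:(lra) ltac:(lra)).
  rewrite P2 in *. rewrite P3 in *. rewrite P4 in *. rewrite P5 in *.
  replace (1 / (2 * x)) with (/ 2 * / x) in A2 by (field; lra).
  replace (11 / 4 / (3 * x)) with (11 / 12 * / x) in A3 by (field; lra).
  replace (3 / 2 / (3 * x)) with (/ 2 * / x) in A4 by (field; lra).
  replace (1 / (3 * x)) with (/ 3 * / x) in A5 by (field; lra).
  replace (/ (2 * x)) with (/ 2 * / x) in S2 by (field; lra).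
  replace (/ (3 * x)) with (/ 3 * / x) in S3 by (field; lra).
  unfold Rdiv in *. apply Rabs_le.
  set (l2 := ln 2) in *. set (l3 := ln 3) in *. set (L := ln x) in *. set (lp := ln PI) in *.
  clearbody x l2 l3 L lp. split; lra. }
assert (E : Rabs (ln c + ln 2 + ln PI / 2) <= 0).
{ apply (Rle_0_of_le_inv_INR _ 10); [lra|exact Hk]. }
assert (E' : ln c = - (ln 2 + ln PI / 2)).
{ assert (H4 := Rabs_pos (ln c + ln 2 + ln PI / 2)).
  assert (H1 := Rle_abs (ln c + ln 2 + ln PI / 2)). assert (H2 := Rle_abs (- (ln c + ln 2 + ln PI / 2))).
  rewrite Rabs_Ropp in H2. lra. }
apply ln_inv; pos.
rewrite E', ln_Rinv, ln_mult; pos. rewrite <- Rpower_sqrt by trivial. unfold Rpower. rewrite ln_exp. field.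
Qed.

(** * Hermite functions *)

(** The three-term recurrence. The nested match makes both predecessors available to structural
    recursion. *)
Fixpoint hermite_poly (n : nat) (x : R) : R :=
  match n with
  | O => 1
  | S m => match m with
           | O => 2 * x
           | S p => 2 * x * hermite_poly m x - 2 * INR m * hermite_poly p x
           end
  end.

Lemma hermite_poly_SS n x :
  hermite_poly (S (S n)) x = 2 * x * hermite_poly (S n) x - 2 * INR (S n) * hermite_poly n x.
Proof. reflexivity. Qed.

(** At n = 0 the truncated index n - 1 is multiplied by [INR 0], so one formula covers all n. *)
Lemma hermite_poly_S n x :
  hermite_poly (S n) x = 2 * x * hermite_poly n x - 2 * INR n * hermite_poly (n - 1) x.
Proof.
destruct n as [|n]; [simpl; ring|]. rewrite hermite_poly_SS. now replace (S n - 1)%nat with n by lia.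
Qed.

Lemma is_derive_hermite_poly n x : is_derive (hermite_poly n) x (2 * INR n * hermite_poly (n - 1) x).
Proof.
assert (H : is_derive (hermite_poly n) x (2 * INR n * hermite_poly (n - 1) x) /\
  is_derive (hermite_poly (S n)) x (2 * INR (S n) * hermite_poly n x)); [|apply H].
induction n as [|n [IH1 IH2]].
- split.
  + simpl. replace (2 * 0 * 1) with 0 by ring. apply (@is_derive_const R_AbsRing R_NormedModule).
  + simpl. auto_derive; trivial. ring.
- replace (S n - 1)%nat with n by lia. split; trivial.
  apply (is_derive_ext (fun x => 2 * x * hermite_poly (S n) x - 2 * INR (S n) * hermite_poly n x)); [intros; now rewrite hermite_poly_SS|].
  evar_last.
  + apply (is_derive_minus (fun x => 2 * x * hermite_poly (S n) x) (fun x => 2 * INR (S n) * hermite_poly n x)).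
    * apply (is_derive_mult (fun x => 2 * x) (hermite_poly (S n)) x 2 (2 * INR (S n) * hermite_poly n x)); [auto_derive; trivial; ring|exact IH2|intros u v; exact (Rmult_comm u v)].
    * apply (is_derive_scal (hermite_poly n) x (2 * INR (S n))). exact IH1.
  + unfold minus, plus, mult, opp; simpl plus. rewrite (hermite_poly_S n), !S_INR. simpl. ring.
Qed.

Lemma Derive_n_gauss n x :
  Derive_n (fun y => exp (- y ^ 2)) n x = (-1) ^ n * hermite_poly n x * exp (- x ^ 2).
Proof.
revert x. induction n as [|n IH]; intros x.
- simpl. ring.
- simpl Derive_n. rewrite (Derive_ext _ _ _ IH). apply is_derive_unique.
  evar_last.
  + apply (is_derive_mult (fun y => (-1) ^ n * hermite_poly n y) (fun y => exp (- y ^ 2)) x).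
    * apply (is_derive_scal (hermite_poly n) x ((-1) ^ n)). apply is_derive_hermite_poly.
    * auto_derive; [trivial|reflexivity].
    * intros u v; exact (Rmult_comm u v).
  + unfold plus, mult; simpl plus. rewrite hermite_poly_S. simpl. ring.
Qed.

Lemma hermite_eq n x : hermite n x = hermite_poly n x.
Proof.
unfold hermite. rewrite Derive_n_gauss, exp_Ropp.
assert (E : (-1) ^ n * (-1) ^ n = 1) by (rewrite <- Rpow_mult_distr; replace (-1 * -1) with 1 by ring; apply pow1).
assert (H := exp_pos (x ^ 2)).
transitivity (((-1) ^ n * (-1) ^ n) * hermite_poly n x); [field; lra|]. rewrite E. ring.
Qed.

Definition hermite_fun (n : nat) (x : R) : R := hermite_poly n x * exp (- x ^ 2 / 2).

Definition hermite_fun' (n : nat) (x : R) : R :=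
  (2 * INR n * hermite_poly (n - 1) x - x * hermite_poly n x) * exp (- x ^ 2 / 2).

Lemma is_derive_gauss_half x : is_derive (fun x => exp (- x ^ 2 / 2)) x (- x * exp (- x ^ 2 / 2)).
Proof. auto_derive; trivial. unfold Rdiv; simpl. field. Qed.

Lemma is_derive_hermite_fun n x : is_derive (hermite_fun n) x (hermite_fun' n x).
Proof.
unfold hermite_fun, hermite_fun'. evar_last.
- apply (is_derive_mult (hermite_poly n) (fun x => exp (- x ^ 2 / 2)) x).
  + apply is_derive_hermite_poly.
  + apply is_derive_gauss_half.
  + intros u v; exact (Rmult_comm u v).
- unfold plus, mult; simpl plus. simpl. ring.
Qed.

Lemma is_derive_hermite_fun' n x :
  is_derive (hermite_fun' n) x ((x ^ 2 - (2 * INR n + 1)) * hermite_fun n x).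
Proof.
unfold hermite_fun, hermite_fun'. evar_last.
- apply (is_derive_mult (fun x => 2 * INR n * hermite_poly (n - 1) x - x * hermite_poly n x) (fun x => exp (- x ^ 2 / 2)) x).
  + apply (is_derive_minus (fun x => 2 * INR n * hermite_poly (n - 1) x) (fun x => x * hermite_poly n x)).
    * apply (is_derive_scal (hermite_poly (n - 1)) x (2 * INR n)). apply is_derive_hermite_poly.
    * apply (is_derive_mult (fun x => x) (hermite_poly n) x 1 (2 * INR n * hermite_poly (n - 1) x)); [auto_derive; trivial|apply is_derive_hermite_poly|intros u v; exact (Rmult_comm u v)].
  + apply is_derive_gauss_half.
  + intros u v; exact (Rmult_comm u v).
- unfold minus, plus, mult, opp; simpl plus. set (E := exp _).
  destruct n as [|n]; [simpl; ring|]. replace (S n - 1)%nat with n by lia.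
  rewrite (hermite_poly_S n), S_INR. simpl. ring.
Qed.

Lemma hermite_poly_lim n : is_lim (fun x => hermite_poly n x / x ^ n) p_infty (2 ^ n).
Proof.
assert (Hext : forall (f g : R -> R) l, (forall x, 0 < x -> f x = g x) -> is_lim f p_infty l -> is_lim g p_infty l).
{ intros f g l Hfg. apply is_lim_ext_loc. exists 0. exact Hfg. }
assert (Hinv : is_lim (fun x => / x) p_infty 0).
{ apply (is_lim_inv (fun t => t) p_infty p_infty); [apply is_lim_id|discriminate]. }
assert (H : is_lim (fun x => hermite_poly n x / x ^ n) p_infty (2 ^ n) /\
  is_lim (fun x => hermite_poly (S n) x / x ^ S n) p_infty (2 ^ S n)); [|apply H].
induction n as [|n [IH1 IH2]].
- split.
  + apply (Hext (fun _ => 1)); [intros; simpl; field|]. apply is_lim_const.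
  + apply (Hext (fun _ => 2)); [intros; simpl; field; lra|]. simpl. rewrite Rmult_1_r. apply is_lim_const.
- split; trivial.
  apply (Hext (fun x => 2 * (hermite_poly (S n) x / x ^ S n) - 2 * INR (S n) * ((hermite_poly n x / x ^ n) * (/ x * / x)))).
  { intros x Hx. rewrite hermite_poly_SS. assert (0 < x ^ n) by (apply pow_lt; lra).
    simpl pow. field. lra. }
  replace (2 ^ S (S n)) with (2 * 2 ^ S n - 2 * INR (S n) * (2 ^ n * (0 * 0))) by (simpl; ring).
  apply is_lim_minus'.
  + apply (is_lim_scal_l _ 2 _ _ IH2).
  + apply (is_lim_scal_l _ (2 * INR (S n)) p_infty (2 ^ n * (0 * 0))).
    apply (is_lim_mult _ _ p_infty (2 ^ n) (0 * 0)); [exact IH1| |exact I].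
    apply (is_lim_mult _ _ p_infty 0 0); [exact Hinv|exact Hinv|exact I].
Qed.

(** * The Langer variable *)

(* Liouville-Green phase of y'' = (s^2-1) y at s = cosh th, i.e. the integral
   of sqrt(s^2-1) from 1. *)
Definition phase (th : R) : R := (sinh th * cosh th - th) / 2.

Lemma cosh_sq th : cosh th ^ 2 = 1 + sinh th ^ 2.
Proof.
unfold cosh, sinh. assert (H : exp th * exp (- th) = 1) by (rewrite <- exp_plus, Rplus_opp_r; apply exp_0).
set (a := exp th) in *. set (b := exp (- th)) in *.
replace (((a + b) / 2) ^ 2) with (((a - b) / 2) ^ 2 + a * b) by field. rewrite H. ring.
Qed.

Lemma sinh_pos th : 0 < th -> 0 < sinh th.
Proof. intros H. unfold sinh. assert (exp (- th) < exp th) by (apply exp_increasing; lra). lra. Qed.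

Lemma cosh_ge_1 th : 1 <= cosh th.
Proof.
assert (H : 0 < cosh th) by (unfold cosh; generalize (exp_pos th) (exp_pos (- th)); lra).
assert (H1 := cosh_sq th). assert (H2 := pow2_ge_0 (sinh th)). nra.
Qed.

Lemma is_derive_phase th : is_derive phase th (sinh th ^ 2).
Proof.
unfold phase. auto_derive; trivial. assert (H := cosh_sq th).
transitivity ((cosh th ^ 2 + sinh th ^ 2 - 1) / 2); [field|]. rewrite H. field.
Qed.

Lemma phase_0 : phase 0 = 0.
Proof. unfold phase, sinh. rewrite Ropp_0. field. Qed.

Lemma phase_ge_of_derive (f df : R -> R) th : 0 <= th ->
  (forall z, is_derive f z (df z)) -> (forall z, 0 <= z -> df z <= sinh z ^ 2) -> f 0 = 0 -> f th <= phase th.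
Proof.
intros Hth Hd Hle H0.
assert (phase 0 - f 0 <= phase th - f th).
{ apply (incr_seg (fun z => phase z - f z) (fun z => sinh z ^ 2 - df z)); trivial.
  - intros z _. apply (is_derive_minus phase f); [apply is_derive_phase|apply Hd].
  - intros z Hz. specialize (Hle z ltac:(lra)). lra. }
rewrite phase_0, H0 in H. lra.
Qed.

Lemma phase_le_of_derive (f df : R -> R) th : 0 <= th ->
  (forall z, is_derive f z (df z)) -> (forall z, 0 <= z -> sinh z ^ 2 <= df z) -> f 0 = 0 -> phase th <= f th.
Proof.
intros Hth Hd Hle H0.
assert (f 0 - phase 0 <= f th - phase th).
{ apply (incr_seg (fun z => f z - phase z) (fun z => df z - sinh z ^ 2)); trivial.
  - intros z _. apply (is_derive_minus f phase); [apply Hd|apply is_derive_phase].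
  - intros z Hz. specialize (Hle z ltac:(lra)). lra. }
rewrite phase_0, H0 in H. lra.
Qed.

(** This lower bound is sharp to leading order at 0 and loses only a constant factor at infinity, so
    it serves in both regimes. *)
Lemma phase_ge_cube th : 0 <= th -> sinh th ^ 3 / (3 * cosh th) <= phase th.
Proof.
intros Hth. apply (phase_ge_of_derive (fun z => sinh z ^ 3 / (3 * cosh z))
  (fun z => sinh z ^ 2 - sinh z ^ 4 / (3 * cosh z ^ 2))); trivial.
- intros z. assert (H := cosh_ge_1 z). auto_derive; [lra|]. simpl. field. lra.
- intros z Hz. assert (H := cosh_ge_1 z).
  assert (0 <= sinh z ^ 4 / (3 * cosh z ^ 2)); [|lra].
  apply Rmult_le_pos; [|left; pos].
  replace (sinh z ^ 4) with ((sinh z ^ 2) ^ 2) by ring. apply pow2_ge_0.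
- rewrite sinh_0. unfold Rdiv. simpl. ring.
Qed.

Lemma phase_pos th : 0 < th -> 0 < phase th.
Proof.
intros H. apply Rlt_le_trans with (2 := phase_ge_cube th (Rlt_le _ _ H)).
assert (H1 := cosh_ge_1 th). assert (H2 := sinh_pos th H). pos.
Qed.

Lemma phase_le_cube th : 0 <= th -> phase th <= sinh th ^ 3 / 3.
Proof.
intros Hth. apply (phase_le_of_derive (fun z => sinh z ^ 3 / 3) (fun z => sinh z ^ 2 * cosh z)); trivial.
- intros z. auto_derive; trivial. simpl. field.
- intros z Hz. assert (H := cosh_ge_1 z). assert (H2 := pow2_ge_0 (sinh z)). nra.
- rewrite sinh_0. simpl. field.
Qed.

(** In terms of v = sinh th the phase is the integral of v^2 / sqrt(1 + v^2). This bound and the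
    next integrate the expansion 1 - v^2/2 + 3/8 v^4 - ... of 1 / sqrt(1 + v^2), truncated on either
    side. *)
Lemma phase_ge_quintic th : 0 <= th -> sinh th ^ 3 / 3 - sinh th ^ 5 / 10 <= phase th.
Proof.
intros Hth. apply (phase_ge_of_derive (fun z => sinh z ^ 3 / 3 - sinh z ^ 5 / 10)
  (fun z => sinh z ^ 2 * ((1 - sinh z ^ 2 / 2) * cosh z))); trivial.
- intros z. auto_derive; trivial. simpl. field.
- intros z Hz. assert (H := cosh_ge_1 z). assert (H1 := cosh_sq z). assert (H2 := pow2_ge_0 (sinh z)).
  set (w := sinh z ^ 2) in *. set (c := cosh z) in *.
  cut ((1 - w / 2) * c <= 1); [nra|].
  destruct (Rle_lt_dec (1 - w / 2) 0); [nra|].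
  (* Squaring replaces cosh^2 by 1 + w, which leaves a polynomial inequality for w < 2. *)
  assert (((1 - w / 2) * c) ^ 2 <= 1).
  { rewrite Rpow_mult_distr, H1. nra. }
  nra.
- rewrite sinh_0. simpl. field.
Qed.

Lemma phase_le_septic th : 0 <= th ->
  phase th <= sinh th ^ 3 / 3 - sinh th ^ 5 / 10 + 3 / 56 * sinh th ^ 7.
Proof.
intros Hth. apply (phase_le_of_derive (fun z => sinh z ^ 3 / 3 - sinh z ^ 5 / 10 + 3 / 56 * sinh z ^ 7)
  (fun z => sinh z ^ 2 * ((1 - sinh z ^ 2 / 2 + 3 / 8 * (sinh z ^ 2) ^ 2) * cosh z))); trivial.
- intros z. auto_derive; trivial. simpl. field.
- intros z Hz. assert (H := cosh_ge_1 z). assert (H1 := cosh_sq z). assert (H2 := pow2_ge_0 (sinh z)).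
  set (w := sinh z ^ 2) in *. set (c := cosh z) in *.
  cut (1 <= (1 - w / 2 + 3 / 8 * w ^ 2) * c); [nra|].
  assert (0 < 1 - w / 2 + 3 / 8 * w ^ 2) by nra.
  assert (1 <= ((1 - w / 2 + 3 / 8 * w ^ 2) * c) ^ 2).
  { rewrite Rpow_mult_distr, H1.
    replace ((1 - w / 2 + 3 / 8 * w ^ 2) ^ 2 * (1 + w)) with (1 + w ^ 3 * (5 / 8 - 15 / 64 * w + 9 / 64 * w ^ 2)) by field.
    assert (0 <= w ^ 3) by now apply pow_le. assert (0 <= 5 / 8 - 15 / 64 * w + 9 / 64 * w ^ 2) by nra. nra. }
  assert (0 < (1 - w / 2 + 3 / 8 * w ^ 2) * c) by nra.
  nra.
- rewrite sinh_0. simpl. field.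
Qed.

Lemma phase_defect th : 0 < th -> exists d,
  3 * phase th = sinh th ^ 3 * (1 - d) /\
  3 / 10 * sinh th ^ 2 - 9 / 56 * (sinh th ^ 2) ^ 2 <= d <= 3 / 10 * sinh th ^ 2.
Proof.
intros Hth. assert (Hv := sinh_pos th Hth).
assert (H1 := phase_ge_quintic th ltac:(lra)). assert (H2 := phase_le_septic th ltac:(lra)).
set (v := sinh th) in *. assert (Hv3 : 0 < v ^ 3) by pos.
exists (1 - 3 * phase th / v ^ 3). split; [field; lra|].
set (q := 3 * phase th / v ^ 3).
assert (E : 3 * phase th = q * v ^ 3) by (unfold q; field; lra).
assert (1 - 3 / 10 * v ^ 2 <= q).
{ apply Rmult_le_reg_r with (v ^ 3); trivial. rewrite <- E. nra. }
assert (q <= 1 - 3 / 10 * v ^ 2 + 9 / 56 * (v ^ 2) ^ 2).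
{ apply Rmult_le_reg_r with (v ^ 3); trivial. rewrite <- E. nra. }
lra.
Qed.

(* The relative perturbation E of the Airy equation under the Langer
   transformation; its poles at th = 0 cancel. *)
Definition langer_error (th : R) : R :=
  3 / (4 * sinh th ^ 2) + 5 / (4 * sinh th ^ 4) - 5 / 36 * (sinh th ^ 2 / phase th ^ 2).

(** For sinh th <= 1 the poles cancel to second order. For sinh th > 1 the positive part and the
    phase term are separately at most 5 / cosh^2. *)
Lemma langer_error_bound th : 0 < th -> Rabs (langer_error th) <= 10 * exp (- th).
Proof.
intros Hth. assert (Hv := sinh_pos th Hth). assert (Hc := cosh_ge_1 th). assert (Hcs := cosh_sq th).
assert (Hp := phase_pos th Hth).
assert (Hexp : / cosh th ^ 2 <= 2 * exp (- th)).
{ apply Rle_trans with (/ cosh th); [apply Rinv_le_contravar; nra|].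
  rewrite exp_Ropp. replace (2 * / exp th) with (/ (exp th / 2)) by (field; generalize (exp_pos th); lra).
  apply Rinv_le_contravar; [pos|]. unfold cosh. generalize (exp_pos (- th)); lra. }
apply Rle_trans with (5 * / cosh th ^ 2); [|lra]. rewrite Hcs.
destruct (phase_defect th Hth) as [d [Hd1 Hd2]].
assert (Hcube := phase_ge_cube th ltac:(lra)).
unfold langer_error. set (v := sinh th) in *.
assert (Hw : 0 < v ^ 2) by pos. 
replace (v ^ 4) with ((v ^ 2) ^ 2) by ring.
destruct (Rle_lt_dec (v ^ 2) 1) as [Hsmall|Hbig].
- replace (phase th) with (v ^ 3 * (1 - d) / 3) by lra.
  set (w := v ^ 2) in *. assert (Hdp : 0 <= d <= 3 / 10) by nra.
  replace (w / (v ^ 3 * (1 - d) / 3) ^ 2) with (9 / (w ^ 2 * (1 - d) ^ 2)) by (unfold w; field; repeat split; lra).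
  (* Numerator over the common denominator. Its first-order part 3/4 w - 5/2 d cancels because d =
     3/10 w + O(w^2), so N is O(w^2) like the denominator. *)
  set (N := 3 / 4 * w - 5 / 2 * d + 5 / 4 * d ^ 2 - 3 / 2 * w * d + 3 / 4 * w * d ^ 2).
  replace (3 / (4 * w) + 5 / (4 * w ^ 2) - 5 / 36 * (9 / (w ^ 2 * (1 - d) ^ 2)))
    with (N / (w ^ 2 * (1 - d) ^ 2)) by (unfold N; field; lra).
  assert (HN : Rabs N <= 6 / 10 * w ^ 2).
  { assert (d * d <= 3 / 10 * w * d) by nra. assert (w * d <= 3 / 10 * w ^ 2) by nra.
    assert (w * d ^ 2 <= d ^ 2) by nra.
    apply Rabs_le. unfold N. split; nra. }
  assert (HD : 49 / 100 * w ^ 2 <= w ^ 2 * (1 - d) ^ 2).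
  { rewrite Rmult_comm. apply Rmult_le_compat_l; [apply pow2_ge_0|nra]. }
  assert (Hw2 : 0 < w ^ 2) by pos.
  unfold Rdiv at 1. rewrite Rabs_mult, Rabs_inv, (Rabs_pos_eq (w ^ 2 * (1 - d) ^ 2)) by lra.
  assert (H5 : 5 / 2 <= 5 * / (1 + w)).
  { unfold Rdiv. apply Rmult_le_compat_l; [lra|]. apply Rinv_le_contravar; lra. }
  apply Rle_trans with (2 := H5).
  apply Rmult_le_reg_r with (w ^ 2 * (1 - d) ^ 2); [lra|].
  rewrite Rmult_assoc, Rinv_l, Rmult_1_r by lra. nra.
- set (w := v ^ 2) in *.
  assert (Hi : 0 < / w) by pos. assert (Hiw : / w <= 1) by (rewrite <- Rinv_1; apply Rinv_le_contravar; lra).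
  assert (Hi1 : / w <= 2 * / (1 + w)).
  { replace (2 * / (1 + w)) with (/ ((1 + w) / 2)) by (field; lra). apply Rinv_le_contravar; lra. }
  assert (E1 : 3 / (4 * w) + 5 / (4 * w ^ 2) = 3 / 4 * / w + 5 / 4 * (/ w * / w)) by (field; lra).
  assert (B1 : 0 <= 3 / (4 * w) + 5 / (4 * w ^ 2) <= 5 * / (1 + w)) by (rewrite E1; nra).
  assert (B2 : 0 <= 5 / 36 * (w / phase th ^ 2) <= 5 * / (1 + w)).
  { split; [left; pos|].
    assert (Hq : w ^ 3 <= 9 * (1 + w) * phase th ^ 2).
    { assert (v ^ 3 <= 3 * cosh th * phase th).
      { apply Rmult_le_reg_r with (/ (3 * cosh th)); [pos|].
        replace (3 * cosh th * phase th * / (3 * cosh th)) with (phase th) by (field; lra). exact Hcube. }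
      assert (0 < v ^ 3) by pos.
      replace (w ^ 3) with (v ^ 3 * v ^ 3) by (unfold w; ring). rewrite <- Hcs.
      replace (9 * cosh th ^ 2 * phase th ^ 2) with ((3 * cosh th * phase th) * (3 * cosh th * phase th)) by ring.
      apply Rmult_le_compat; lra. }
    apply Rmult_le_reg_r with (phase th ^ 2 * (1 + w)); [pos|].
    replace (5 / 36 * (w / phase th ^ 2) * (phase th ^ 2 * (1 + w))) with (5 / 36 * (w * (1 + w))) by (field; lra).
    replace (5 * / (1 + w) * (phase th ^ 2 * (1 + w))) with (5 * phase th ^ 2) by (field; lra).
    assert (w ^ 3 <= 18 * w * phase th ^ 2).
    { apply Rle_trans with (1 := Hq). apply Rmult_le_compat_r; [apply pow2_ge_0|lra]. }
    assert (w ^ 2 <= 18 * phase th ^ 2).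
    { apply Rmult_le_reg_l with w; [lra|]. replace (w * w ^ 2) with (w ^ 3) by ring. lra. }
    nra. }
  apply Rabs_le. lra.
Qed.

(** The part of the Langer variable free of u, normalized to behave like sinh^2 near 0. *)
Definition langer (th : R) : R := Rpower (3 * phase th) (2 / 3).

Lemma langer_cube th : 0 < th -> langer th ^ 3 = (3 * phase th) ^ 2.
Proof.
intros Hth. assert (Hp := phase_pos th Hth). unfold langer.
rewrite <- Rpower_pow, Rpower_mult by apply Rpower_pos.
replace (2 / 3 * INR 3) with (INR 2) by (simpl; field). apply Rpower_pow. lra.
Qed.

(** The quotient [langer] / sinh^2 equals (1 - d)^(2/3) with d close to 3/10 sinh^2, hence 1 -
    sinh^2 / 5 to first order, and [langer] is close to sinh^2. *)
Lemma langer_bound th : 0 < th ->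
  Rabs (langer th / sinh th ^ 2 - 1 + langer th / 5) <= 5 * langer th ^ 2.
Proof.
intros Hth. assert (Hv := sinh_pos th Hth). assert (Hc := cosh_ge_1 th). assert (Hcs := cosh_sq th).
assert (Hp := phase_pos th Hth). assert (Hz3 := langer_cube th Hth).
assert (Hz : 0 < langer th) by apply Rpower_pos. set (z := langer th) in *.
destruct (phase_defect th Hth) as [d [Hd1 Hd2]].
assert (Hcube := phase_ge_cube th ltac:(lra)). assert (Hcube2 := phase_le_cube th ltac:(lra)).
set (v := sinh th) in *. assert (Hw : 0 < v ^ 2) by pos.
destruct (Rle_lt_dec (v ^ 2) 1) as [Hsmall|Hbig].
- rewrite Hd1 in Hz3.
  assert (Hm3 : (z / v ^ 2) ^ 3 = (1 - d) ^ 2).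
  { replace ((z / v ^ 2) ^ 3) with (z ^ 3 / (v ^ 3) ^ 2) by (field; lra). rewrite Hz3. field. lra. }
  assert (Hzm : z = v ^ 2 * (z / v ^ 2)) by (field; lra).
  assert (Hm : 0 < z / v ^ 2) by pos.
  set (m := z / v ^ 2) in *. rewrite Hzm. set (w := v ^ 2) in *. clearbody m w. clear - Hm3 Hm Hw Hsmall Hd2.
  assert (Hdp : 0 <= d <= 3 / 10) by nra.
  assert (Hm1 : m <= 1) by (apply Rnot_lt_le; intros Hlt; nra).
  assert (Hm7 : 7 / 10 <= m) by (apply Rnot_lt_le; intros Hlt; assert (m ^ 2 <= 49 / 100) by nra; nra).
  (* Cube roots are avoided: m^3 = (1 - d)^2, and m - 1 is recovered by dividing m^3 - 1 by m^2 + m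
     + 1, which lies between 1 and 3. *)
  assert (F1 : (m - 1) * (m ^ 2 + m + 1) = - 2 * d + d ^ 2) by (ring_simplify; lra).
  assert (Hq : 1 <= m ^ 2 + m + 1 <= 3) by nra.
  assert (Hm2 : - (6 / 10) * w <= m - 1) by nra.
  assert (F2 : (m - 1 + w * m / 5) * (m ^ 2 + m + 1)
    = (- 2 * d + 3 / 5 * w) + d ^ 2 + w / 5 * ((m - 1) * (m ^ 2 + 2 * m + 3))).
  { transitivity ((m - 1) * (m ^ 2 + m + 1) + w / 5 * (m ^ 3 + m ^ 2 + m)); [field|].
    rewrite F1. field. }
  assert (T1 : 0 <= - 2 * d + 3 / 5 * w <= 9 / 28 * w ^ 2) by nra.
  assert (T2 : 0 <= d ^ 2 <= 9 / 100 * w ^ 2) by nra.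
  assert (T3 : - (36 / 10) * w <= (m - 1) * (m ^ 2 + 2 * m + 3) <= 0).
  { assert (0 <= m ^ 2 + 2 * m + 3 <= 6) by nra. split; nra. }
  assert (T4 : - (72 / 100) * w ^ 2 <= w / 5 * ((m - 1) * (m ^ 2 + 2 * m + 3)) <= 0).
  { set (X := (m - 1) * (m ^ 2 + 2 * m + 3)) in *. split; nra. }
  assert (Hlo : - (12 / 10) * w ^ 2 <= (m - 1 + w * m / 5) * (m ^ 2 + m + 1) <= 12 / 10 * w ^ 2) by (rewrite F2; nra).
  assert (49 / 100 <= m ^ 2) by nra.
  assert (49 / 100 * w ^ 2 <= (w * m) ^ 2) by (rewrite Rpow_mult_distr, Rmult_comm; apply Rmult_le_compat_l; [apply pow2_ge_0|trivial]).
  set (Y := m - 1 + w * m / 5) in *. assert (0 < w ^ 2) by pos.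
  apply Rabs_le. split.
  + apply Rle_trans with (- (12 / 10) * w ^ 2); [lra|]. apply Rnot_lt_le; intros Hlt.
    assert (Y * (m ^ 2 + m + 1) <= Y * 1) by (apply Rmult_le_compat_neg_l; lra). lra.
  + apply Rle_trans with (12 / 10 * w ^ 2); [|lra]. apply Rnot_lt_le; intros Hlt.
    assert (Y * 1 <= Y * (m ^ 2 + m + 1)) by (apply Rmult_le_compat_l; lra). lra.
- assert (Hz1 : z / v ^ 2 <= 1).
  { apply Rmult_le_reg_r with (v ^ 2); trivial. replace (z / v ^ 2 * v ^ 2) with z by (field; lra). rewrite Rmult_1_l.
    apply Rnot_lt_le; intros Hlt.
    assert ((v ^ 2) ^ 3 < z ^ 3).
    { assert (v ^ 2 * v ^ 2 < z * z) by nra. simpl. rewrite !Rmult_1_r in *. 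
      apply Rmult_gt_0_lt_compat; nra. }
    rewrite Hz3 in H. assert (3 * phase th <= v ^ 3) by lra.
    assert ((3 * phase th) ^ 2 <= (v ^ 3) ^ 2) by (apply pow_incr; lra).
    replace ((v ^ 2) ^ 3) with ((v ^ 3) ^ 2) in H by ring. lra. }
  assert (Hz2 : 1 / 2 <= z).
  { apply Rnot_lt_le; intros Hlt. assert (z ^ 3 < 1 / 8) by (assert (z * z < 1 / 4) by nra; simpl; nra).
    rewrite Hz3 in H.
    assert (v ^ 3 <= cosh th * (3 * phase th)).
    { apply Rmult_le_reg_r with (/ (3 * cosh th)); [pos|].
      replace (cosh th * (3 * phase th) * / (3 * cosh th)) with (phase th) by (field; lra). exact Hcube. }
    assert ((v ^ 3) ^ 2 <= (cosh th * (3 * phase th)) ^ 2) by (apply pow_incr; split; [left; pos|lra]).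
    rewrite Rpow_mult_distr, Hcs in H1. replace ((v ^ 3) ^ 2) with ((v ^ 2) ^ 3) in H1 by ring.
    set (w := v ^ 2) in *. assert (w <= w ^ 3) by (assert (1 < w * w) by nra; simpl; nra). nra. }
  assert (0 < z / v ^ 2) by pos. apply Rabs_le. split; nra.
Qed.

(** * Comparison with the Airy function *)

(** If V exceeded K p at a, then V - K p, which does not decrease, would stay at least m > 0. With p
    nonincreasing, h' = V / p would be at least m / p a and h unbounded. Boundedness of h thus
    replaces a boundary condition at infinity. *)
Lemma flux_bound (h V p dV dp : R -> R) (a K M : R) :
  (forall z, a <= z -> 0 < p z) ->
  (forall z, a <= z -> is_derive h z (V z / p z)) ->
  (forall z, a <= z -> is_derive V z (dV z)) ->
  (forall z, a <= z -> is_derive p z (dp z)) ->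
  (forall z, a <= z -> dp z <= 0) ->
  (forall z, a <= z -> K * dp z <= dV z) ->
  0 <= K -> (forall z, a <= z -> h z <= M) -> V a / p a <= K.
Proof.
intros Hp Hh HV Hdp Hneg HK HK0 HM. apply Rnot_lt_le. intros Hlt.
assert (Hpa := Hp a (Rle_refl a)).
set (m := V a - K * p a).
assert (Hm : 0 < m).
{ unfold m. replace (V a) with (V a / p a * p a) by (field; lra). nra. }
apply (unbounded_of_derive_ge h (fun z => V z / p z) a (m / p a) M); trivial; [pos|].
intros z Hz. assert (Hpz := Hp z Hz).
assert (H1 : p z <= p a) by (apply (decr_seg p dp); trivial; intros y Hy; [apply Hdp|apply Hneg]; lra).
assert (H2 : m <= V z - K * p z).
{ apply (incr_seg (fun z => V z - K * p z) (fun z => dV z - K * dp z)); trivial.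
  - intros y Hy. apply (is_derive_minus V (fun z => K * p z)); [apply HV; lra|].
    apply is_derive_scal, Hdp; lra.
  - intros y Hy. specialize (HK y ltac:(lra)). lra. }
apply Rmult_le_reg_r with (p z); trivial. replace (V z / p z * p z) with (V z) by (field; lra).
apply Rle_trans with (m / p a * p a).
- apply Rmult_le_compat_l; [left; pos|trivial].
- replace (m / p a * p a) with m by (field; lra). nra.
Qed.

Lemma is_derive_langer th : 0 < th ->
  is_derive langer th (langer th * (2 / 3 * sinh th ^ 2 / phase th)).
Proof.
intros Hth. assert (Hp := phase_pos th Hth). unfold langer. evar_last.
- apply (is_derive_comp (fun y => Rpower y (2 / 3)) (fun th => 3 * phase th)).
  + apply is_derive_Rpower; lra.
  + apply (is_derive_scal phase th 3). apply is_derive_phase.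
- unfold scal; simpl. unfold mult; simpl.
  replace (2 / 3 - 1) with (2 / 3 + - (1)) by ring. rewrite Rpower_plus, Rpower_Ropp, Rpower_1 by lra. field. lra.
Qed.

Definition langer_scale (u : R) : R := Rpower (u / 2) (2 / 3).

Definition zeta (u th : R) : R := langer_scale u * langer th.

Lemma zeta_pos u th : 0 < zeta u th.
Proof. unfold zeta, langer_scale, langer. pos. Qed.

Lemma zeta_cube u th : 0 < u -> 0 < th -> zeta u th ^ 3 = (3 / 2 * (u * phase th)) ^ 2.
Proof.
intros Hu Hth. unfold zeta. rewrite Rpow_mult_distr, langer_cube by trivial. unfold langer_scale.
rewrite <- Rpower_pow, Rpower_mult by apply Rpower_pos.
replace (2 / 3 * INR 3) with (INR 2) by (simpl; field). rewrite Rpower_pow by lra. field.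
Qed.

Lemma zeta_sqrt u th : 0 < u -> 0 < th -> zeta u th * sqrt (zeta u th) = 3 / 2 * (u * phase th).
Proof.
intros Hu Hth. assert (Hz := zeta_pos u th). assert (H := zeta_cube u th Hu Hth).
assert (Hp := phase_pos th Hth). assert (Hs := sqrt_lt_R0 _ Hz).
assert (E : sqrt (zeta u th) * sqrt (zeta u th) = zeta u th) by (apply sqrt_sqrt; lra).
set (z := zeta u th) in *. set (s := sqrt z) in *.
apply Rsqr_inj.
- left; pos.
- left; pos.
- unfold Rsqr. replace (z * s * (z * s)) with (z * z * (s * s)) by ring. rewrite E. simpl in H. lra.
Qed.

Definition zeta_rate (th : R) : R := 2 / 3 * sinh th ^ 2 / phase th.

Lemma is_derive_zeta u th : 0 < th -> is_derive (zeta u) th (zeta u th * zeta_rate th).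
Proof.
intros Hth. unfold zeta at 1. evar_last.
- apply (is_derive_scal langer th (langer_scale u)). now apply is_derive_langer.
- unfold zeta, zeta_rate. simpl. ring.
Qed.

Lemma zeta_sqrt_rate u th : 0 < u -> 0 < th ->
  zeta u th * zeta_rate th * sqrt (zeta u th) = u * sinh th ^ 2.
Proof.
intros Hu Hth. assert (H := zeta_sqrt u th Hu Hth). assert (Hp := phase_pos th Hth).
replace (zeta u th * zeta_rate th * sqrt (zeta u th)) with ((zeta u th * sqrt (zeta u th)) * zeta_rate th) by ring.
rewrite H. unfold zeta_rate. field. lra.
Qed.

Lemma is_derive_zeta_rate th : 0 < th ->
  is_derive zeta_rate th (zeta_rate th * (2 * cosh th / sinh th - sinh th ^ 2 / phase th)).
Proof.
intros Hth. assert (Hp := phase_pos th Hth). assert (Hv := sinh_pos th Hth).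
unfold zeta_rate. evar_last.
- apply (is_derive_div (fun th => 2 / 3 * sinh th ^ 2) phase th); [|apply is_derive_phase|lra].
  auto_derive; [trivial|reflexivity].
- simpl. field. lra.
Qed.

(** The amplitude zeta^(1/4) sinh^(-1/2), written through logarithms so that its logarithmic
    derivative is immediate. *)
Definition langer_amp (u th : R) : R := exp (ln (zeta u th) / 4 - ln (sinh th) / 2).

Lemma langer_amp_pos u th : 0 < langer_amp u th.
Proof. apply exp_pos. Qed.

Lemma langer_amp_sq u th : 0 < th -> langer_amp u th ^ 2 = sqrt (zeta u th) / sinh th.
Proof.
intros Hth. assert (Hv := sinh_pos th Hth). unfold langer_amp. simpl. rewrite Rmult_1_r, <- exp_plus.
replace (ln (zeta u th) / 4 - ln (sinh th) / 2 + (ln (zeta u th) / 4 - ln (sinh th) / 2))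
  with (/ 2 * ln (zeta u th) + - ln (sinh th)) by field.
rewrite exp_plus, exp_Ropp, exp_ln by trivial. unfold Rdiv. f_equal.
rewrite <- Rpower_sqrt by apply zeta_pos. reflexivity.
Qed.

Lemma is_derive_langer_amp u th : 0 < th ->
  is_derive (langer_amp u) th (langer_amp u th * (zeta_rate th / 4 - cosh th / sinh th / 2)).
Proof.
intros Hth. assert (Hv := sinh_pos th Hth). assert (Hz := zeta_pos u th).
assert (Hd := is_derive_zeta u th Hth). unfold langer_amp. auto_derive.
- repeat split; trivial. eexists; apply Hd.
- change (Derive (fun x => zeta u x) th) with (Derive (zeta u) th). rewrite (is_derive_unique _ _ _ Hd). unfold Rdiv, Rminus. field. lra.
Qed.

Definition turning_sq (n : nat) : R := 2 * INR n + 1.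

Lemma turning_sq_pos n : 0 < turning_sq n.
Proof. unfold turning_sq. generalize (pos_INR n). lra. Qed.

Definition outer_fun (n : nat) (th : R) : R := hermite_fun n (sqrt (turning_sq n) * cosh th).

Definition outer_fun' (n : nat) (th : R) : R :=
  sqrt (turning_sq n) * sinh th * hermite_fun' n (sqrt (turning_sq n) * cosh th).

Lemma is_derive_outer_fun n th : is_derive (outer_fun n) th (outer_fun' n th).
Proof.
unfold outer_fun, outer_fun'. evar_last.
- apply (is_derive_comp (hermite_fun n) (fun th => sqrt (turning_sq n) * cosh th)); [apply is_derive_hermite_fun|].
  apply (is_derive_scal cosh th (sqrt (turning_sq n))). auto_derive; [trivial|reflexivity].
- unfold scal; simpl. unfold mult; simpl. ring.
Qed.

Lemma is_derive_outer_fun' n th : 0 < th ->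
  is_derive (outer_fun' n) th
    (cosh th / sinh th * outer_fun' n th + turning_sq n ^ 2 * sinh th ^ 4 * outer_fun n th).
Proof.
intros Hth. assert (Hv := sinh_pos th Hth). assert (Hu := turning_sq_pos n).
assert (E : sqrt (turning_sq n) * sqrt (turning_sq n) = turning_sq n) by (apply sqrt_sqrt; lra).
unfold outer_fun, outer_fun'. evar_last.
- apply (is_derive_mult (fun th => sqrt (turning_sq n) * sinh th) (fun th => hermite_fun' n (sqrt (turning_sq n) * cosh th)) th).
  + apply (is_derive_scal sinh th (sqrt (turning_sq n))). auto_derive; [trivial|reflexivity].
  + apply (is_derive_comp (hermite_fun' n) (fun th => sqrt (turning_sq n) * cosh th)); [apply is_derive_hermite_fun'|].
    apply (is_derive_scal cosh th (sqrt (turning_sq n))). auto_derive; [trivial|reflexivity].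
  + intros x y; exact (Rmult_comm x y).
- unfold plus, scal; simpl. unfold mult; simpl. fold (turning_sq n).
  set (s := sqrt (turning_sq n)) in *. rewrite <- E.
  assert (Hcs := cosh_sq th). set (H0 := hermite_fun n _). set (H1 := hermite_fun' n _).
  replace (s * cosh th * (s * cosh th * 1) - s * s) with (s * s * sinh th ^ 2).
  + field. lra.
  + replace (s * cosh th * (s * cosh th * 1)) with (s * s * cosh th ^ 2) by ring. rewrite Hcs. ring.
Qed.

Definition airy_approx (A : R -> R) (n : nat) (th : R) : R :=
  langer_amp (turning_sq n) th * A (zeta (turning_sq n) th).

(** The weight p in the self-adjoint equation (p h')' = - E sinh^2 p h for the ratio h. The divisor
    sinh comes from the first-order term coth of the equation in th. *)
Definition approx_weight (A : R -> R) (n : nat) (th : R) : R := airy_approx A n th ^ 2 / sinh th.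

(** The Wronskian of [outer_fun] and [airy_approx] divided by sinh, which is p h' for the ratio
    h. *)
Definition approx_flux (A D : R -> R) (n : nat) (th : R) : R :=
  let u := turning_sq n in let z := zeta u th in
  langer_amp u th / sinh th *
  (A z * outer_fun' n th -
   outer_fun n th * (A z * (zeta_rate th / 4 - cosh th / sinh th / 2) + D z * (z * zeta_rate th))).

Lemma airy_approx_pos A D n th : decaying_airy A D -> 0 < airy_approx A n th.
Proof.
intros H. unfold airy_approx. apply Rmult_lt_0_compat; [apply langer_amp_pos|].
apply (airy_pos A D H). left; apply zeta_pos.
Qed.

Lemma approx_weight_pos A D n th : decaying_airy A D -> 0 < th -> 0 < approx_weight A n th.
Proof.
intros H Hth. assert (H1 := airy_approx_pos A D n th H). assert (H2 := sinh_pos th Hth).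
unfold approx_weight. pos.
Qed.

Lemma is_derive_airy_zeta (F dF : R -> R) u th : (forall t, is_derive F t (dF t)) -> 0 < th ->
  is_derive (fun th => F (zeta u th)) th (dF (zeta u th) * (zeta u th * zeta_rate th)).
Proof.
intros H Hth. evar_last.
- apply (is_derive_comp F (zeta u)); [apply H|now apply is_derive_zeta].
- unfold scal; simpl. unfold mult; simpl. ring.
Qed.

Lemma is_derive_airy_approx A D n th : decaying_airy A D -> 0 < th ->
  is_derive (airy_approx A n) th
   (langer_amp (turning_sq n) th * (A (zeta (turning_sq n) th) * (zeta_rate th / 4 - cosh th / sinh th / 2)
     + D (zeta (turning_sq n) th) * (zeta (turning_sq n) th * zeta_rate th))).
Proof.
intros H Hth. unfold airy_approx. evar_last.
- apply (is_derive_mult (langer_amp (turning_sq n)) (fun th => A (zeta (turning_sq n) th)) th).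
  + now apply is_derive_langer_amp.
  + apply (is_derive_airy_zeta A D); [apply H|trivial].
  + intros x y; exact (Rmult_comm x y).
- unfold plus, mult; simpl. ring.
Qed.

Definition hermite_ratio (A : R -> R) (n : nat) (th : R) : R := outer_fun n th / airy_approx A n th.

Lemma is_derive_hermite_ratio A D n th : decaying_airy A D -> 0 < th ->
  is_derive (hermite_ratio A n) th (approx_flux A D n th / approx_weight A n th).
Proof.
intros H Hth. assert (Hw := airy_approx_pos A D n th H). assert (Hv := sinh_pos th Hth).
unfold hermite_ratio. evar_last.
- apply (is_derive_div (outer_fun n) (airy_approx A n) th).
  + apply is_derive_outer_fun.
  + now apply (is_derive_airy_approx A D).
  + lra.
- unfold approx_flux, approx_weight. simpl. fold (turning_sq n).
  unfold airy_approx at 2. assert (Hm := langer_amp_pos (turning_sq n) th).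
  unfold airy_approx in *. set (m := langer_amp _ _) in *. set (a := A _) in *.
  assert (a <> 0) by (intros E; rewrite E in Hw; lra). field. repeat split; lra.
Qed.

Lemma is_derive_approx_flux A D n th : decaying_airy A D -> 0 < th ->
  is_derive (approx_flux A D n) th
    (- (langer_error th * sinh th ^ 2 * approx_weight A n th * hermite_ratio A n th)).
Proof.
intros H Hth. assert (Hw := airy_approx_pos A D n th H). assert (Hv := sinh_pos th Hth).
assert (Hu := turning_sq_pos n). assert (Hp := phase_pos th Hth).
assert (Hm := langer_amp_pos (turning_sq n) th).
unfold approx_flux. cbv zeta. set (u := turning_sq n) in *.
evar_last.
- apply (is_derive_mult (fun th => langer_amp u th / sinh th)
   (fun th => A (zeta u th) * outer_fun' n th -
     outer_fun n th * (A (zeta u th) * (zeta_rate th / 4 - cosh th / sinh th / 2) + D (zeta u th) * (zeta u th * zeta_rate th))) th).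
  + apply (is_derive_div (langer_amp u) sinh th); [now apply is_derive_langer_amp| |lra].
    auto_derive; [trivial|reflexivity].
  + apply (is_derive_minus (fun th => A (zeta u th) * outer_fun' n th)).
    * apply (is_derive_mult (fun th => A (zeta u th)) (outer_fun' n) th).
      { apply (is_derive_airy_zeta A D); [apply H|trivial]. }
      { now apply is_derive_outer_fun'. }
      { intros x y; exact (Rmult_comm x y). }
    * apply (is_derive_mult (outer_fun n) (fun th => A (zeta u th) * (zeta_rate th / 4 - cosh th / sinh th / 2) + D (zeta u th) * (zeta u th * zeta_rate th)) th).
      { apply is_derive_outer_fun. }
      { apply (is_derive_plus (fun th => A (zeta u th) * (zeta_rate th / 4 - cosh th / sinh th / 2))).
        - apply (is_derive_mult (fun th => A (zeta u th)) (fun th => zeta_rate th / 4 - cosh th / sinh th / 2) th).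
          + apply (is_derive_airy_zeta A D); [apply H|trivial].
          + apply (is_derive_minus (fun th => zeta_rate th / 4) (fun th => cosh th / sinh th / 2)).
            * apply (is_derive_ext (fun th => / 4 * zeta_rate th)); [intros; apply Rmult_comm|].
              apply (is_derive_scal zeta_rate th (/ 4)). now apply is_derive_zeta_rate.
            * auto_derive; [lra|reflexivity].
          + intros x y; exact (Rmult_comm x y).
        - apply (is_derive_mult (fun th => D (zeta u th)) (fun th => zeta u th * zeta_rate th) th).
          + apply (is_derive_airy_zeta D (fun t => t * A t)); [apply H|trivial].
          + apply (is_derive_mult (zeta u) zeta_rate th); [now apply is_derive_zeta|now apply is_derive_zeta_rate|].
            intros x y; exact (Rmult_comm x y).
          + intros x y; exact (Rmult_comm x y). }
      { intros x y; exact (Rmult_comm x y). }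
  + intros x y; exact (Rmult_comm x y).
- unfold minus, plus, opp, mult, scal; simpl. unfold mult; simpl.
  unfold approx_weight, hermite_ratio, airy_approx in *. fold u in Hw |- *.
  assert (Hz3 := zeta_cube u th Hu Hth). assert (Hcs := cosh_sq th).
  set (m := langer_amp u th) in *. set (z := zeta u th) in *. set (a := A z) in *. set (d := D z) in *.
  set (g := outer_fun n th) in *. set (g' := outer_fun' n th) in *.
  assert (Ha : a <> 0) by (intros E; rewrite E in Hw; lra).
  unfold langer_error, zeta_rate.
  set (v := sinh th) in *. set (C := cosh th) in *.
  (* Halving the phase gives the relation [Hz] integer coefficients; [field] uses it and [Hcs] as
     rewrite rules. *)
  set (T := phase th / 2). assert (ET : phase th = 2 * T) by (unfold T; field).
  rewrite ET in *. clearbody T v C z a d g g' m u.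
  assert (Hz : z ^ 3 = 9 * u ^ 2 * T ^ 2) by (rewrite Hz3; field).
  field [Hcs Hz]. repeat split; lra.
Qed.

Definition approx_weight_rate (A D : R -> R) (n : nat) (th : R) : R :=
  let z := zeta (turning_sq n) th in
  zeta_rate th / 2 - 2 * (cosh th / sinh th) + 2 * (D z / A z * (z * zeta_rate th)).

Lemma is_derive_approx_weight A D n th : decaying_airy A D -> 0 < th ->
  is_derive (approx_weight A n) th (approx_weight A n th * approx_weight_rate A D n th).
Proof.
intros H Hth. assert (Hw := airy_approx_pos A D n th H). assert (Hv := sinh_pos th Hth).
unfold approx_weight. evar_last.
- apply (is_derive_div (fun th => airy_approx A n th ^ 2) sinh th).
  + apply (is_derive_pow (airy_approx A n) 2). now apply (is_derive_airy_approx A D).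
  + auto_derive; [trivial|reflexivity].
  + lra.
- simpl. unfold approx_weight_rate, airy_approx in *. cbv zeta. set (z := zeta _ _) in *.
  set (a := A z) in *. assert (a <> 0) by (intros E; rewrite E in Hw; lra). field. split; lra.
Qed.

Lemma zeta_rate_le th : 0 < th -> zeta_rate th <= 2 * (cosh th / sinh th).
Proof.
intros Hth. assert (Hv := sinh_pos th Hth). assert (Hc := cosh_ge_1 th).
assert (Hp := phase_pos th Hth). assert (Hcube := phase_ge_cube th ltac:(lra)).
unfold zeta_rate. apply Rmult_le_reg_r with (phase th); trivial.
replace (2 / 3 * sinh th ^ 2 / phase th * phase th) with (2 * (cosh th / sinh th) * (sinh th ^ 3 / (3 * cosh th))) by (field; lra).
apply Rmult_le_compat_l; trivial. left; pos.
Qed.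

(** The amplitude terms have a favourable sign by [zeta_rate_le], and D / A <= - sqrt zeta with
    [zeta_sqrt_rate] gives the rest. The factor sinh^2 matches that of the error term, so comparing
    the two yields 1/u. *)
Lemma approx_weight_rate_le A D n th : decaying_airy A D -> 0 < th ->
  approx_weight_rate A D n th <= - (2 * turning_sq n * sinh th ^ 2).
Proof.
intros H Hth. assert (Hu := turning_sq_pos n). assert (Hz := zeta_pos (turning_sq n) th).
assert (Hs := zeta_sqrt_rate (turning_sq n) th Hu Hth). assert (Hr := zeta_rate_le th Hth).
assert (Hv := sinh_pos th Hth). assert (Hc := cosh_ge_1 th). assert (Hp := phase_pos th Hth).
unfold approx_weight_rate. cbv zeta. set (z := zeta _ _) in *.
assert (Ha := airy_pos A D H z ltac:(lra)). assert (Hd := airy_deriv_le A D H z ltac:(lra)).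
assert (D z / A z <= - sqrt z).
{ apply Rmult_le_reg_r with (A z); trivial. replace (D z / A z * A z) with (D z) by (field; lra). trivial. }
assert (Hzr : 0 < z * zeta_rate th) by (unfold zeta_rate; pos).
assert (D z / A z * (z * zeta_rate th) <= - sqrt z * (z * zeta_rate th)) by (apply Rmult_le_compat_r; lra).
assert (0 < cosh th / sinh th) by pos.
lra.
Qed.

(** Applies [flux_bound] to h and to -h. The flux varies at a rate of at most 10 M exp(-th) sinh^2
    p, while K p decreases at least at the rate 2 K u sinh^2 p; equating the two gives K. *)
Lemma hermite_ratio_flux_le A D n th M : decaying_airy A D -> 0 < th ->
  (forall t, th <= t -> Rabs (hermite_ratio A n t) <= M) ->
  Rabs (approx_flux A D n th / approx_weight A n th) <= 5 * M / turning_sq n * exp (- th).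
Proof.
intros H Hth HM. assert (Hu := turning_sq_pos n).
assert (HM0 : 0 <= M) by (apply Rle_trans with (2 := HM th (Rle_refl _)), Rabs_pos).
set (K := 5 * M / turning_sq n * exp (- th)).
assert (HK0 : 0 <= K).
{ unfold K. apply Rmult_le_pos; [|left; pos]. apply Rmult_le_pos; [lra|left; pos]. }
assert (Hdp : forall z, th <= z -> approx_weight A n z * approx_weight_rate A D n z <= - (2 * turning_sq n * (sinh z ^ 2 * approx_weight A n z))).
{ intros z Hz. assert (Hw := approx_weight_pos A D n z H ltac:(lra)).
  assert (Hr := approx_weight_rate_le A D n z H ltac:(lra)). nra. }
assert (HdV : forall z, th <= z -> K * (2 * turning_sq n * (sinh z ^ 2 * approx_weight A n z))
   >= Rabs (langer_error z * sinh z ^ 2 * approx_weight A n z * hermite_ratio A n z)).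
{ intros z Hz. assert (Hw := approx_weight_pos A D n z H ltac:(lra)). assert (Hv := sinh_pos z ltac:(lra)).
  assert (HE := langer_error_bound z ltac:(lra)).
  assert (He : exp (- z) <= exp (- th)) by (apply exp_mono; lra).
  specialize (HM z Hz). rewrite !Rabs_mult.
  assert (0 < sinh z ^ 2) by pos.
  rewrite (Rabs_pos_eq (sinh z ^ 2)), (Rabs_pos_eq (approx_weight A n z)) by lra.
  replace (K * (2 * turning_sq n * (sinh z ^ 2 * approx_weight A n z)))
    with ((10 * exp (- th)) * M * (sinh z ^ 2 * approx_weight A n z)) by (unfold K; field; lra).
  replace (Rabs (langer_error z) * sinh z ^ 2 * approx_weight A n z * Rabs (hermite_ratio A n z))
    with (Rabs (langer_error z) * Rabs (hermite_ratio A n z) * (sinh z ^ 2 * approx_weight A n z)) by ring.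
  apply Rle_ge. apply Rmult_le_compat_r; [left; pos|].
  apply Rmult_le_compat; try apply Rabs_pos; lra. }
assert (Hneg : forall z, th <= z -> approx_weight A n z * approx_weight_rate A D n z <= 0).
{ intros z Hz. specialize (Hdp z Hz). assert (Hw := approx_weight_pos A D n z H ltac:(lra)).
  assert (Hv := sinh_pos z ltac:(lra)).
  assert (0 < 2 * turning_sq n * (sinh z ^ 2 * approx_weight A n z)) by pos. lra. }
apply Rabs_le. split.
- cut (- approx_flux A D n th / approx_weight A n th <= K).
  { unfold Rdiv. lra. }
  apply (flux_bound (fun z => - hermite_ratio A n z) (fun z => - approx_flux A D n z) (approx_weight A n)
    (fun z => - - (langer_error z * sinh z ^ 2 * approx_weight A n z * hermite_ratio A n z))
    (fun z => approx_weight A n z * approx_weight_rate A D n z) th K M); trivial.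
  + intros z Hz. apply (approx_weight_pos A D); trivial; lra.
  + intros z Hz. evar_last.
    * apply (is_derive_opp (hermite_ratio A n)). apply (is_derive_hermite_ratio A D); trivial; lra.
    * unfold opp; simpl. unfold Rdiv. ring.
  + intros z Hz. apply (is_derive_opp (approx_flux A D n)). apply is_derive_approx_flux; trivial; lra.
  + intros z Hz. apply is_derive_approx_weight; trivial; lra.
  + intros z Hz. specialize (Hdp z Hz). specialize (HdV z Hz).
    apply Rge_le in HdV. apply Rabs_le_between in HdV. nra.
  + intros z Hz. specialize (HM z Hz). apply Rabs_le_between in HM. lra.
- apply (flux_bound (hermite_ratio A n) (approx_flux A D n) (approx_weight A n)
    (fun z => - (langer_error z * sinh z ^ 2 * approx_weight A n z * hermite_ratio A n z))
    (fun z => approx_weight A n z * approx_weight_rate A D n z) th K M); trivial.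
  + intros z Hz. apply (approx_weight_pos A D); trivial; lra.
  + intros z Hz. apply is_derive_hermite_ratio; trivial; lra.
  + intros z Hz. apply is_derive_approx_flux; trivial; lra.
  + intros z Hz. apply is_derive_approx_weight; trivial; lra.
  + intros z Hz. specialize (Hdp z Hz). specialize (HdV z Hz).
    apply Rge_le in HdV. apply Rabs_le_between in HdV. nra.
  + intros z Hz. specialize (HM z Hz). apply Rabs_le_between in HM. lra.
Qed.

(* Integrating the flux bound down from infinity. *)
Lemma hermite_ratio_near_limit A D n th M (L : R) : decaying_airy A D -> 0 < th ->
  is_lim (hermite_ratio A n) p_infty L ->
  (forall t, th <= t -> Rabs (hermite_ratio A n t) <= M) ->
  Rabs (hermite_ratio A n th - L) <= 5 * M / turning_sq n.
Proof.
intros H Hth HL HM. assert (Hu := turning_sq_pos n).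
assert (HM0 : 0 <= M) by (apply Rle_trans with (2 := HM th (Rle_refl _)), Rabs_pos).
set (K := 5 * M / turning_sq n). assert (HK : 0 <= K) by (apply Rmult_le_pos; [lra|left; pos]).
assert (Hfl : forall z, th <= z -> Rabs (approx_flux A D n z / approx_weight A n z) <= K * exp (- z)).
{ intros z Hz. apply hermite_ratio_flux_le; trivial; [lra|]. intros; apply HM; lra. }
assert (Hd : forall z, th <= z -> Rabs (hermite_ratio A n z - hermite_ratio A n th) <= K).
{ intros z Hz.
  assert (He := exp_pos (- z)).
  assert (He2 : exp (- th) <= 1) by (rewrite <- exp_0; apply exp_mono; lra).
  assert (He3 : exp (- z) <= exp (- th)) by (apply exp_mono; lra).
  assert (Hexp : forall t, is_derive (fun t => K * exp (- t)) t (- (K * exp (- t)))).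
  { intros t. auto_derive; trivial. ring. }
  assert (I1 : hermite_ratio A n z + K * exp (- z) <= hermite_ratio A n th + K * exp (- th)).
  { apply (decr_seg (fun t => hermite_ratio A n t + K * exp (- t))
      (fun t => approx_flux A D n t / approx_weight A n t + - (K * exp (- t)))); trivial.
    - intros t Ht. apply (is_derive_plus (hermite_ratio A n)); [|apply Hexp].
      apply is_derive_hermite_ratio; trivial; lra.
    - intros t Ht. specialize (Hfl t ltac:(lra)). apply Rabs_le_between in Hfl. lra. }
  assert (I2 : hermite_ratio A n th - K * exp (- th) <= hermite_ratio A n z - K * exp (- z)).
  { apply (incr_seg (fun t => hermite_ratio A n t - K * exp (- t))
      (fun t => approx_flux A D n t / approx_weight A n t - - (K * exp (- t)))); trivial.
    - intros t Ht. apply (is_derive_minus (hermite_ratio A n)); [|apply Hexp].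
      apply is_derive_hermite_ratio; trivial; lra.
    - intros t Ht. specialize (Hfl t ltac:(lra)). apply Rabs_le_between in Hfl. lra. }
  apply Rabs_le. split; nra. }
apply Rle_plus_epsilon. intros eps Heps.
destruct (is_lim_p_infty_eventually _ _ eps HL Heps) as [T HT].
set (z := Rmax th (T + 1)). assert (Hz1 : th <= z) by apply Rmax_l. assert (Hz2 : T + 1 <= z) by apply Rmax_r.
specialize (Hd z Hz1). specialize (HT z ltac:(lra)). rewrite Rabs_minus_sym in Hd.
replace (hermite_ratio A n th - L) with ((hermite_ratio A n th - hermite_ratio A n z) + (hermite_ratio A n z - L)) by ring.
apply Rle_trans with (1 := Rabs_triang _ _). lra.
Qed.

(** Removes the a priori bound M. At a maximizer s with value M > 2 L, the previous lemma on [s, oo)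
    and u >= 10 would give M <= M/2 + L. So 2 L is a bound, and the previous lemma is applied once
    more. *)
Lemma hermite_ratio_approx A D n th (L : R) : decaying_airy A D -> 0 < th -> 0 < L -> 10 <= turning_sq n ->
  is_lim (hermite_ratio A n) p_infty L ->
  Rabs (hermite_ratio A n th - L) <= 10 * L / turning_sq n.
Proof.
intros H Hth HL0 Hn HL. assert (Hu := turning_sq_pos n).
destruct (is_lim_p_infty_eventually _ _ L HL HL0) as [T HT].
set (T' := Rmax th (T + 1)). assert (HT1 : th <= T') by apply Rmax_l. assert (HT2 : T + 1 <= T') by apply Rmax_r.
destruct (continuity_ab_maj (fun t => Rabs (hermite_ratio A n t)) th T' HT1) as [s [Hs1 Hs2]].
{ intros t Ht. apply continuity_pt_filterlim. apply (continuous_comp (hermite_ratio A n) Rabs); [|apply continuous_Rabs].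
  apply (ex_derive_continuous (hermite_ratio A n)). eexists. apply (is_derive_hermite_ratio A D); trivial; lra. }
assert (Hb : forall t, th <= t -> Rabs (hermite_ratio A n t) <= 2 * L).
{ destruct (Rle_lt_dec (Rabs (hermite_ratio A n s)) (2 * L)) as [Hle|Hgt].
  - intros t Ht. destruct (Rle_lt_dec t T'); [specialize (Hs1 t ltac:(lra)); simpl in Hs1; lra|].
    specialize (HT t ltac:(lra)). apply Rabs_def2 in HT. apply Rabs_le; lra.
  - exfalso. set (M := Rabs (hermite_ratio A n s)) in *.
    assert (HM : forall t, s <= t -> Rabs (hermite_ratio A n t) <= M).
    { intros t Ht. destruct (Rle_lt_dec t T'); [apply Hs1; lra|].
      specialize (HT t ltac:(lra)). apply Rabs_def2 in HT. apply Rle_trans with (2 * L); [|lra]. apply Rabs_le; lra. }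
    assert (Hnear := hermite_ratio_near_limit A D n s M L H ltac:(lra) HL HM).
    assert (5 * M / turning_sq n <= M / 2).
    { apply Rmult_le_reg_r with (turning_sq n); trivial.
      replace (5 * M / turning_sq n * turning_sq n) with (5 * M) by (field; lra). nra. }
    assert (M <= Rabs (hermite_ratio A n s - L) + L).
    { unfold M. replace (hermite_ratio A n s) with ((hermite_ratio A n s - L) + L) at 1 by ring.
      apply Rle_trans with (1 := Rabs_triang _ _). rewrite (Rabs_pos_eq L) by lra. lra. }
    lra. }
assert (Hnear := hermite_ratio_near_limit A D n th (2 * L) L H Hth HL Hb).
replace (10 * L / turning_sq n) with (5 * (2 * L) / turning_sq n) by (field; lra). exact Hnear.
Qed.

Lemma is_lim_airy_ratio A c : airy_connected A c -> is_lim (fun t => A t * wkb t) p_infty c.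
Proof.
intros [Hc H].
assert (Hlow : is_lim (fun t => c * exp (- (5 / 48 * / t))) p_infty c).
{ assert (H0 : is_lim (fun t => - (5 / 48 * / t)) p_infty 0).
  { replace (Finite 0) with (Finite (- (5 / 48 * 0))) by (f_equal; ring).
    apply (is_lim_opp _ p_infty (5 / 48 * 0)). apply (is_lim_scal_l (fun t => / t) (5 / 48) p_infty 0).
    apply (is_lim_inv (fun t => t) p_infty p_infty); [apply is_lim_id|discriminate]. }
  replace (Finite c) with (Finite (c * exp 0)) by (rewrite exp_0; f_equal; ring).
  apply (is_lim_scal_l (fun t => exp (- (5 / 48 * / t))) c p_infty (exp 0)).
  apply (is_lim_comp_continuous (fun t => - (5 / 48 * / t)) exp p_infty 0 H0).
  apply (ex_derive_continuous exp). auto_derive; trivial. }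
apply (is_lim_le_le_loc (fun t => c * exp (- (5 / 48 * / t))) (fun _ => c)); [|exact Hlow|apply is_lim_const].
exists 1. intros t Ht. destruct (H t ltac:(lra)) as [H1 H2]. split; trivial.
assert (Hs : 1 <= sqrt t) by (rewrite <- sqrt_1; apply sqrt_le_1; lra).
set (y := 5 / 48 * / (t * sqrt t)) in *.
assert (Hy : y <= 5 / 48 * / t).
{ unfold y. apply Rmult_le_compat_l; [lra|]. apply Rinv_le_contravar; [lra|nra]. }
apply Rle_trans with (c * exp (- y)).
- apply Rmult_le_compat_l; [lra|]. apply exp_mono. lra.
- rewrite exp_Ropp. assert (He := exp_pos y). apply Rmult_le_reg_r with (exp y); trivial.
  replace (c * / exp y * exp y) with c by (field; lra). trivial.
Qed.

(** Since 2/3 zeta^(3/2) = u * [phase], this trades the Airy asymptotics for exponentials in th. *)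
Lemma langer_amp_wkb u th : 0 < u -> 0 < th ->
  langer_amp u th * (sqrt (sinh th) * exp (u * phase th)) = wkb (zeta u th).
Proof.
intros Hu Hth. assert (Hv := sinh_pos th Hth). assert (Hz := zeta_pos u th).
unfold wkb. rewrite zeta_sqrt by trivial. replace (2 / 3 * (3 / 2 * (u * phase th))) with (u * phase th) by field.
rewrite <- Rmult_assoc. f_equal. unfold langer_amp.
rewrite <- (Rpower_sqrt (sqrt _)), <- (Rpower_sqrt (zeta u th)), <- (Rpower_sqrt (sinh th)), Rpower_mult by pos.
unfold Rpower. rewrite <- exp_plus. f_equal. field.
Qed.

(** The function x^n exp(-x^2/2) sqrt(sinh th) exp(u * [phase]), rewritten in y = exp(-2 th). It
    extends continuously to y = 0, so its limit at infinity is a substitution. *)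
Definition hermite_ratio_tail (n : nat) (y : R) : R :=
  let u := turning_sq n in
  sqrt u ^ n * exp (- u / 4) * ((1 + y) / 2) ^ n * sqrt ((1 - y) / 2) * exp (- (u * y) / 4).

Lemma hermite_ratio_factor A D n th : decaying_airy A D -> 0 < th ->
  let x := sqrt (turning_sq n) * cosh th in
  hermite_ratio A n th = hermite_poly n x / x ^ n * hermite_ratio_tail n (exp (- (2 * th)))
    / (A (zeta (turning_sq n) th) * wkb (zeta (turning_sq n) th)).
Proof.
intros H Hth x. assert (Hu := turning_sq_pos n). assert (Hz := zeta_pos (turning_sq n) th).
assert (Ha := airy_pos A D H _ (Rlt_le _ _ Hz)). assert (Hm := langer_amp_pos (turning_sq n) th).
assert (Hv := sinh_pos th Hth). assert (Hc := cosh_ge_1 th). assert (Hs := sqrt_lt_R0 _ Hu).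
rewrite <- langer_amp_wkb by trivial.
assert (Hx : 0 < x) by (unfold x; pos).
assert (Hxn : 0 < x ^ n) by pos.
assert (Hsv := sqrt_lt_R0 _ Hv). assert (He := exp_pos (turning_sq n * phase th)).
assert (E : hermite_ratio_tail n (exp (- (2 * th))) = x ^ n * exp (- x ^ 2 / 2) * (sqrt (sinh th) * exp (turning_sq n * phase th))).
{ unfold hermite_ratio_tail. cbv zeta. set (y := exp (- (2 * th))). set (u := turning_sq n) in *.
  assert (Hy : exp (- th) = exp th * y) by (unfold y; rewrite <- exp_plus; f_equal; ring).
  assert (Hy2 : y * (exp th * exp th) = 1) by (unfold y; rewrite <- !exp_plus, <- exp_0; f_equal; ring).
  assert (Hy1 : y < 1) by (unfold y; rewrite <- exp_0; apply exp_increasing; lra).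
  assert (Ec : cosh th = exp th * ((1 + y) / 2)) by (unfold cosh; rewrite Hy; field).
  assert (Es : sinh th = exp th * ((1 - y) / 2)) by (unfold sinh; rewrite Hy; field).
  assert (Eth : sqrt (exp th) = exp (th / 2)).
  { rewrite <- Rpower_sqrt by apply exp_pos. unfold Rpower. rewrite ln_exp. f_equal. field. }
  assert (Een : exp th ^ n = exp (INR n * th)).
  { rewrite <- Rpower_pow by apply exp_pos. unfold Rpower. now rewrite ln_exp. }
  assert (Hss : sqrt u * sqrt u = u) by (apply sqrt_sqrt; lra).
  assert (Ex : - x ^ 2 / 2 + u * phase th = - u / 4 + (- (u * y) / 4 + - (u * th / 2))).
  { unfold x, phase. rewrite Ec, Es. simpl.
    replace (sqrt u * (exp th * ((1 + y) / 2)) * (sqrt u * (exp th * ((1 + y) / 2)) * 1))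
      with ((sqrt u * sqrt u) * (exp th * exp th) * ((1 + y) / 2) ^ 2) by ring. rewrite Hss.
    set (X := exp th * exp th) in *.
    transitivity (u * (- (1 + y) ^ 2 * X / 8 + (1 - y) * (1 + y) * X / 8 - th / 2)); [unfold X; field|].
    replace (- (1 + y) ^ 2 * X / 8 + (1 - y) * (1 + y) * X / 8) with (- (1 + y) * (y * X) / 4) by field.
    rewrite Hy2. field. }
  transitivity (x ^ n * sqrt (sinh th) * exp (- x ^ 2 / 2 + u * phase th)); [|rewrite exp_plus; ring].
  rewrite Ex. unfold x. rewrite Ec, Es, !Rpow_mult_distr, Een, sqrt_mult, Eth by (left; pos).
  rewrite !exp_plus, exp_Ropp.
  (* The exponential growth cancels exactly because u = 2 n + 1. *)
  assert (E3 : exp (INR n * th) * exp (th / 2) = exp (u * th / 2)).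
  { rewrite <- exp_plus. f_equal. unfold u, turning_sq. field. }
  transitivity (sqrt u ^ n * exp (- u / 4) * ((1 + y) / 2) ^ n * sqrt ((1 - y) / 2) * exp (- (u * y) / 4)
     * ((exp (INR n * th) * exp (th / 2)) * / exp (u * th / 2))); [rewrite E3|]; field; apply Rgt_not_eq, exp_pos. }
rewrite E. unfold hermite_ratio, airy_approx, outer_fun, hermite_fun. fold x. field. repeat split; lra.
Qed.

Definition outer_limit (n : nat) (c : R) : R :=
  sqrt (turning_sq n) ^ n * exp (- turning_sq n / 4) * sqrt (/ 2) / c.

Lemma is_lim_cosh : is_lim cosh p_infty p_infty.
Proof.
apply (is_lim_le_p_loc (fun x => / 2 * x)).
- exists 0. intros x Hx. unfold cosh. assert (H1 := exp_ineq1_le x). assert (H2 := exp_pos (- x)). lra.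
- evar_last; [apply is_lim_scal_l, is_lim_id|]. simpl.
  case Rle_dec; [|lra]. intros Hle. case Rle_lt_or_eq_dec; [trivial|lra].
Qed.

Lemma is_lim_scal_p_infty (f : R -> R) (k : R) : 0 < k -> is_lim f p_infty p_infty -> is_lim (fun x => k * f x) p_infty p_infty.
Proof.
intros Hk Hf. evar_last; [apply (is_lim_scal_l f k p_infty p_infty Hf)|]. simpl.
case Rle_dec; [|lra]. intros Hle. case Rle_lt_or_eq_dec; [trivial|lra].
Qed.

Lemma langer_ge th : 1 <= th -> / 3 * th <= langer th.
Proof.
intros Hth. assert (Hp := phase_pos th ltac:(lra)). assert (Hz3 := langer_cube th ltac:(lra)).
assert (Hz : 0 < langer th) by apply Rpower_pos.
assert (Hcube := phase_ge_cube th ltac:(lra)). assert (Hc := cosh_ge_1 th). assert (Hcs := cosh_sq th).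
assert (Hv : th <= sinh th).
{ assert (H0 : sinh 0 - 0 <= sinh th - th).
  { apply (incr_seg (fun t => sinh t - t) (fun t => cosh t - 1)); [lra| |].
    - intros z _. auto_derive; trivial. ring.
    - intros z _. generalize (cosh_ge_1 z). lra. }
  rewrite sinh_0 in H0. lra. }
set (z := langer th) in *. set (v := sinh th) in *. set (C := cosh th) in *.
assert (HC : C <= 2 * v) by nra.
assert (v ^ 2 / 6 <= phase th).
{ apply Rle_trans with (2 := Hcube). apply Rmult_le_reg_r with (3 * C); [lra|].
  replace (v ^ 3 / (3 * C) * (3 * C)) with (v ^ 3) by (field; lra). simpl. nra. }
apply Rnot_lt_le; intros Hlt.
assert (z ^ 3 < (/ 3 * th) ^ 3).
{ simpl. rewrite !Rmult_1_r. apply Rmult_gt_0_lt_compat; try nra. }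
rewrite Hz3 in H0.
assert (v ^ 2 / 2 <= 3 * phase th) by lra.
assert ((v ^ 2 / 2) ^ 2 <= (3 * phase th) ^ 2) by (apply pow_incr; split; [left; pos|lra]).
assert (th ^ 4 <= v ^ 4) by (apply pow_incr; lra).
replace ((v ^ 2 / 2) ^ 2) with (v ^ 4 / 4) in H2 by field.
replace ((/ 3 * th) ^ 3) with (/ 27 * th ^ 3) in H0 by field.
assert (th ^ 3 <= th ^ 4) by (simpl; nra). assert (0 < th ^ 3) by pos. lra.
Qed.

Lemma is_lim_zeta u : is_lim (zeta u) p_infty p_infty.
Proof.
unfold zeta. apply (is_lim_scal_p_infty langer); [apply Rpower_pos|].
apply (is_lim_le_p_loc (fun x => / 3 * x)).
- exists 1. intros x Hx. apply langer_ge; lra.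
- apply (is_lim_scal_p_infty (fun x => x)); [lra|apply is_lim_id].
Qed.

Lemma is_lim_hermite_ratio A D c n : decaying_airy A D -> airy_connected A c ->
  is_lim (hermite_ratio A n) p_infty (outer_limit n c).
Proof.
intros H Hc. assert (Hu := turning_sq_pos n). assert (Hs := sqrt_lt_R0 _ Hu). assert (Hc0 := proj1 Hc).
set (x := fun th => sqrt (turning_sq n) * cosh th).
apply (is_lim_ext_loc (fun th => hermite_poly n (x th) / x th ^ n * hermite_ratio_tail n (exp (- (2 * th)))
    / (A (zeta (turning_sq n) th) * wkb (zeta (turning_sq n) th)))).
{ exists 0. intros th Hth. symmetry. now apply (hermite_ratio_factor A D). }
assert (H1 : is_lim (fun th => hermite_poly n (x th) / x th ^ n) p_infty (2 ^ n)).
{ apply (is_lim_comp (fun y => hermite_poly n y / y ^ n) x p_infty (2 ^ n) p_infty); [apply hermite_poly_lim| |].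
  - apply is_lim_scal_p_infty; [trivial|apply is_lim_cosh].
  - exists 0. intros; discriminate. }
assert (H2 : is_lim (fun th => hermite_ratio_tail n (exp (- (2 * th)))) p_infty (hermite_ratio_tail n 0)).
{ apply (is_lim_comp_continuous (fun th => exp (- (2 * th))) (hermite_ratio_tail n) p_infty 0).
  - apply (is_lim_comp exp (fun th => - (2 * th)) p_infty 0 m_infty); [apply is_lim_exp_m| |exists 0; intros; discriminate].
    apply (is_lim_opp (fun th => 2 * th) p_infty p_infty). apply (is_lim_scal_p_infty (fun x => x)); [lra|apply is_lim_id].
  - apply (ex_derive_continuous (hermite_ratio_tail n)). unfold hermite_ratio_tail. cbv zeta.
    auto_derive. lra. }
assert (H3 : is_lim (fun th => A (zeta (turning_sq n) th) * wkb (zeta (turning_sq n) th)) p_infty c).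
{ apply (is_lim_comp (fun t => A t * wkb t) (zeta (turning_sq n)) p_infty c p_infty); [now apply is_lim_airy_ratio|apply is_lim_zeta|].
  exists 0. intros; discriminate. }
replace (Finite (outer_limit n c)) with (Finite (2 ^ n * hermite_ratio_tail n 0 / c)).
- apply (is_lim_div _ _ p_infty (2 ^ n * hermite_ratio_tail n 0) c); trivial.
  + apply (is_lim_mult _ _ p_infty (2 ^ n) (hermite_ratio_tail n 0)); trivial. exact I.
  + intros E; injection E; lra.
  + exact I.
- f_equal. unfold outer_limit, hermite_ratio_tail. cbv zeta.
  replace (- (turning_sq n * 0) / 4) with 0 by field. rewrite exp_0.
  replace ((1 + 0) / 2) with (/ 2) by field. replace ((1 - 0) / 2) with (/ 2) by field.
  rewrite pow_inv. field. split; [lra|]. apply pow_nonzero; lra.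
Qed.

(** * The integral over the forbidden region *)

Lemma ex_RInt_gen_at_point_bounded (f : R -> R) (a B : R) :
  (forall t, a <= t -> continuous f t) -> (forall t, a <= t -> 0 <= f t) ->
  (forall y, a <= y -> RInt f a y <= B) ->
  exists l, is_RInt_gen f (at_point a) (Rbar_locally p_infty) l /\ forall y, a <= y -> RInt f a y <= l.
Proof.
intros Hc Hp HB.
destruct (ex_RInt_gen_bounded (at_point a) (fun x => x = a) f B) as [l [Hl [_ Hle]]].
- now exists a.
- intros x0 ->. split; [reflexivity|apply Rle_refl].
- intros x t -> Ht. now apply Hc.
- intros x t -> Ht. now apply Hp.
- intros x y -> Hy. now apply HB.
- exists l. split; trivial. intros y Hy. now apply Hle.
Qed.

Lemma is_lim_RInt_of_gen (f : R -> R) (a l : R) :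
  is_RInt_gen f (at_point a) (Rbar_locally p_infty) l -> is_lim (fun y => RInt f a y) p_infty l.
Proof.
intros H P HP. destruct (H P HP) as [Q S HQ [M HS] HQS].
exists M. intros y Hy. destruct (HQS a y HQ (HS y Hy)) as [v [Hv1 Hv2]]. simpl in Hv1.
rewrite (is_RInt_unique _ _ _ _ Hv1). exact Hv2.
Qed.

Lemma is_derive_RInt_continuous (f : R -> R) (a t : R) :
  (forall t, continuous f t) -> is_derive (fun y => RInt f a y) t (f t).
Proof.
intros Hc. apply (is_derive_RInt f _ a t); [|apply Hc].
apply filter_forall. intros y. apply (RInt_correct f). apply (ex_RInt_continuous (V := R_CompleteNormedModule)).
intros; apply Hc.
Qed.

Lemma RInt_nonneg_continuous (f : R -> R) (a y : R) :
  (forall t, continuous f t) -> (forall t, a <= t -> 0 <= f t) -> a <= y -> 0 <= RInt f a y.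
Proof.
intros Hc Hp Hy. apply RInt_ge_0; trivial.
- apply (ex_RInt_continuous (V := R_CompleteNormedModule)). intros; apply Hc.
- intros t Ht. apply Hp; lra.
Qed.

Definition airy_sq (A : R -> R) (j : nat) (t : R) : R := t ^ j * A t ^ 2.

Lemma continuous_airy_sq A D j t : decaying_airy A D -> continuous (airy_sq A j) t.
Proof.
intros H. apply (continuous_mult (fun t => t ^ j) (fun t => A t ^ 2)).
- apply (ex_derive_continuous (fun t => t ^ j)). auto_derive; trivial.
- apply (ex_derive_continuous (fun t => A t ^ 2)). eexists. apply (is_derive_pow A 2 t (D t)). apply H.
Qed.

Lemma airy_sq_nonneg A j t : 0 <= t -> 0 <= airy_sq A j t.
Proof. intros Ht. apply Rmult_le_pos; [now apply pow_le|apply pow2_ge_0]. Qed.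

(** Antiderivatives that are quadratic forms in A and D; the last branch is the case j = 2. Each is
    nonpositive for t >= 0, so its value at 0 bounds the integrals. *)
Definition airy_sq_primitive (A D : R -> R) (j : nat) (t : R) : R :=
  match j with
  | O => t * A t ^ 2 - D t ^ 2
  | S O => (A t * D t - t * D t ^ 2 + t ^ 2 * A t ^ 2) / 3
  | _ => (2 * (t * A t * D t) - A t ^ 2 - t ^ 2 * (D t ^ 2 - t * A t ^ 2)) / 5
  end.

Lemma is_derive_airy_sq_primitive A D j t : decaying_airy A D -> (j <= 2)%nat ->
  is_derive (airy_sq_primitive A D j) t (airy_sq A j t).
Proof.
intros H Hj. assert (H1 := airy_D1 A D H). assert (H2 := airy_D2 A D H).
assert (X1 : ex_derive (fun x => A x) t) by (exists (D t); apply H1).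
assert (X2 : ex_derive (fun x => D x) t) by (exists (t * A t); apply H2).
unfold airy_sq. destruct j as [|[|[|j]]]; [| | |lia].
- change (is_derive (fun t => t * A t ^ 2 - D t ^ 2) t (t ^ 0 * A t ^ 2)).
  auto_derive; [repeat split; trivial|subst_derive A H1 t; subst_derive D H2 t; field].
- change (is_derive (fun t => (A t * D t - t * D t ^ 2 + t ^ 2 * A t ^ 2) / 3) t (t ^ 1 * A t ^ 2)).
  auto_derive; [repeat split; trivial|subst_derive A H1 t; subst_derive D H2 t; field].
- change (is_derive (fun t => (2 * (t * A t * D t) - A t ^ 2 - t ^ 2 * (D t ^ 2 - t * A t ^ 2)) / 5) t (t ^ 2 * A t ^ 2)).
  auto_derive; [repeat split; trivial|subst_derive A H1 t; subst_derive D H2 t; field].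
Qed.

Lemma airy_sq_primitive_le0 A D j t : decaying_airy A D -> 0 <= t -> airy_sq_primitive A D j t <= 0.
Proof.
intros H Ht. assert (H1 := airy_prod_le0 A D H t Ht). assert (H2 := airy_deriv_sq_ge A D H t Ht).
assert (H3 := pow2_ge_0 (A t)).
unfold airy_sq_primitive. destruct j as [|[|j]].
- lra.
- assert (t * (t * A t ^ 2) <= t * D t ^ 2) by (apply Rmult_le_compat_l; trivial). lra.
- assert (0 <= t ^ 2 * (D t ^ 2 - t * A t ^ 2)) by (apply Rmult_le_pos; [apply pow2_ge_0|lra]).
  assert (t * (A t * D t) <= 0) by nra. lra.
Qed.

Lemma ex_RInt_gen_airy_sq A D j : decaying_airy A D -> (j <= 2)%nat ->
  exists l, is_RInt_gen (airy_sq A j) (at_point 0) (Rbar_locally p_infty) l /\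
    forall y, 0 <= y -> RInt (airy_sq A j) 0 y <= l.
Proof.
intros H Hj. apply (ex_RInt_gen_at_point_bounded _ _ (- airy_sq_primitive A D j 0)).
- intros; now apply (continuous_airy_sq A D).
- intros; now apply airy_sq_nonneg.
- intros y Hy.
  assert (E := is_RInt_unique _ _ _ _ (is_RInt_derive (airy_sq_primitive A D j) (airy_sq A j) 0 y
    (fun t _ => is_derive_airy_sq_primitive A D j t H Hj) (fun t _ => continuous_airy_sq A D j t H))).
  rewrite E. assert (Hp := airy_sq_primitive_le0 A D j y H Hy). unfold minus, plus, opp; simpl. lra.
Qed.

(** Comparison starting from the turning point. A limit at 0+ is used since [langer] takes the
    default value of [Rpower] at 0, which is not its limit. *)
Lemma nonpos_of_decr_at_0 (f r : R -> R) :
  (forall s t, 0 < s <= t -> f t <= f s) -> (forall s, 0 < s -> f s <= r s) ->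
  filterlim r (at_right 0) (locally 0) -> forall t, 0 < t -> f t <= 0.
Proof.
intros Hd Hr Hl t Ht. apply Rnot_lt_le. intros Hlt.
assert (HP : locally 0 (fun v => v < f t)).
{ exists (mkposreal _ Hlt). intros v Hv.
  unfold_ball_in Hv.
  apply Rabs_def2 in Hv. lra. }
assert (HP' : at_right 0 (fun s => r s < f t)) by exact (Hl _ HP).
destruct (filter_ex (F := at_right 0) _ (filter_and _ _ HP' (at_right_pos t Ht))) as [s [Hs1 [Hs2 Hs3]]].
specialize (Hd s t ltac:(lra)). specialize (Hr s Hs2). lra.
Qed.

Lemma langer_le_sq th : 0 < th -> langer th <= sinh th ^ 2.
Proof.
intros Hth. assert (Hv := sinh_pos th Hth). assert (Hp := phase_pos th Hth).
assert (Hz3 := langer_cube th Hth). assert (Hz : 0 < langer th) by apply Rpower_pos.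
assert (Hcube := phase_le_cube th ltac:(lra)).
apply Rnot_lt_le; intros Hlt. set (z := langer th) in *. set (w := sinh th ^ 2) in *.
assert (0 < w) by (unfold w; pos).
assert (w ^ 3 < z ^ 3).
{ simpl. rewrite !Rmult_1_r. assert (w * w < z * z) by nra. apply Rmult_gt_0_lt_compat; nra. }
rewrite Hz3 in H0.
assert ((3 * phase th) ^ 2 <= (sinh th ^ 3) ^ 2) by (apply pow_incr; lra).
unfold w in H0. replace ((sinh th ^ 2) ^ 3) with ((sinh th ^ 3) ^ 2) in H0 by ring. lra.
Qed.

Lemma filterlim_zeta_0 u : filterlim (zeta u) (at_right 0) (locally 0).
Proof.
apply (filterlim_squeeze0 (zeta u) (fun th => langer_scale u * sinh th ^ 2)).
- exists (mkposreal 1 Rlt_0_1). intros th _ Hth. split; [left; apply zeta_pos|].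
  unfold zeta. apply Rmult_le_compat_l; [left; apply Rpower_pos|now apply langer_le_sq].
- apply (filterlim_filter_le_1 (F := locally 0)); [apply filter_le_within|].
  replace 0 with (langer_scale u * sinh 0 ^ 2) at 2 by (rewrite sinh_0; ring).
  apply (ex_derive_continuous (fun th => langer_scale u * sinh th ^ 2)). auto_derive; trivial.
Qed.

Lemma filterlim_RInt_zeta_0 (f : R -> R) u : (forall t, continuous f t) ->
  filterlim (fun th => RInt f 0 (zeta u th)) (at_right 0) (locally 0).
Proof.
intros Hc. apply (filterlim_comp _ _ _ (zeta u) (fun y => RInt f 0 y) _ (locally 0)); [apply filterlim_zeta_0|].
replace 0 with (RInt f 0 0) at 2 by apply (RInt_point (V := R_CompleteNormedModule)).
apply (ex_derive_continuous (fun y => RInt f 0 y)). eexists. now apply is_derive_RInt_continuous.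
Qed.

Definition outer_integral (n : nat) (X : R) : R :=
  RInt (fun x => hermite_fun n x ^ 2) (sqrt (turning_sq n)) X.

Lemma continuous_hermite_fun_sq n x : continuous (fun x => hermite_fun n x ^ 2) x.
Proof.
apply (ex_derive_continuous (fun x => hermite_fun n x ^ 2)). eexists.
apply (is_derive_pow (hermite_fun n) 2 x (hermite_fun' n x)). apply is_derive_hermite_fun.
Qed.

Lemma is_derive_outer_integral n th :
  is_derive (fun th => outer_integral n (sqrt (turning_sq n) * cosh th)) th
   (outer_fun n th ^ 2 * (sqrt (turning_sq n) * sinh th)).
Proof.
unfold outer_integral. evar_last.
- apply (is_derive_comp (fun X => RInt (fun x => hermite_fun n x ^ 2) (sqrt (turning_sq n)) X) (fun th => sqrt (turning_sq n) * cosh th)).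
  + apply is_derive_RInt_continuous. intros; apply continuous_hermite_fun_sq.
  + apply (is_derive_scal cosh th (sqrt (turning_sq n))). auto_derive; [trivial|reflexivity].
- unfold scal; simpl. unfold mult, outer_fun; simpl. ring.
Qed.

Lemma filterlim_outer_integral_0 n :
  filterlim (fun th => outer_integral n (sqrt (turning_sq n) * cosh th)) (at_right 0) (locally 0).
Proof.
apply (filterlim_filter_le_1 (F := locally 0)); [apply filter_le_within|].
replace 0 with (outer_integral n (sqrt (turning_sq n) * cosh 0)) at 2.
- apply (ex_derive_continuous (fun th => outer_integral n (sqrt (turning_sq n) * cosh th))).
  eexists. apply is_derive_outer_integral.
- unfold outer_integral. rewrite cosh_0, Rmult_1_r. apply (RInt_point (V := R_CompleteNormedModule)).
Qed.

(** Change of variable from x to zeta: [zeta * zeta_rate] is the derivative of zeta in th, and the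
    squared amplitude combines with both Jacobians into [langer] / sinh^2. *)
Lemma outer_density A D n th : decaying_airy A D -> 0 < th ->
  outer_fun n th ^ 2 * (sqrt (turning_sq n) * sinh th) =
  sqrt (turning_sq n) * langer_scale (turning_sq n) / turning_sq n *
   (hermite_ratio A n th ^ 2 * (langer th / sinh th ^ 2)) *
   (airy_sq A 0 (zeta (turning_sq n) th) * (zeta (turning_sq n) th * zeta_rate th)).
Proof.
intros H Hth. assert (Hu := turning_sq_pos n). assert (Hv := sinh_pos th Hth).
assert (Hw := airy_approx_pos A D n th H). assert (Hz := zeta_pos (turning_sq n) th).
assert (E1 := zeta_sqrt_rate (turning_sq n) th Hu Hth).
assert (E2 : outer_fun n th = hermite_ratio A n th * airy_approx A n th) by (unfold hermite_ratio; field; lra).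
assert (E3 : sqrt (zeta (turning_sq n) th) * sqrt (zeta (turning_sq n) th) = zeta (turning_sq n) th) by (apply sqrt_sqrt; lra).
rewrite E2, Rpow_mult_distr. unfold airy_approx. rewrite Rpow_mult_distr, langer_amp_sq by trivial.
unfold airy_sq. simpl (_ ^ 0). rewrite Rmult_1_l.
set (h := hermite_ratio A n th). set (nu := sqrt (turning_sq n)). set (u := turning_sq n) in *.
set (a := A _). assert (E4 : langer_scale u * langer th = zeta u th) by reflexivity.
transitivity (nu * h ^ 2 * a ^ 2 * sqrt (zeta u th)); [field; lra|].
replace (nu * langer_scale u / u * (h ^ 2 * (langer th / sinh th ^ 2)) * (a ^ 2 * (zeta u th * zeta_rate th)))
  with (nu * h ^ 2 * a ^ 2 * ((langer_scale u * langer th) * (zeta u th * zeta_rate th)) / (u * sinh th ^ 2)) by (field; lra).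
rewrite E4, <- E1. rewrite <- E3 at 2. 
assert (0 < sqrt (zeta u th)) by pos. assert (0 < zeta_rate th) by (unfold zeta_rate; generalize (phase_pos th Hth); intros; pos).
field. repeat split; lra.
Qed.

Lemma langer_scale_sq_ge u : 2 <= u -> u / 2 <= langer_scale u ^ 2.
Proof.
intros Hu. unfold langer_scale. rewrite <- Rpower_double. 
rewrite <- (Rpower_1 (u / 2)) at 1 by lra. apply Rle_Rpower; lra.
Qed.

(** With z = zeta / b, [langer_bound] gives 1 - z/5 up to 5 z^2, and b^2 >= u/2 turns z^2 into at
    most 2 zeta^2 / u. The factor 30 comes from |h - L| <= 10 L / u and h + L <= 3 L. *)
Lemma density_ratio_approx A D n th (L : R) : decaying_airy A D -> 0 < th -> 0 < L -> 30 <= turning_sq n ->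
  is_lim (hermite_ratio A n) p_infty L ->
  Rabs (hermite_ratio A n th ^ 2 * (langer th / sinh th ^ 2)
    - L ^ 2 * (1 - zeta (turning_sq n) th / (5 * langer_scale (turning_sq n))))
  <= L ^ 2 * (30 / turning_sq n * (1 + zeta (turning_sq n) th ^ 2)).
Proof.
intros H Hth HL0 Hn HL. assert (Hu := turning_sq_pos n). assert (Hv := sinh_pos th Hth).
assert (Hh := hermite_ratio_approx A D n th L H Hth HL0 ltac:(lra) HL).
assert (Hlb := langer_bound th Hth). assert (Hb2 := langer_scale_sq_ge (turning_sq n) ltac:(lra)).
assert (Hb : 0 < langer_scale (turning_sq n)) by apply Rpower_pos.
assert (Hz : 0 < langer th) by apply Rpower_pos.
unfold zeta. set (u := turning_sq n) in *. set (b := langer_scale u) in *. set (z := langer th) in *.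
set (q := z / sinh th ^ 2) in *. set (h := hermite_ratio A n th) in *.
assert (Hq : 0 < q) by (unfold q; pos).
replace (b * z / (5 * b)) with (z / 5) by (field; lra).
assert (Hi : 0 < / u) by pos. 
assert (Hi30 : / u <= / 30) by (apply Rinv_le_contravar; lra).
replace (10 * L / u) with (10 * L * / u) in Hh by (field; lra).
replace (30 / u) with (30 * / u) by (field; lra).
assert (Hzz : z ^ 2 <= 2 * / u * (b * z) ^ 2).
{ replace (2 * / u * (b * z) ^ 2) with ((2 * / u * b ^ 2) * z ^ 2) by ring.
  rewrite <- (Rmult_1_l (z ^ 2)) at 1. apply Rmult_le_compat_r; [apply pow2_ge_0|].
  replace 1 with (2 * / u * (u / 2)) by (field; lra). apply Rmult_le_compat_l; lra. }
apply Rabs_le_between in Hh. apply Rabs_le_between in Hlb.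
assert (Hq2 : q <= 1 + 5 * z ^ 2) by lra.
assert (HLu : 10 * L * / u <= L) by nra.
assert (Hh2 : - (30 * / u * L ^ 2) <= h ^ 2 - L ^ 2 <= 30 * / u * L ^ 2).
{ replace (h ^ 2 - L ^ 2) with ((h - L) * (h + L)) by ring.
  replace (30 * / u * L ^ 2) with ((10 * L * / u) * (3 * L)) by ring.
  set (e := 10 * L * / u) in *. assert (0 < e) by (unfold e; pos). split; nra. }
replace (h ^ 2 * q - L ^ 2 * (1 - z / 5)) with ((h ^ 2 - L ^ 2) * q + L ^ 2 * (q - 1 + z / 5)) by field.
set (e := 30 * / u) in *. assert (0 < e <= 1) by (unfold e; lra).
assert (Hzz' : z ^ 2 <= e / 15 * (b * z) ^ 2) by (unfold e; lra).
set (Z := (b * z) ^ 2) in *. assert (0 <= Z) by apply pow2_ge_0.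
assert (HL2 : 0 < L ^ 2) by pos. assert (Hz2 : 0 <= z ^ 2) by apply pow2_ge_0.
set (L2 := L ^ 2) in *. set (z2 := z ^ 2) in *.
apply Rle_trans with (e * L2 * (1 + 5 * z2) + L2 * (5 * z2)).
- apply Rle_trans with (1 := Rabs_triang _ _). apply Rplus_le_compat.
  + rewrite Rabs_mult, (Rabs_pos_eq q) by lra. apply Rmult_le_compat; try lra; [apply Rabs_pos|apply Rabs_le; lra].
  + rewrite Rabs_mult, (Rabs_pos_eq L2) by lra. apply Rmult_le_compat_l; [lra|]. apply Rabs_le; lra.
- replace (e * L2 * (1 + 5 * z2) + L2 * (5 * z2)) with (L2 * (e + 5 * e * z2 + 5 * z2)) by ring.
  apply Rmult_le_compat_l; [lra|]. nra.
Qed.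

(** The pointwise comparison of densities makes both signed differences minus the error
    nonincreasing in th. Upper bounds tending to 0 at 0+ then make them nonpositive. *)
Lemma outer_integral_bounds A D n (L : R) th : decaying_airy A D -> 0 < L -> 30 <= turning_sq n ->
  is_lim (hermite_ratio A n) p_infty L -> 0 < th ->
  let u := turning_sq n in let b := langer_scale u in
  let kappa := L ^ 2 * (sqrt u * b / u) in
  let B j := RInt (airy_sq A j) 0 (zeta u th) in
  Rabs (outer_integral n (sqrt u * cosh th) - kappa * (B 0%nat - B 1%nat / (5 * b)))
  <= kappa * (30 / u * (B 0%nat + B 2%nat)).
Proof.
intros H HL0 Hn HL Hth u b kappa B. assert (Hu := turning_sq_pos n). fold u in Hu.
assert (Hb : 0 < b) by apply Rpower_pos. assert (Hsu := sqrt_lt_R0 u Hu).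
assert (Hk : 0 < kappa) by (unfold kappa; pos).
set (BB := fun j th => RInt (airy_sq A j) 0 (zeta u th)).
assert (HB0 : forall j s, 0 <= BB j s).
{ intros j s. apply RInt_nonneg_continuous; [intros; now apply (continuous_airy_sq A D)|intros; now apply airy_sq_nonneg|].
  left; apply zeta_pos. }
assert (Hdz : forall s, 0 < s -> 0 < zeta u s * zeta_rate s).
{ intros s Hs. assert (H1 := zeta_pos u s). assert (H2 := sinh_pos s Hs). assert (H3 := phase_pos s Hs). unfold zeta_rate; pos. }
assert (HdB : forall j s, 0 < s -> is_derive (BB j) s (airy_sq A j (zeta u s) * (zeta u s * zeta_rate s))).
{ intros j s Hs. unfold BB. apply (is_derive_airy_zeta (fun y => RInt (airy_sq A j) 0 y) (airy_sq A j)); trivial.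
  intros t. apply is_derive_RInt_continuous. intros; now apply (continuous_airy_sq A D). }
assert (HB00 : forall j, filterlim (BB j) (at_right 0) (locally 0)).
{ intros j. apply filterlim_RInt_zeta_0. intros; now apply (continuous_airy_sq A D). }
set (Phi := fun th => outer_integral n (sqrt u * cosh th)).
assert (HPhi0 : forall s, 0 <= s -> 0 <= Phi s).
{ intros s Hs. apply RInt_nonneg_continuous; [intros; apply continuous_hermite_fun_sq|intros; apply pow2_ge_0|].
  fold u. assert (Hc := cosh_ge_1 s). nra. }
set (main := fun s => kappa * (BB 0%nat s - / (5 * b) * BB 1%nat s)).
set (err := fun s => kappa * (30 / u * (BB 0%nat s + BB 2%nat s))).
set (dmain := fun s => kappa * (airy_sq A 0 (zeta u s) * (zeta u s * zeta_rate s) - / (5 * b) * (airy_sq A 1 (zeta u s) * (zeta u s * zeta_rate s)))).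
set (derr := fun s => kappa * (30 / u * (airy_sq A 0 (zeta u s) * (zeta u s * zeta_rate s) + airy_sq A 2 (zeta u s) * (zeta u s * zeta_rate s)))).
set (dPhi := fun s => outer_fun n s ^ 2 * (sqrt u * sinh s)).
assert (DPhi : forall s, is_derive Phi s (dPhi s)) by (intros; apply is_derive_outer_integral).
assert (Dmain : forall s, 0 < s -> is_derive main s (dmain s)).
{ intros s Hs. apply (is_derive_scal (fun s => BB 0%nat s - / (5 * b) * BB 1%nat s)).
  apply (is_derive_minus (BB 0%nat)); [now apply HdB|]. apply (is_derive_scal (BB 1%nat)). now apply HdB. }
assert (Derr : forall s, 0 < s -> is_derive err s (derr s)).
{ intros s Hs. apply (is_derive_scal (fun s => 30 / u * (BB 0%nat s + BB 2%nat s))).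
  apply (is_derive_scal (fun s => BB 0%nat s + BB 2%nat s)).
  apply (is_derive_plus (BB 0%nat)); now apply HdB. }
assert (Hkey : forall s, 0 < s -> Rabs (dPhi s - dmain s) <= derr s).
{ intros s Hs. unfold dPhi. fold u. unfold u at 1. rewrite (outer_density A D n s H Hs). fold u. fold b.
  assert (Hr := density_ratio_approx A D n s L H Hs HL0 Hn HL). fold u in Hr. fold b in Hr.
  unfold dmain, derr, airy_sq. rewrite pow_O, pow_1.
  set (z := zeta u s) in *. set (a := A z ^ 2). set (r := z * zeta_rate s).
  set (hq := hermite_ratio A n s ^ 2 * _) in *.
  assert (Ha : 0 <= a) by apply pow2_ge_0. assert (Hr0 := Hdz s Hs). fold z in Hr0. fold r in Hr0.
  set (k := sqrt u * b / u) in *. assert (Hk' : 0 < k) by (unfold k; pos).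
  replace (k * hq * (1 * a * r) - kappa * (1 * a * r - / (5 * b) * (z * a * r)))
    with (k * (a * r) * (hq - L ^ 2 * (1 - z / (5 * b)))) by (unfold kappa; field; lra).
  replace (kappa * (30 / u * (1 * a * r + z ^ 2 * a * r)))
    with (k * (a * r) * (L ^ 2 * (30 / u * (1 + z ^ 2)))) by (unfold kappa; field; lra).
  assert (0 <= k * (a * r)) by (apply Rmult_le_pos; [lra|]; apply Rmult_le_pos; lra).
  rewrite Rabs_mult, (Rabs_pos_eq (k * (a * r))) by trivial. apply Rmult_le_compat_l; trivial. }
assert (Hi5 : 0 < / (5 * b)) by pos. assert (Hi30 : 0 < 30 / u) by pos.
assert (Hup : Phi th - main th - err th <= 0).
{ apply (nonpos_of_decr_at_0 (fun s => Phi s - main s - err s) (fun s => Phi s + kappa * / (5 * b) * BB 1%nat s)); trivial.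
  - intros s t Hst. apply (decr_seg (fun s => Phi s - main s - err s) (fun s => dPhi s - dmain s - derr s)); [lra| |].
    + intros y Hy. apply (is_derive_minus (fun s => Phi s - main s) err); [|apply Derr; lra].
      apply (is_derive_minus Phi main); [apply DPhi|apply Dmain; lra].
    + intros y Hy. specialize (Hkey y ltac:(lra)). apply Rabs_le_between in Hkey. lra.
  - intros s Hs. unfold main, err. assert (G0 := HB0 0%nat s). assert (G2 := HB0 2%nat s).
    assert (0 <= kappa * BB 0%nat s) by (apply Rmult_le_pos; lra).
    assert (0 <= kappa * (30 / u * (BB 0%nat s + BB 2%nat s))).
    { apply Rmult_le_pos; [lra|]. apply Rmult_le_pos; lra. }
    rewrite Rmult_minus_distr_l. rewrite <- Rmult_assoc. lra.
  - cut (filterlim (fun s => Phi s + kappa * / (5 * b) * BB 1%nat s) (at_right 0) (locally (0 + kappa * / (5 * b) * 0))).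
    { rewrite Rmult_0_r, Rplus_0_r. trivial. }
    apply (filterlim_comp_2 Phi (fun s => kappa * / (5 * b) * BB 1%nat s) Rplus (G := locally 0) (H := locally (kappa * / (5 * b) * 0))).
    + apply filterlim_outer_integral_0.
    + apply (filterlim_comp _ _ _ (BB 1%nat) (fun y => kappa * / (5 * b) * y) _ (locally 0)); [apply HB00|].
      apply (filterlim_scal_r (kappa * / (5 * b)) (0 : R_NormedModule)).
    + apply (filterlim_plus 0 (kappa * / (5 * b) * 0)). }
assert (Hlo : main th - Phi th - err th <= 0).
{ apply (nonpos_of_decr_at_0 (fun s => main s - Phi s - err s) (fun s => kappa * BB 0%nat s)); trivial.
  - intros s t Hst. apply (decr_seg (fun s => main s - Phi s - err s) (fun s => dmain s - dPhi s - derr s)); [lra| |].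
    + intros y Hy. apply (is_derive_minus (fun s => main s - Phi s) err); [|apply Derr; lra].
      apply (is_derive_minus main Phi); [apply Dmain; lra|apply DPhi].
    + intros y Hy. specialize (Hkey y ltac:(lra)). apply Rabs_le_between in Hkey. lra.
  - intros s Hs. unfold main, err. assert (G0 := HB0 0%nat s). assert (G1 := HB0 1%nat s). assert (G2 := HB0 2%nat s).
    assert (0 <= kappa * (30 / u * (BB 0%nat s + BB 2%nat s))).
    { apply Rmult_le_pos; [lra|]. apply Rmult_le_pos; lra. }
    assert (0 <= kappa * (/ (5 * b) * BB 1%nat s)).
    { apply Rmult_le_pos; [lra|]. apply Rmult_le_pos; lra. }
    specialize (HPhi0 s ltac:(lra)). rewrite Rmult_minus_distr_l. lra.
  - cut (filterlim (fun s => kappa * BB 0%nat s) (at_right 0) (locally (kappa * 0))).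
    { rewrite Rmult_0_r. trivial. }
    apply (filterlim_comp _ _ _ (BB 0%nat) (fun y => kappa * y) _ (locally 0)); [apply HB00|].
    apply (filterlim_scal_r kappa (0 : R_NormedModule)). }
unfold B. fold (BB 0%nat th) (BB 1%nat th) (BB 2%nat th). fold (Phi th). fold (err th).
replace (kappa * (BB 0%nat th - BB 1%nat th / (5 * b))) with (main th) by (unfold main, Rdiv; ring).
apply Rabs_le. lra.
Qed.

(** The finite bounds first give a uniform bound, hence convergence of the integral, and then the
    estimate in the limit th -> oo. *)
Lemma outer_integral_limit A D n (L A0 A1 A2 : R) : decaying_airy A D -> 0 < L -> 30 <= turning_sq n ->
  is_lim (hermite_ratio A n) p_infty L ->
  is_RInt_gen (airy_sq A 0) (at_point 0) (Rbar_locally p_infty) A0 ->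
  is_RInt_gen (airy_sq A 1) (at_point 0) (Rbar_locally p_infty) A1 ->
  is_RInt_gen (airy_sq A 2) (at_point 0) (Rbar_locally p_infty) A2 ->
  let u := turning_sq n in let b := langer_scale u in
  let kappa := L ^ 2 * (sqrt u * b / u) in
  exists I, is_RInt_gen (fun x => hermite_fun n x ^ 2) (at_point (sqrt u)) (Rbar_locally p_infty) I /\
  Rabs (I - kappa * (A0 - A1 / (5 * b))) <= kappa * (30 / u * (A0 + A2)).
Proof.
intros H HL0 Hn HL HA0 HA1 HA2 u b kappa. assert (Hu := turning_sq_pos n). fold u in Hu.
assert (Hb : 0 < b) by apply Rpower_pos. assert (Hsu := sqrt_lt_R0 u Hu).
assert (Hk : 0 < kappa) by (unfold kappa; pos).
assert (Hbd := fun th => outer_integral_bounds A D n L th H HL0 Hn HL). cbv zeta in Hbd. fold u b kappa in Hbd.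
assert (Hle : forall j l, (j <= 2)%nat -> is_RInt_gen (airy_sq A j) (at_point 0) (Rbar_locally p_infty) l ->
  forall th, 0 <= RInt (airy_sq A j) 0 (zeta u th) <= l).
{ intros j l Hj Hl th. destruct (ex_RInt_gen_airy_sq A D j H Hj) as [l' [Hl'1 Hl'2]].
  assert (l = l').
  { rewrite <- (is_RInt_gen_unique (V := R_CompleteNormedModule) _ _ Hl).
    apply (is_RInt_gen_unique (V := R_CompleteNormedModule) _ _ Hl'1). }
  subst l'. split; [|apply Hl'2; left; apply zeta_pos].
  apply RInt_nonneg_continuous; [intros; now apply (continuous_airy_sq A D)|intros; now apply airy_sq_nonneg|].
  left; apply zeta_pos. }
assert (Hxlim : is_lim (fun th => sqrt u * cosh th) p_infty p_infty) by (apply is_lim_scal_p_infty; [trivial|apply is_lim_cosh]).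
assert (Hi5 : 0 < / (5 * b)) by pos. assert (Hi30 : 0 < 30 / u) by pos.
destruct (ex_RInt_gen_at_point_bounded (fun x => hermite_fun n x ^ 2) (sqrt u) (kappa * A0 + kappa * (30 / u * (A0 + A2)))) as [I [HI1 HI2]].
- intros; apply continuous_hermite_fun_sq.
- intros; apply pow2_ge_0.
- intros y Hy.
  set (P := fun v => y < v). 
  destruct (Hxlim P) as [M HM]; [now exists y|].
  set (th := Rmax 1 (M + 1)). assert (Hth1 : 1 <= th) by apply Rmax_l. assert (Hth2 : M + 1 <= th) by apply Rmax_r.
  specialize (HM th ltac:(lra)). unfold P in HM.
  assert (Hb1 := Hbd th ltac:(lra)). apply Rabs_le_between in Hb1.
  assert (G0 := Hle 0%nat A0 ltac:(lia) HA0 th). assert (G1 := Hle 1%nat A1 ltac:(lia) HA1 th).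
  assert (G2 := Hle 2%nat A2 ltac:(lia) HA2 th).
  set (B0 := RInt (airy_sq A 0) _ _) in *. set (B1 := RInt (airy_sq A 1) _ _) in *. set (B2 := RInt (airy_sq A 2) _ _) in *.
  apply Rle_trans with (outer_integral n (sqrt u * cosh th)).
  + apply (incr_seg (fun X => outer_integral n X) (fun x => hermite_fun n x ^ 2)); [lra| |].
    * intros; apply (is_derive_RInt_continuous (fun x => hermite_fun n x ^ 2)). intros; apply continuous_hermite_fun_sq.
    * intros; apply pow2_ge_0.
  + assert (kappa * (B0 - B1 / (5 * b)) <= kappa * A0).
    { apply Rmult_le_compat_l; [lra|]. unfold Rdiv. assert (0 <= B1 * / (5 * b)) by (apply Rmult_le_pos; lra). lra. }
    assert (kappa * (30 / u * (B0 + B2)) <= kappa * (30 / u * (A0 + A2))).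
    { apply Rmult_le_compat_l; [lra|]. apply Rmult_le_compat_l; lra. }
    lra.
- exists I. split; trivial.
  assert (L0 : is_lim (fun th => outer_integral n (sqrt u * cosh th)) p_infty I).
  { apply (is_lim_comp (fun X => outer_integral n X) (fun th => sqrt u * cosh th) p_infty I p_infty); trivial.
    - apply is_lim_RInt_of_gen. exact HI1.
    - exists 0. intros; discriminate. }
  assert (LB : forall j l, is_RInt_gen (airy_sq A j) (at_point 0) (Rbar_locally p_infty) l ->
    is_lim (fun th => RInt (airy_sq A j) 0 (zeta u th)) p_infty l).
  { intros j l Hl. apply (is_lim_comp (fun y => RInt (airy_sq A j) 0 y) (zeta u) p_infty l p_infty).
    - now apply is_lim_RInt_of_gen.
    - apply is_lim_zeta.
    - exists 0. intros; discriminate. }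
  assert (L1 : is_lim (fun th => outer_integral n (sqrt u * cosh th) -
     kappa * (RInt (airy_sq A 0) 0 (zeta u th) - / (5 * b) * RInt (airy_sq A 1) 0 (zeta u th))) p_infty
     (I - kappa * (A0 - / (5 * b) * A1))).
  { apply is_lim_minus'; trivial. apply (is_lim_scal_l _ kappa p_infty (A0 - / (5 * b) * A1)).
    apply is_lim_minus'; [now apply LB|]. apply (is_lim_scal_l _ (/ (5 * b)) p_infty A1). now apply LB. }
  apply (is_lim_comp_continuous _ Rabs) in L1; [|apply continuous_Rabs].
  replace (A1 / (5 * b)) with (/ (5 * b) * A1) by (unfold Rdiv; ring).
  assert (Hfin : Rbar_le (Rabs (I - kappa * (A0 - / (5 * b) * A1))) (kappa * (30 / u * (A0 + A2)))); [|exact Hfin].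
  refine (is_lim_le_loc _ (fun _ => kappa * (30 / u * (A0 + A2))) p_infty _ _ _ L1 (is_lim_const _ _)).
  exists 1. intros th Hth. assert (Hb1 := Hbd th ltac:(lra)).
  assert (G0 := Hle 0%nat A0 ltac:(lia) HA0 th). assert (G2 := Hle 2%nat A2 ltac:(lia) HA2 th).
  set (B0 := RInt (airy_sq A 0) _ _) in *. set (B1 := RInt (airy_sq A 1) _ _) in *. set (B2 := RInt (airy_sq A 2) _ _) in *.
  replace (/ (5 * b) * B1) with (B1 / (5 * b)) by (unfold Rdiv; ring).
  apply Rle_trans with (1 := Hb1). apply Rmult_le_compat_l; [lra|]. apply Rmult_le_compat_l; [lra|]. fold B0 B2. lra.
Qed.

(** * Asymptotics of the prefactor and the final estimate *)

Lemma is_airy_decaying Ai : is_airy Ai -> decaying_airy Ai (Derive Ai).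
Proof.
intros [H1 [H2 H3]]. constructor.
- intros t. apply Derive_correct. apply H1.
- intros t. apply (proj2 (H1 t)).
- exact H2.
- rewrite H3, Gamma_Mellin by lra. assert (HG := Mellin_pos 1 (2 / 3) ltac:(lra) ltac:(lra)). pos.
Qed.

Lemma is_airy_connected Ai : is_airy Ai -> airy_connected Ai (/ (2 * sqrt PI)).
Proof.
intros H. assert (HA := is_airy_decaying Ai H).
destruct (airy_connection Ai (Derive Ai) HA) as [c Hc].
rewrite <- (airy_connection_value Ai (Derive Ai) c HA Hc); [exact Hc|apply H].
Qed.

Lemma RInt_gen_ext_at_point (f g : R -> R) (a l : R) : (forall x, f x = g x) ->
  is_RInt_gen f (at_point a) (Rbar_locally p_infty) l ->
  RInt_gen g (at_point a) (Rbar_locally p_infty) = l.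
Proof.
intros Hfg Hf. apply (is_RInt_gen_unique (V := R_CompleteNormedModule)).
apply (is_RInt_gen_ext f g l); [|exact Hf]. apply filter_forall. intros ab x _. apply Hfg.
Qed.

Lemma P_tun_eq n I :
  is_RInt_gen (fun x => hermite_fun n x ^ 2) (at_point (sqrt (turning_sq n))) (Rbar_locally p_infty) I ->
  P_tun n = 2 / (sqrt PI * 2 ^ n * INR (fact n)) * I.
Proof.
intros H. unfold P_tun. f_equal. unfold turning_sq in H.
apply (RInt_gen_ext_at_point (fun x => hermite_fun n x ^ 2)); trivial.
intros x. unfold hermite_fun. now rewrite hermite_eq.
Qed.

(** The normalization of the squared eigenfunction times the factor [kappa] of
    [outer_integral_limit], hence the total coefficient of the Airy integrals. *)
Definition tunnel_scale (n : nat) : R :=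
  2 / (sqrt PI * 2 ^ n * INR (fact n)) *
  (outer_limit n (/ (2 * sqrt PI)) ^ 2 * (sqrt (turning_sq n) * langer_scale (turning_sq n) / turning_sq n)).

Lemma outer_limit_pos n c : 0 < c -> 0 < outer_limit n c.
Proof. intros Hc. assert (Hu := turning_sq_pos n). unfold outer_limit. pos. Qed.

Lemma tunnel_scale_pos n : 0 < tunnel_scale n.
Proof.
assert (Hu := turning_sq_pos n). assert (Hpi := PI_RGT_0). assert (Hf := INR_fact_pos n).
assert (HL : 0 < outer_limit n (/ (2 * sqrt PI))) by (apply outer_limit_pos; pos).
unfold tunnel_scale, langer_scale. pos.
Qed.

Lemma ln_sqrt x : 0 < x -> ln (sqrt x) = ln x / 2.
Proof. intros Hx. rewrite <- Rpower_sqrt by trivial. unfold Rpower. rewrite ln_exp. field. Qed.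

Lemma ln_tunnel_scale n : (1 <= n)%nat ->
  Rabs (ln (tunnel_scale n) - (ln 2 - ln (INR n) / 3)) <= / 3 * / INR n.
Proof.
intros Hn. assert (Hx : 1 <= INR n) by (apply (le_INR 1 n); trivial).
assert (Hu := turning_sq_pos n). assert (Hpi := PI_RGT_0). assert (Hf := INR_fact_pos n).
assert (Hsp := sqrt_lt_R0 PI Hpi). assert (Hsu := sqrt_lt_R0 _ Hu).
assert (HL : 0 < outer_limit n (/ (2 * sqrt PI))) by (apply outer_limit_pos; pos).
assert (Hb : 0 < langer_scale (turning_sq n)) by apply Rpower_pos.
assert (S := ln_fact_bounds n Hn).
assert (EL : ln (outer_limit n (/ (2 * sqrt PI))) =
  INR n * (ln (turning_sq n) / 2) - turning_sq n / 4 - ln 2 / 2 + ln 2 + ln PI / 2).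
{ unfold outer_limit. rewrite ln_div, !ln_mult, ln_pow, ln_exp, !ln_sqrt, !ln_Rinv, ln_mult, ln_sqrt by pos. field. }
assert (EQ : ln (tunnel_scale n) = ln 2 - (ln PI / 2 + INR n * ln 2 + ln (INR (fact n)))
  + (2 * ln (outer_limit n (/ (2 * sqrt PI))) + (ln (turning_sq n) / 2 + 2 / 3 * (ln (turning_sq n) - ln 2) - ln (turning_sq n)))).
{ unfold tunnel_scale. rewrite ln_mult, ln_div, !ln_mult, !ln_pow, ln_div, ln_mult, !ln_sqrt by pos.
  unfold langer_scale at 1, Rpower. rewrite ln_exp, ln_div by lra. simpl (INR 2). ring. }
rewrite EQ, EL.
assert (Eu : ln (turning_sq n) = ln 2 + ln (INR n + / 2)).
{ rewrite <- ln_mult by lra. f_equal. unfold turning_sq. field. }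
assert (E2 : ln (2 * PI) = ln 2 + ln PI) by (apply ln_mult; lra).
assert (Em : ln (INR n + / 2) = ln (INR n) + ln (1 + / (2 * INR n))).
{ rewrite <- ln_mult; [f_equal; field; lra|lra|]. assert (0 < / (2 * INR n)) by pos. lra. }
rewrite Eu, Em. unfold turning_sq. rewrite E2 in S.
set (x := INR n) in *. assert (Hi : 0 < / x) by pos.
assert (Hy0 : 0 < / (2 * x)) by pos.
assert (B1 := ln_1p_ge (/ (2 * x)) ltac:(lra)). assert (B2 := ln_1p_le_id (/ (2 * x)) ltac:(lra)).
replace (2 * / (2 * x) / (2 + / (2 * x))) with (2 / (4 * x + 1)) in B1 by (field; lra).
set (y := ln (1 + / (2 * x))) in *.
(* After Stirling the deviation is (x + 1/6) y - 1/2 minus a remainder in [0, 1/(4x)]. The 1/6 is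
   the net exponent 1/2 + 2/3 - 1 of u outside u^n. *)
assert (C1 : (x + / 6) * y <= / 2 + / 12 * / x).
{ apply Rle_trans with ((x + / 6) * / (2 * x)); [apply Rmult_le_compat_l; lra|]. right. field. lra. }
assert (C2 : / 2 - / 24 * / x <= (x + / 6) * y).
{ apply Rle_trans with ((x + / 6) * (2 / (4 * x + 1))); [|apply Rmult_le_compat_l; lra].
  replace ((x + / 6) * (2 / (4 * x + 1))) with (/ 2 - / 6 * / (4 * x + 1)) by (field; lra).
  assert (/ (4 * x + 1) <= / 4 * / x) by (rewrite <- Rinv_mult; apply Rinv_le_contravar; lra). lra. }
set (l2 := ln 2) in *. set (lp := ln PI) in *. set (lx := ln x) in *. set (lf := ln (INR (fact n))) in *.
clearbody y l2 lp lx lf.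
apply Rabs_le. split; lra.
Qed.

Lemma exp_sub_1_bound x : Rabs x <= / 2 -> Rabs (exp x - 1) <= 2 * Rabs x.
Proof.
intros Hx. assert (H1 := exp_ineq1_le x). assert (H2 := exp_ineq1_le (- x)). rewrite exp_Ropp in H2.
assert (H3 := exp_pos x). assert (H4 := Rle_abs x). assert (H5 := Rle_abs (- x)). rewrite Rabs_Ropp in H5.
assert (exp x * (1 + - x) <= 1).
{ apply Rle_trans with (exp x * / exp x); [apply Rmult_le_compat_l; lra|]. right. field. lra. }
apply Rabs_le. split; [lra|].
destruct (Rle_lt_dec 0 x) as [Hp|Hn].
- rewrite (Rabs_pos_eq x) in * by trivial. nra.
- rewrite (Rabs_left x) in * by trivial. nra.
Qed.

Lemma tunnel_scale_approx n : (1 <= n)%nat ->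
  Rabs (tunnel_scale n - 2 * / Rpower (INR n) (1 / 3)) <= 2 * / Rpower (INR n) (1 / 3) * (/ INR n).
Proof.
intros Hn. assert (Hx : 1 <= INR n) by (apply (le_INR 1 n); trivial).
assert (H := ln_tunnel_scale n Hn). assert (Hq := tunnel_scale_pos n).
set (e := ln (tunnel_scale n) - (ln 2 - ln (INR n) / 3)) in *.
assert (E : tunnel_scale n = 2 * / Rpower (INR n) (1 / 3) * exp e).
{ rewrite <- Rpower_Ropp. unfold Rpower. rewrite <- (exp_ln (tunnel_scale n)) by trivial.
  rewrite <- (exp_ln 2) at 1 by lra. rewrite <- !exp_plus. f_equal. unfold e. field. }
assert (Hi : / INR n <= 1) by (rewrite <- Rinv_1; apply Rinv_le_contravar; lra).
assert (Hb := exp_sub_1_bound e ltac:(lra)).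
assert (Hs : 0 < 2 * / Rpower (INR n) (1 / 3)) by pos.
rewrite E. set (s := 2 * / Rpower (INR n) (1 / 3)) in *.
assert (0 < / INR n) by pos.
replace (s * exp e - s) with (s * (exp e - 1)) by ring.
rewrite Rabs_mult, (Rabs_pos_eq s) by lra. apply Rmult_le_compat_l; lra.
Qed.

(** Here b = n^(2/3) (1 + 1/(2n))^(2/3), and the last factor lies between 1 and 1 + 1/(2n). *)
Lemma langer_scale_approx n : (1 <= n)%nat ->
  1 <= langer_scale (turning_sq n) /\
  0 <= / Rpower (INR n) (2 / 3) - / langer_scale (turning_sq n) <= / INR n.
Proof.
intros Hn. assert (Hx : 1 <= INR n) by (apply (le_INR 1 n); trivial).
unfold langer_scale, turning_sq. set (x := INR n) in *. assert (Hi : 0 < / x) by pos.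
replace ((2 * x + 1) / 2) with (x * (1 + / 2 * / x)) by (field; lra).
rewrite <- Rpower_mult_distr by lra.
set (r := Rpower x (2 / 3)). set (w := 1 + / 2 * / x).
assert (Hr : 1 <= r) by (unfold r; rewrite <- (Rpower_O x) by lra; apply Rle_Rpower; lra).
assert (Hw1 : 1 <= Rpower w (2 / 3)) by (rewrite <- (Rpower_O w) by (unfold w; lra); apply Rle_Rpower; unfold w; lra).
assert (Hw2 : Rpower w (2 / 3) <= w).
{ rewrite <- (Rpower_1 w) at 2 by (unfold w; lra). apply Rle_Rpower; unfold w; lra. }
set (p := Rpower w (2 / 3)) in *. split; [nra|].
replace (/ r - / (r * p)) with (/ r * (1 - / p)) by (field; lra).
assert (/ r <= 1) by (rewrite <- Rinv_1; apply Rinv_le_contravar; lra). assert (0 < / r) by pos.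
assert (0 < / p <= 1) by (split; [pos|rewrite <- Rinv_1; apply Rinv_le_contravar; lra]).
assert (1 - / p <= p - 1).
{ assert (p * / p = 1) by (field; lra). nra. }
unfold w in Hw2. split; nra.
Qed.

Theorem mainTheorem2 (Ai : R -> R) (HAi : is_airy Ai) :
  big_O
    (fun n : nat =>
       P_tun n -
       1 / Rpower (INR n) (1 / 3) *
       (2 * RInt_gen (fun t => Ai t ^ 2) (at_point 0) (Rbar_locally p_infty) -
        2 / (5 * Rpower (INR n) (2 / 3)) *
        RInt_gen (fun t => t * Ai t ^ 2) (at_point 0) (Rbar_locally p_infty)))
    (fun n : nat => Rpower (INR n) (- (4 / 3))).
Proof.
assert (HA := is_airy_decaying Ai HAi). assert (Hc := is_airy_connected Ai HAi).
assert (Hpi := PI_RGT_0).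
destruct (ex_RInt_gen_airy_sq Ai _ 0 HA ltac:(lia)) as [A0 [HA0 HA0p]].
destruct (ex_RInt_gen_airy_sq Ai _ 1 HA ltac:(lia)) as [A1 [HA1 HA1p]].
destruct (ex_RInt_gen_airy_sq Ai _ 2 HA ltac:(lia)) as [A2 [HA2 HA2p]].
assert (Hpos : forall j l, (forall y, 0 <= y -> RInt (airy_sq Ai j) 0 y <= l) -> 0 <= l).
{ intros j l Hl. specialize (Hl 0 (Rle_refl 0)). rewrite RInt_point in Hl. exact Hl. }
apply Hpos in HA0p. apply Hpos in HA1p. apply Hpos in HA2p. clear Hpos.
rewrite (RInt_gen_ext_at_point (airy_sq Ai 0) (fun t => Ai t ^ 2) 0 A0) by (trivial; intros; unfold airy_sq; ring).
rewrite (RInt_gen_ext_at_point (airy_sq Ai 1) (fun t => t * Ai t ^ 2) 0 A1) by (trivial; intros; unfold airy_sq; ring).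
(* From n = 15 on, u >= 30 as [outer_integral_limit] requires. The estimates below add up to 62 A0 +
   3 A1 + 60 A2. *)
exists (100 * (A0 + A1 + A2)). exists 15%nat. intros n Hn.
assert (Hn1 : (1 <= n)%nat) by lia.
assert (Hx : 15 <= INR n) by (replace 15 with (INR 15) by (simpl; ring); now apply le_INR).
assert (Hu30 : 30 <= turning_sq n) by (unfold turning_sq; lra).
assert (HL := is_lim_hermite_ratio Ai _ _ n HA Hc).
assert (HL0 : 0 < outer_limit n (/ (2 * sqrt PI))) by (apply outer_limit_pos; pos).
destruct (outer_integral_limit Ai _ n _ A0 A1 A2 HA HL0 Hu30 HL HA0 HA1 HA2) as [I [HI1 HI2]].
rewrite (P_tun_eq n I HI1).
assert (HQ := tunnel_scale_pos n). assert (HQa := tunnel_scale_approx n Hn1).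
destruct (langer_scale_approx n Hn1) as [Hb1 Hb2].
assert (Hf := INR_fact_pos n). assert (Hsp := sqrt_lt_R0 PI Hpi).
assert (Hpre : 0 < 2 / (sqrt PI * 2 ^ n * INR (fact n))) by pos.
set (pre := 2 / (sqrt PI * 2 ^ n * INR (fact n))) in *.
set (b := langer_scale (turning_sq n)) in *.
set (s := / Rpower (INR n) (1 / 3)) in *. assert (Hs : 0 < s) by (unfold s; pos).
assert (Hr : 0 < Rpower (INR n) (2 / 3)) by apply Rpower_pos.
set (r := Rpower (INR n) (2 / 3)) in *.
assert (E43 : Rpower (INR n) (- (4 / 3)) = s * / INR n).
{ unfold s. rewrite <- !Rpower_Ropp. rewrite <- (Rpower_1 (INR n)) at 3 by lra.
  rewrite <- Rpower_Ropp, <- Rpower_plus. f_equal. field. }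
rewrite E43.
set (kappa := outer_limit n (/ (2 * sqrt PI)) ^ 2 * (sqrt (turning_sq n) * b / turning_sq n)) in *.
assert (HQk : tunnel_scale n = pre * kappa) by reflexivity.
assert (H1 : Rabs (pre * I - tunnel_scale n * (A0 - A1 / (5 * b))) <= tunnel_scale n * (30 / turning_sq n * (A0 + A2))).
{ rewrite HQk. replace (pre * I - pre * kappa * (A0 - A1 / (5 * b))) with (pre * (I - kappa * (A0 - A1 / (5 * b)))) by ring.
  rewrite Rabs_mult, (Rabs_pos_eq pre), Rmult_assoc by lra. apply Rmult_le_compat_l; [lra|exact HI2]. }
replace (1 / Rpower (INR n) (1 / 3)) with s by (unfold s, Rdiv; ring).
set (Q := tunnel_scale n) in *. clearbody Q s r b pre. clear HQk HI2 HI1 HL HL0 E43.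
assert (Hi : 0 < / INR n) by pos. assert (Hi1 : / INR n <= 1) by (rewrite <- Rinv_1; apply Rinv_le_contravar; lra).
assert (Hui : 30 / turning_sq n <= 15 * / INR n).
{ unfold turning_sq. replace (15 * / INR n) with (30 * / (2 * INR n)) by (field; lra).
  apply Rmult_le_compat_l; [lra|]. apply Rinv_le_contravar; lra. }
set (i := / INR n) in *.
assert (HQ4 : Q <= 4 * s) by (apply Rabs_le_between in HQa; nra).
rewrite (Rabs_pos_eq (s * i)) by (apply Rmult_le_pos; lra).
assert (Hib : 0 < / b <= 1) by (split; [pos|rewrite <- Rinv_1; apply Rinv_le_contravar; lra]).
replace (A1 / (5 * b)) with (A1 / 5 * / b) in H1 by (field; lra).
(* Three errors: of the integral, of the coefficient Q against 2 n^(-1/3), and of b against n^(2/3).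
   Each is O(s i) with s i = n^(-4/3). *)
replace (pre * I - s * (2 * A0 - 2 / (5 * r) * A1))
  with ((pre * I - Q * (A0 - A1 / 5 * / b)) + ((Q - 2 * s) * (A0 - A1 / 5 * / b) + 2 * s * (A1 / 5) * (/ r - / b)))
  by (field; lra).
assert (T1 : Q * (30 / turning_sq n * (A0 + A2)) <= 60 * (A0 + A2) * (s * i)).
{ replace (60 * (A0 + A2) * (s * i)) with (4 * s * (15 * i * (A0 + A2))) by ring.
  apply Rmult_le_compat; try lra.
  - apply Rmult_le_pos; [|lra]. left. assert (Hu := turning_sq_pos n). pos.
  - apply Rmult_le_compat_r; lra. }
assert (T2 : Rabs ((Q - 2 * s) * (A0 - A1 / 5 * / b)) <= 2 * (A0 + A1) * (s * i)).
{ rewrite Rabs_mult. replace (2 * (A0 + A1) * (s * i)) with (2 * s * i * (A0 + A1)) by ring.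
  apply Rmult_le_compat; try apply Rabs_pos; [exact HQa|]. apply Rabs_le. split; nra. }
assert (T3 : Rabs (2 * s * (A1 / 5) * (/ r - / b)) <= A1 * (s * i)).
{ rewrite Rabs_pos_eq.
  - assert (s * A1 * (/ r - / b) <= s * A1 * i) by (apply Rmult_le_compat_l; [apply Rmult_le_pos; lra|lra]).
    assert (0 <= s * A1 * (/ r - / b)) by (apply Rmult_le_pos; [apply Rmult_le_pos; lra|lra]). lra.
  - apply Rmult_le_pos; [|lra]. apply Rmult_le_pos; lra. }
apply Rle_trans with (1 := Rabs_triang _ _).
apply Rle_trans with (60 * (A0 + A2) * (s * i) + (2 * (A0 + A1) * (s * i) + A1 * (s * i))).
- apply Rplus_le_compat; [lra|]. apply Rle_trans with (1 := Rabs_triang _ _). lra.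
- assert (0 < s * i) by (apply Rmult_lt_0_compat; trivial).
  assert (0 <= A0 * (s * i)) by (apply Rmult_le_pos; lra).
  assert (0 <= A1 * (s * i)) by (apply Rmult_le_pos; lra).
  assert (0 <= A2 * (s * i)) by (apply Rmult_le_pos; lra). lra.
Qed.
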